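(* There exists a universal constant $C$ such that, for every $n\ge2$ and every radial log-concave probability measure $\mu$ on $\mathbb R^n$ whose support $K$ is bounded, $$C_{LS}(\mu)\le C\,\frac{\mathrm{diam}^2(K)}{n-1}.$$
   Context: A radial log-concave probability measure on $\mathbb R^n$ is one of the form $\mu(dx)=e^{-V(|x|)}dx$ with $V$ convex and non-decreasing on $[0,+\infty)$, possibly taking the value $+\infty$. $\mathrm{diam}(K)$ is the Euclidean diameter. $C_{LS}(\mu)$ is the best constant in the log-Sobolev inequality $\mu(f^2\ln f^2)-\mu(f^2)\ln\mu(f^2)\le C_{LS}(\mu)\,\mu(|\nabla f|^2)$ for all smooth $f$, where $\mu(f)=\int f\,d\mu$. *)

(* Defs.v *)
From HB Require Import structures.
From mathcomp Require Import all_boot all_order all_algebra.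
From mathcomp Require Import all_classical all_reals all_analysis.

Set Implicit Arguments.
Unset Strict Implicit.
Unset Printing Implicit Defensive.

Import Order.TTheory GRing.Theory Num.Theory.
Import numFieldNormedType.Exports.

Local Open Scope classical_set_scope.
Local Open Scope ring_scope.

Fact rV_display : measure_display. Proof. exact: default_measure_display. Qed.

(** The Borel sigma-algebra of [R^n], presented as the one generated by the
    coordinate functions, each of which is continuous; it contains the open sets
    by [open_measurable_rV] below. *)
Section measurable_rV.
Context {R : realType} {n : nat}.

Definition coord_rV (i : 'I_n) (x : 'rV[R]_n) : measurableTypeR R := x ord0 i.

Let rV_set0 : g_sigma_preimage coord_rV set0.
Proof. exact: sigma_algebra0. Qed.

Let rV_setC A : g_sigma_preimage coord_rV A -> g_sigma_preimage coord_rV (~` A).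
Proof. exact: sigma_algebraC. Qed.

Let rV_bigcup (F : _^nat) : (forall i, g_sigma_preimage coord_rV (F i)) ->
  g_sigma_preimage coord_rV (\bigcup_i (F i)).
Proof. exact: sigma_algebra_bigcup. Qed.

HB.instance Definition _ := @isMeasurable.Build rV_display
  'rV[R]_n (g_sigma_preimage coord_rV) rV_set0 rV_setC rV_bigcup.

Lemma measurable_coord_rV (i : 'I_n) : measurable_fun [set: 'rV[R]_n] (coord_rV i).
Proof.
move=> _ Y mY; rewrite setTI; apply: sub_sigma_algebra => /=.
rewrite -bigcup_seq/=; exists i => /=; first by rewrite mem_index_enum.
by exists Y => //; rewrite setTI.
Qed.

Lemma measurable_fun_rV d (T : measurableType d) (f : T -> 'rV[R]_n) :
  (forall i, measurable_fun [set: T] (coord_rV i \o f)) ->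
  measurable_fun [set: T] f.
Proof.
move=> mf _ Y mY.
suff sub : g_sigma_preimage (fun i => coord_rV i \o f) `<=` measurable.
  by apply: sub; rewrite g_sigma_preimage_comp; exists Y.
apply: smallest_sub; first exact: sigma_algebra_measurable.
rewrite -bigcup_seq; apply: bigcup_sub => i _.
by move=> A [B mB <-]; exact: mf.
Qed.

Lemma open_measurable_rV (U : set 'rV[R]_n) : open U -> measurable U.
Proof.
move=> oU.
pose q (p : 'rV[rat]_n * nat) : 'rV[R]_n := map_mx ratr p.1.
pose B p := ball (q p) (p.2.+1%:R^-1 : R).
pose I := [set p | B p `<=` U].
have mB p : measurable (B p).
  rewrite (_ : B p = \bigcap_(i in [set: 'I_n])
      (coord_rV i @^-1` ball (q p ord0 i) (p.2.+1%:R^-1 : R))); last first.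
    apply/seteqP; split=> x /=; first by move=> [_ xB] i _; exact: (xB ord0 i).
    by move=> xB; split=> [|i j]; [rewrite invr_gt0|rewrite ord1; exact: xB].
  apply: fin_bigcap_measurable => // i _.
  rewrite -[X in measurable X]setTI; apply: measurable_coord_rV => //.
  by rewrite ball_itv; exact: measurable_itv.
suff -> : U = \bigcup_p [set x | I p /\ B p x].
  apply: countable_bigcupT_measurable => [|p]; first exact: countableP.
  have [Ip|nIp] := pselect (I p).
    by rewrite (_ : mkset _ = B p)//; apply/seteqP; split=> [x []|].
  by rewrite (_ : mkset _ = set0)//; apply/seteqP; split=> [x []|].
apply/seteqP; split=> [x Ux|x [p _ [Ip]]]; last exact: Ip.
have /nbhs_ballP[e /= e0 eU] := oU x Ux.
have [k ke] : exists k : nat, 2 * (k.+1%:R^-1 : R) < e.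
  have := near_infty_natSinv_lt (PosNum (divr_gt0 e0 (ltr0n R 2))).
  move=> [k _ /(_ k (leqnn k)) /=]; rewrite ltr_pdivlMr// mulrC => ?.
  by exists k.
have qx i : {r : rat | `|x ord0 i - ratr r| < (k.+1%:R^-1 : R)}.
  apply: cid; have k0 : x ord0 i - (k.+1%:R^-1 : R) < x ord0 i + (k.+1%:R^-1 : R).
    by rewrite ltrD2l gtrN.
  have [r] := rat_in_itvoo k0; rewrite in_itv/= => /andP[r1 r2].
  by exists r; rewrite distrC ltr_distl r1 r2.
exists (\row_i sval (qx i), k) => //; split; last first.
  split=> [|i j]; first by rewrite invr_gt0.
  by rewrite (ord1 i) /q !mxE /= /ball/= distrC; exact: (svalP (qx j)).
move=> y [_ By]; apply: eU; split=> // i j; rewrite (ord1 i).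
have := By ord0 j; rewrite /q !mxE /= => qy.
apply: lt_trans ke; rewrite mulr_natl mulr2n.
apply: le_lt_trans (ler_distD (ratr (sval (qx j))) _ _) _.
by rewrite ltrD// (svalP (qx j)).
Qed.

End measurable_rV.

Section lebesgue_rV.
Context {R : realType}.

Definition cons_rV n (p : measurableTypeR R * 'rV[R]_n) : 'rV[R]_n.+1 :=
  \row_i (if unlift ord0 i is Some j then p.2 ord0 j else p.1).

Definition uncons_rV n (x : 'rV[R]_n.+1) : measurableTypeR R * 'rV[R]_n :=
  (x ord0 ord0, \row_j x ord0 (lift ord0 j)).

Lemma cons_rV0 n (p : measurableTypeR R * 'rV[R]_n) :
  cons_rV p ord0 ord0 = p.1.
Proof. by rewrite mxE unlift_none. Qed.

Lemma cons_rVS n (p : measurableTypeR R * 'rV[R]_n) j :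
  cons_rV p ord0 (lift ord0 j) = p.2 ord0 j.
Proof. by rewrite mxE liftK. Qed.

Lemma cons_rVK n : cancel (@cons_rV n) (@uncons_rV n).
Proof.
move=> [a v]; rewrite /uncons_rV cons_rV0; congr pair.
by apply/rowP => j; rewrite mxE cons_rVS.
Qed.

Lemma measurable_cons_rV n : measurable_fun setT (@cons_rV n).
Proof.
apply: measurable_fun_rV => i; case: (unliftP ord0 i) => [j ->|->].
  rewrite (_ : _ \o _ = coord_rV j \o snd); last first.
    by apply/funext => p /=; rewrite /coord_rV cons_rVS.
  by apply: measurableT_comp => //; exact: measurable_coord_rV.
rewrite (_ : _ \o _ = fst)//.
by apply/funext => p /=; rewrite /coord_rV cons_rV0.
Qed.

Lemma measurable_uncons_rV n : measurable_fun setT (@uncons_rV n).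
Proof.
apply/measurable_fun_pairP; split.
  exact: (measurable_coord_rV (ord0 : 'I_n.+1)).
apply: measurable_fun_rV => i.
rewrite (_ : _ \o _ = coord_rV (lift ord0 i)); first exact: measurable_coord_rV.
by apply/funext => x /=; rewrite /coord_rV /= mxE.
Qed.

Section step.
Context {n : nat} (m : {sigma_finite_measure set 'rV[R]_n -> \bar R}).

Definition lebesgue_cons : set 'rV[R]_n.+1 -> \bar R :=
  pushforward (lebesgue_measure \x m)%E (@cons_rV n).

Let measurable_preimage_cons_rV A :
  measurable A -> measurable (@cons_rV n @^-1` A).
Proof.
by move=> mA; rewrite -[X in measurable X]setTI; exact: measurable_cons_rV.
Qed.

Let lebesgue_cons0 : lebesgue_cons set0 = 0%E.
Proof. by rewrite /lebesgue_cons /pushforward preimage_set0 measure0. Qed.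

Let lebesgue_cons_ge0 A : (0 <= lebesgue_cons A)%E.
Proof. by rewrite /lebesgue_cons /pushforward measure_ge0. Qed.

Let lebesgue_cons_sigma_additive : semi_sigma_additive lebesgue_cons.
Proof.
move=> F mF tF mUF; rewrite /lebesgue_cons /pushforward preimage_bigcup.
apply: measure_semi_sigma_additive.
- by move=> k; exact: measurable_preimage_cons_rV.
- apply/trivIsetP => /= i j _ _ ij; rewrite -preimage_setI.
  by move/trivIsetP : tF => /(_ _ _ _ _ ij) ->//; rewrite preimage_set0.
- by rewrite -preimage_bigcup; exact: measurable_preimage_cons_rV.
Qed.

HB.instance Definition _ := isMeasure.Build _ _ _ lebesgue_cons
  lebesgue_cons0 lebesgue_cons_ge0 lebesgue_cons_sigma_additive.

Let lebesgue_cons_sigma_finite : sigma_finite setT lebesgue_cons.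
Proof.
have /sigma_finiteP[F [UF ndF Foo]] := sigma_finiteT (@lebesgue_measure R).
have /sigma_finiteP[G [UG ndG Goo]] := sigma_finiteT m.
exists (fun k => @uncons_rV n @^-1` (F k `*` G k)).
  rewrite -preimage_bigcup -[LHS](preimage_setT (@uncons_rV n)).
  congr (_ @^-1` _); rewrite -setXTT UF UG predeqE => -[x y]; split.
    move=> [/= [i _ Fix] [j _ Gjy]]; exists (maxn i j) => //; split.
    - by move: x Fix; exact/subsetPset/ndF/leq_maxl.
    - by move: y Gjy; exact/subsetPset/ndG/leq_maxr.
  by move=> [i _ []/= ? ?]; split; exists i.
move=> k; have [mF Fkoo] := Foo k; have [mG Gkoo] := Goo k; split.
  rewrite -[X in measurable X]setTI.
  by apply: measurable_uncons_rV => //; exact: measurableX.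
rewrite /lebesgue_cons /pushforward -comp_preimage.
rewrite (_ : _ \o _ = id) ?preimage_id//; last first.
  by apply/funext => p /=; rewrite cons_rVK.
by rewrite product_measure1E// lte_mul_pinfty// ge0_fin_numE.
Qed.

HB.instance Definition _ :=
  Measure_isSigmaFinite.Build _ _ _ lebesgue_cons lebesgue_cons_sigma_finite.

End step.

Fixpoint lebesgue_rV n : {sigma_finite_measure set 'rV[R]_n -> \bar R} :=
  match n with
  | 0 => \d_(0 : 'rV[R]_0)
  | n'.+1 => lebesgue_cons (lebesgue_rV n')
  end.

Lemma lebesgue_rV_box n (A : 'I_n -> set (measurableTypeR R)) :
  (forall i, measurable (A i)) ->
  lebesgue_rV n [set x : 'rV[R]_n | forall i, A i (x ord0 i)] =
  (\prod_(i < n) lebesgue_measure (A i))%E.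
Proof.
elim: n A => [|n IH] A mA.
  rewrite big_ord0 /= diracE mem_set//= => -[]//.
rewrite big_ord_recl -IH//= /lebesgue_cons /pushforward.
rewrite -product_measure1E//=; last first.
  rewrite (_ : mkset _ = \bigcap_(i in [set: 'I_n])
      (coord_rV i @^-1` A (lift ord0 i))).
    apply: fin_bigcap_measurable => // i _.
    by rewrite -[X in measurable X]setTI; exact: measurable_coord_rV.
  by apply/seteqP; split=> x /= xA i => [_|]; exact: xA.
congr (_ _); apply/seteqP; split=> -[a v] /=.
  move=> Av; split=> [|i].
    by have := Av ord0; rewrite cons_rV0.
  by have := Av (lift ord0 i); rewrite cons_rVS.
move=> [Aa Av] i; case: (unliftP ord0 i) => [j ->|->].
  by rewrite cons_rVS; exact: Av.
by rewrite cons_rV0.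
Qed.

End lebesgue_rV.

(** The library's norm on ['rV[R]_n] is the sup norm, hence [enorm]. *)
Definition enorm {R : realType} {n : nat} (x : 'rV[R]_n) : R :=
  Num.sqrt (\sum_(i < n) x ord0 i ^+ 2).

Definition diam {R : realType} {n : nat} (K : set 'rV[R]_n) : \bar R :=
  ereal_sup [set (enorm (x - y))%:E | x in K & y in K].

Definition msupport {R : realType} {n : nat}
    (mu : set 'rV[R]_n -> \bar R) : set 'rV[R]_n :=
  [set x | forall U, open U -> U x -> (0 < mu U)%E].

Definition grad {R : realType} {n : nat} (f : 'rV[R]_n -> R) (x : 'rV[R]_n) :
  'rV[R]_n := \row_i 'D_(delta_mx ord0 i) f x.

Fixpoint Ck {R : realType} {n : nat} (k : nat) (f : 'rV[R]_n -> R) : Prop :=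
  match k with
  | 0 => continuous f
  | k'.+1 => (forall x, differentiable f x) /\
             (forall i, Ck k' (fun x => grad f x ord0 i))
  end.

Definition smooth {R : realType} {n : nat} (f : 'rV[R]_n -> R) : Prop :=
  forall k, Ck k f.

(** When [f ^+ 2] is not integrable, the subtracted term is [+oo] and the value
    is [-oo]: such an [f] imposes no condition in [log_sobolev]. *)
Definition entropy_sq {R : realType} {n : nat}
    (mu : probability 'rV[R]_n R) (f : 'rV[R]_n -> R) : \bar R :=
  ((\int[mu]_x (f x ^+ 2 * ln (f x ^+ 2))%:E) -
   (\int[mu]_x (f x ^+ 2)%:E) * lne (\int[mu]_x (f x ^+ 2)%:E))%E.

Definition log_sobolev {R : realType} {n : nat}
    (mu : probability 'rV[R]_n R) (c : R) : Prop :=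
  forall f : 'rV[R]_n -> R, smooth f ->
    (entropy_sq mu f <= c%:E * \int[mu]_x (enorm (grad f x) ^+ 2)%:E)%E.

Definition C_LS {R : realType} {n : nat} (mu : probability 'rV[R]_n R) : \bar R :=
  ereal_inf [set c%:E | c in [set c : R | 0 <= c /\ log_sobolev mu c]].

(** At the endpoints [t = 0, 1] the convention [0 * +oo = 0] is the right one. *)
Definition convex_on_nneg {R : realType} (V : R -> \bar R) : Prop :=
  forall r s t : R, 0 <= r -> 0 <= s -> 0 <= t <= 1 ->
    (V (t * r + (1 - t) * s)%R <= t%:E * V r + (1 - t)%:E * V s)%E.

Definition nondecreasing_on_nneg {R : realType} (V : R -> \bar R) : Prop :=
  forall r s : R, 0 <= r -> r <= s -> (V r <= V s)%E.

Definition radial_log_concave {R : realType} {n : nat}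
    (mu : probability 'rV[R]_n R) : Prop :=
  exists V : R -> \bar R,
    [/\ forall r, 0 <= r -> (-oo < V r)%E,
        convex_on_nneg V,
        nondecreasing_on_nneg V &
        forall A, measurable A ->
          mu A = (\int[lebesgue_rV n]_(x in A) expeR (- V (enorm x)))%E].

(* Main.v *)
From HB Require Import structures.
Require Import Defs.
From mathcomp Require Import all_boot all_order all_algebra.
From mathcomp Require Import all_classical all_reals all_analysis.
From mathcomp Require Import measurable_realfun ring lra.

(** Let [mu] have density [k (|x|)] on the [n]-dimensional space, with [k]
    nonincreasing and log-concave, put [d = n - 1] and let [r] be the radius of
    the support, which is at most its diameter. By rotation invariance [mu] is the
    law of [rho X / |X|], where [rho] has density proportional to [rho^d k rho] on
    [(0, r]] and [X] is an independent centered Gaussian vector.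

    The concentration of [mu] is that of the pair [(rho, X)]. The factor [rho^d]
    makes the density of the radius strongly log-concave: the second derivative of
    [- d ln rho] is at least [d / r^2] on [(0, r]]
    ([radial_weight_strongly_log_concave]). Taking the covariance of [X] of order
    [r^2 / d], the density of the pair is strongly log-concave with constant
    [c = d / (2 r^2)], and such a density satisfies a log-Sobolev inequality of
    constant [2 / c]. This is deduced from the Prekopa-Leindler inequality as in
    Bobkov and Ledoux ([prekopa_leindler], [strongly_log_concave_entropy_le]), a
    method that handles the support constraint and the nonsmooth [k] with no
    approximation.

    To come back to [mu], push the inequality forward by the ray map
    [(rho, x) |-> rho x / |x|]. It multiplies gradients at a pair by at most
    [kap = 1 + 2 r / |x|] ([ray_map_lipschitz]), which is unbounded; but [kap]
    depends on [x] only through [|x|], which is independent of [rho X / |X|], so it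
    may be averaged separately. The average of [|X|^-2] is of order [c / d], that
    is [1 / r^2], as soon as [n >= 3] ([gaussian_moment_ratio]), so that the average
    of [kap^2] is bounded by a universal constant. Altogether the constant for [mu]
    is of order [1 / c], that is [r^2 / d] ([log_sobolev_ray]).

    In the plane the average of [|X|^-2] is infinite. There [n - 1 = 1], and it is
    enough to have a constant of order [r^2]: the measure
    [exp (- |x|^2 / (2 r^2)) mu] is strongly log-concave with constant [1 / r^2], and
    differs from [mu] by a density between [exp (- 1 / 2)] and 1 on the support
    ([log_sobolev_perturbation]).

    Both cases are instances of one statement ([log_sobolev_entropy_le]) about the
    image of a strongly log-concave measure under a locally Lipschitz map. The
    independence of norm and direction is obtained from a form of polar coordinates
    that involves only scalings of Lebesgue measure ([ge0_integral_polar]). *)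

Set Implicit Arguments.
Unset Strict Implicit.
Unset Printing Implicit Defensive.

Import Order.TTheory GRing.Theory Num.Theory.
Import numFieldNormedType.Exports.
Local Open Scope classical_set_scope.
Local Open Scope ring_scope.

(** * The Brunn-Minkowski inequality on the line *)

Section one_dimensional.
Context {R : realType}.
Local Notation leb := (@lebesgue_measure R).
Local Notation RR := (measurableTypeR R).

Lemma measurable_affine (t b : R) :
  measurable_fun [set: RR] (fun x : RR => t * x + b : RR).
Proof. by apply: measurable_funD => //; apply: measurable_funM. Qed.

Lemma lebesgue_affine (t b : R) (A : set RR) : 0 < t -> measurable A ->
  (t%:E * leb ((fun x => (t * x + b)%R) @^-1` A) = leb A)%E.
Proof.
move=> t0 mA.
pose mf := measurable_affine t b.
pose m : {measure set RR -> \bar R} := mscale (NngNum (ltW t0))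
  (measure_function_pushforward__canonical__measure_function_Measure
    lebesgue_measure mf).
apply/esym; rewrite (@lebesgue_measure_unique _ m) // => _ [[a c] /= _ <-].
rewrite /m /mscale /= /pushforward.
have -> : (fun x => t * x + b) @^-1` [set` `]a, c]] =
    `](a - b) / t, (c - b) / t]%classic.
  apply/seteqP; split=> x /=; rewrite !in_itv /= => /andP[h1 h2].
    by rewrite ltr_pdivrMr// ler_pdivlMr// ltrBlDr lerBrDr ![x * t]mulrC h1 h2.
  move: h1 h2; rewrite ltr_pdivrMr// ler_pdivlMr// ltrBlDr lerBrDr.
  by rewrite ![x * t]mulrC => -> ->.
rewrite !lebesgue_measure_itv /= !lte_fin ltr_pM2r ?invr_gt0// ltrD2r.
case: ifP => _; last by rewrite mule0.
by rewrite -!EFinB -EFinM; congr (_%:E); field; rewrite gt_eqF.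
Qed.

Lemma ge0_integral_affine (t b : R) (h : RR -> \bar R) : 0 < t ->
  measurable_fun [set: RR] h -> (forall x, 0 <= h x)%E ->
  (t%:E * \int[leb]_x h (t * x + b)%R = \int[leb]_x h x)%E.
Proof.
move=> t0 mh h0.
pose mf := measurable_affine t b.
have -> : (\int[leb]_x h (t * x + b)%R =
    \int[pushforward leb (fun x : RR => (t * x + b)%R : RR)]_x h x)%E.
  by rewrite ge0_integral_pushforward.
pose m : {measure set RR -> \bar R} :=
  measure_function_pushforward__canonical__measure_function_Measure
    lebesgue_measure mf.
rewrite -(@ge0_integral_mscale _ _ _ m setT measurableT (NngNum (ltW t0)) h)//.
by apply: eq_measure_integral => A mA _; exact: lebesgue_affine.
Qed.

(** Compact sets [K] and [L] have a largest point [a0] and a smallest point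
    [b0]; the two pieces [t K + (1 - t) b0] and [t a0 + (1 - t) L] of the
    Minkowski sum then meet in at most one point. *)
Let brunn_minkowski_compact (t : R) (K L C : set RR) : 0 < t < 1 ->
  compact K -> compact L -> measurable C -> K !=set0 -> L !=set0 ->
  (forall x y, K x -> L y -> C (t * x + (1 - t) * y)) ->
  (t%:E * leb K + (1 - t)%:E * leb L <= leb C)%E.
Proof.
move=> /andP[t0 t1] cK cL mC K0 L0 KLC.
have s0 : 0 < 1 - t by rewrite subr_gt0.
have ci (A : set R) : {within A, continuous (@idfun R)}.
  by apply: continuous_subspaceT => x; exact: cvg_id.
have [a /set_mem Ka amax] := compact_EVT_max K0 cK (ci K).
have [b /set_mem Lb bmin] := compact_EVT_min L0 cL (ci L).
have mK := compact_measurable cK; have mL := compact_measurable cL.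
pose P := (fun x : RR => (t^-1 * x + - (t^-1 * ((1 - t) * b)))) @^-1` K.
pose Q := (fun x : RR => ((1 - t)^-1 * x + - ((1 - t)^-1 * (t * a)))) @^-1` L.
have mP : measurable P.
  by rewrite -[X in measurable X]setTI; exact: (@measurable_affine _ _).
have mQ : measurable Q.
  by rewrite -[X in measurable X]setTI; exact: (@measurable_affine _ _).
have PE : (t%:E * leb K = leb P)%E.
  rewrite -(@lebesgue_affine t^-1 (- (t^-1 * ((1 - t) * b))) K) ?invr_gt0//.
  by rewrite muleA -EFinM divff ?gt_eqF// mul1e.
have QE : ((1 - t)%:E * leb L = leb Q)%E.
  rewrite -(@lebesgue_affine (1 - t)^-1 (- ((1 - t)^-1 * (t * a))) L) ?invr_gt0//.
  by rewrite muleA -EFinM divff ?gt_eqF// mul1e.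
rewrite PE QE.
have Poo : (leb P < +oo)%E.
  by rewrite -PE lte_mul_pinfty// ?lee_fin ?ltW// compact_finite_measure.
have PQ0 : leb (P `&` Q) = 0%E.
  apply/eqP; rewrite eq_le measure_ge0 andbT.
  rewrite -(lebesgue_measure_set1 (t * a + (1 - t) * b)).
  apply: le_measure; rewrite ?inE//; first exact: measurableI.
  move=> x /= [/mem_set Px /mem_set Qx].
  have := amax _ Px; have := bmin _ Qx; rewrite /=.
  rewrite -!mulrBr ![_^-1 * _]mulrC ler_pdivlMr// ler_pdivrMr// => h1 h2.
  by apply/eqP; rewrite eq_le; apply/andP; split; lra.
have -> : (leb P + leb Q = leb (P `|` Q))%E.
  apply: etrans (esym (measureUfinl mP mQ Poo)).
  by rewrite [X in (_ = _ - X)%E]PQ0 sube0.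
apply: le_measure; rewrite ?inE//; first exact: measurableU.
move=> x [Px|Qx].
  have := KLC _ _ Px Lb; rewrite /=; congr C; field; by rewrite gt_eqF.
have := KLC _ _ Ka Qx; rewrite /=; congr C; field; by rewrite gt_eqF.
Qed.

(** Inner regularity reduces to compact sets; the sums [t A + (1 - t) B] need
    not be measurable, whence the separate set [C]. *)
Lemma brunn_minkowski1 (t : R) (A B C : set RR) : 0 < t < 1 ->
  measurable A -> measurable B -> measurable C -> A !=set0 -> B !=set0 ->
  (forall x y, A x -> B y -> C (t * x + (1 - t) * y)) ->
  (t%:E * leb A + (1 - t)%:E * leb B <= leb C)%E.
Proof.
move=> t01 mA mB mC A0 B0 ABC; have /andP[t0 t1] := t01.
have s0 : 0 < 1 - t by rewrite subr_gt0.
have ne (D K : set RR) : D !=set0 -> compact K -> K `<=` D ->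
    exists K', [/\ compact K', K' `<=` D, K' !=set0 & (leb K <= leb K')%E].
  move=> [x Dx] cK KD; have [->|K0] := eqVneq K set0.
    exists [set x]; split; [exact: compact_set1|by move=> _ ->|by exists x|].
    by rewrite measure0.
  by exists K; split => //; exact/set0P.
have key (K L : set RR) : compact K -> K `<=` A -> compact L -> L `<=` B ->
    (t%:E * leb K + (1 - t)%:E * leb L <= leb C)%E.
  move=> cK KA cL LB.
  have [K' [cK' KA' K0' KK']] := ne _ _ A0 cK KA.
  have [L' [cL' LB' L0' LL']] := ne _ _ B0 cL LB.
  apply: (@le_trans _ _ (t%:E * leb K' + (1 - t)%:E * leb L')%E).
    by apply: leeD; apply: lee_pmul => //; rewrite lee_fin ltW.
  by apply: brunn_minkowski_compact => // x y /KA' Ax /LB' By; exact: ABC.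
have keyA (L : set RR) : compact L -> L `<=` B ->
    (t%:E * leb A + (1 - t)%:E * leb L <= leb C)%E.
  move=> cL LB.
  have fL : ((1 - t)%:E * leb L)%E \is a fin_num.
    by rewrite fin_numM// ge0_fin_numE// compact_finite_measure.
  rewrite -leeBrDr// -lee_pdivlMl// lebesgue_regularity_inner_sup//.
  apply: ge_ereal_sup => _ [K [cK KA] <-].
  by rewrite lee_pdivlMl// leeBrDr//; exact: key.
have [Aoo|Aoo] := eqVneq (leb A) +oo%E.
  rewrite Aoo gt0_muley ?lte_fin// addye; last first.
    by rewrite gt_eqF// (lt_le_trans ltNy0)// mule_ge0// lee_fin ltW.
  have := @keyA set0 (@compact0 _) (@sub0set _ _).
  by rewrite Aoo gt0_muley ?lte_fin// measure0 mule0 adde0.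
have fA : (t%:E * leb A)%E \is a fin_num.
  by rewrite fin_numM// ge0_fin_numE// ltey.
rewrite -leeBrDl// -lee_pdivlMl// (lebesgue_regularity_inner_sup mB).
apply: ge_ereal_sup => _ [L [cL LB] <-].
by rewrite lee_pdivlMl// leeBrDl//; exact: keyA.
Qed.

End one_dimensional.

(** * The Prekopa-Leindler inequality on the line *)

Section layer_cake.
Context d (T : measurableType d) {R : realType}
  (m : {sigma_finite_measure set T -> \bar R}).
Local Notation leb := (@lebesgue_measure R).
Local Notation RR := (measurableTypeR R).
Local Open Scope ereal_scope.
Variable u : T -> \bar R.
Hypothesis mu : measurable_fun [set: T] u.
Hypothesis u0 : forall x, 0 <= u x.

Let S := [set p : RR * T | (p.1%:E < u p.2)%E].

Let mS : measurable S.
Proof.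
rewrite -[S]setTI; apply: measurable_lte => //.
  by apply/measurable_EFinP; exact: measurable_fst.
by apply: measurableT_comp => //; exact: measurable_snd.
Qed.

Let layerE (l : R) : m [set x | l%:E < u x] = \int[m]_x (\1_S (l, x))%:E.
Proof.
have mA : measurable [set x | l%:E < u x].
  by rewrite -[X in measurable X]setTI; apply: measurable_lte.
rewrite -[X in m X]setIT -(@integral_indic _ _ _ m setT measurableT)//.
Qed.

Lemma measurable_superlevel : measurable_fun [set: RR]
  (fun l : RR => m [set x | l%:E < u x]).
Proof.
under eq_fun do rewrite layerE.
apply: (measurable_fun_fubini_tonelli_F (m2 := m)
  (fun p => (\1_S p)%:E)).
- by apply/measurable_EFinP; exact: measurable_indic.
- by move=> p; rewrite lee_fin.
Qed.

(** The layer-cake formula restricted to levels below 1, the only ones that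
    matter for functions of supremum 1. *)
Lemma layer_cake_le1 :
  \int[leb]_(l in `]0%R, 1%R[) m [set x | l%:E < u x] =
  \int[m]_x mine (u x) 1.
Proof.
rewrite integral_mkcond.
pose D := `]0%R, 1%R[%classic : set RR.
transitivity (\int[leb]_l \int[m]_x (\1_((D `*` setT) `&` S) (l, x))%:E).
  apply: eq_integral => l _; rewrite patchE layerE.
  case: ifPn => [/set_mem|/negP] lD.
    apply: eq_integral => x _; rewrite !indicE; congr ((_ : bool)%:R%:E).
    by rewrite in_setI (mem_set (A := D `*` setT)).
  under eq_integral => x _.
    rewrite indicE memNset; last by case=> -[/= /mem_set].
    over.
  by rewrite integral0.
rewrite (fubini_tonelli (m1 := leb) (m2 := m)
  (fun p => (\1_((D `*` setT) `&` S) p)%:E)); last 2 first.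
- apply/measurable_EFinP/measurable_indic; apply: measurableI => //.
  by apply: measurableX => //; exact: measurable_itv.
- by move=> p; rewrite lee_fin.
apply: eq_integral => x _.
transitivity (leb (D `&` [set l : RR | l%:E < u x])).
  have mA : measurable (D `&` [set l : RR | l%:E < u x]).
    apply: measurableI; first exact: measurable_itv.
    by rewrite -[X in measurable X]setTI; apply: measurable_lte.
  rewrite -[X in leb X]setIT -(@integral_indic _ _ _ leb setT measurableT)//.
  apply: eq_integral => l _; rewrite !indicE; congr ((_ : bool)%:R%:E).
  by apply/idP/idP => /set_mem [a b]; apply/mem_set; split => //; case: a.
have : 0 <= u x by [].
case: (u x) => [r||//]; rewrite ?lee_fin => r0.
- have [r1|r1] := ltP r 1%R.
  + rewrite (_ : D `&` _ = `]0%R, r[%classic); last first.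
      apply/seteqP; split=> l; rewrite /D /= !in_itv /= lte_fin.
        by move=> [/andP[-> _] ->].
      by move=> /andP[-> lr]; rewrite lr (lt_trans lr r1).
    rewrite lebesgue_measure_itv /= lte_fin /mine lte_fin r1.
    by case: ltgtP r0 => // [r0|<-] _; rewrite ?oppr0 ?adde0 ?sube0.
  + rewrite (_ : D `&` _ = D); last first.
      apply/seteqP; split=> l /=; first by case.
      by rewrite /D /= in_itv /= lte_fin => /andP[-> l1]; rewrite l1 (lt_le_trans l1 r1).
    by rewrite lebesgue_measure_itv /= lte_fin ltr01 sube0 /mine lte_fin ltNge r1.
- rewrite (_ : D `&` _ = D); last first.
    by apply/seteqP; split=> l /=; [case|move=> lD; split; rewrite ?ltry].
  by rewrite lebesgue_measure_itv /= lte_fin ltr01 sube0 /mine ltNge leey.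
Qed.

End layer_cake.

Lemma powR_AMGM {R : realType} (t a b : R) : 0 < t < 1 -> 0 < a -> 0 < b ->
  a `^ t * b `^ (1 - t) <= t * a + (1 - t) * b.
Proof.
move=> /andP[t0 t1] a0 b0; have s0 : 0 < 1 - t by rewrite subr_gt0.
have m0 : 0 < t * a + (1 - t) * b by rewrite addr_gt0// mulr_gt0.
set m := t * a + _ in m0 *.
rewrite /powR !gt_eqF// -expRD -[leRHS]lnK ?posrE// ler_expR.
have ineq x : 0 < x -> ln x <= ln m + (x / m - 1).
  move=> x0; have -> : ln x = ln m + ln (x / m).
    by rewrite ln_div ?posrE// addrC subrK.
  by rewrite lerD2l -{1}(subrKC 1 (x / m)) le_ln1Dx// ltrBrDr addNr divr_gt0.
have ha := ineq a a0; have hb := ineq b b0.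
rewrite -(ler_pM2l t0) in ha; rewrite -(ler_pM2l s0) in hb.
apply: le_trans (lerD ha hb) _.
suff e : t * (a / m) + (1 - t) * (b / m) = 1 by lra.
by rewrite !mulrA -mulrDl divff ?gt_eqF.
Qed.

(** The hypothesis of the Prekopa-Leindler inequality, stated through real
    numbers strictly below [u x] and [v y], so that infinite values never meet a
    real power. *)
Definition pl_le1 {R : realType} (t : R) (u v w : R -> \bar R) :=
  forall (x y a b : R), 0 < a -> 0 < b -> (a%:E < u x)%E -> (b%:E < v y)%E ->
    ((a `^ t * b `^ (1 - t))%:E <= w (t * x + (1 - t) * y)%R)%E.

Section prekopa_leindler1.
Context {R : realType}.
Local Notation leb := (@lebesgue_measure R).
Local Notation RR := (measurableTypeR R).
Local Open Scope ereal_scope.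

(** When both suprema are 1, all superlevel sets of [u] and [v] at levels below
    1 are nonempty, so the Brunn-Minkowski inequality applies at each level and
    can be integrated. The result is additive, hence stronger than the
    multiplicative form. *)
Lemma prekopa_leindler1_normalized (t : R) (u v w : RR -> \bar R) :
  (0 < t < 1)%R ->
  measurable_fun setT u -> measurable_fun setT v -> measurable_fun setT w ->
  (forall x, 0 <= u x <= 1) -> (forall x, 0 <= v x <= 1) ->
  (forall x, 0 <= w x) ->
  (forall l : R, (0 < l < 1)%R -> exists x, l%:E < u x) ->
  (forall l : R, (0 < l < 1)%R -> exists x, l%:E < v x) ->
  (forall (l x y : R), (0 < l < 1)%R -> l%:E < u x -> l%:E < v y ->
    l%:E < w (t * x + (1 - t) * y)%R) ->
  t%:E * \int[leb]_x u x + (1 - t)%:E * \int[leb]_x v x <= \int[leb]_x w x.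
Proof.
move=> t01 mu mv mw u01 v01 w0 neu nev uvw.
have /andP[t0 t1] := t01; have s0 : (0 < 1 - t)%R by rewrite subr_gt0.
have u0 x : 0 <= u x by case/andP: (u01 x).
have v0 x : 0 <= v x by case/andP: (v01 x).
apply: (@le_trans _ _ (\int[leb]_x mine (w x) 1)); last first.
  apply: ge0_le_integral => //.
  - by move=> x _; rewrite le_min w0 lee01.
  - exact: measurable_mine.
  - by move=> x _; rewrite ge_min lexx.
have cap1 (f : RR -> \bar R) : (forall x, 0 <= f x <= 1) ->
    \int[leb]_x f x = \int[leb]_x mine (f x) 1.
  move=> f01; apply: eq_integral => x _; apply/esym/min_idPl.
  by case/andP: (f01 x).
rewrite (cap1 u)// (cap1 v)// -!layer_cake_le1//.
have mi : measurable (`]0%R, 1%R[%classic : set RR) by exact: measurable_itv.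
rewrite -!ge0_integralZl ?lee_fin ?(ltW t0) ?(ltW s0)//;
  try (by apply: measurable_funTS; exact: (@measurable_superlevel _ RR R leb)).
have mc (c : R) (f : RR -> \bar R) : measurable_fun setT f ->
    measurable_fun (`]0%R, 1%R[%classic : set RR)
      (fun l : RR => c%:E * leb [set x | l%:E < f x]).
  move=> mf; apply: measurable_funeM; apply: measurable_funTS.
  exact: (@measurable_superlevel _ RR R leb).
have ge0c (c : R) (f : RR -> \bar R) (l : R) : (0 < c)%R ->
    0 <= c%:E * leb [set x | l%:E < f x].
  by move=> c0; rewrite mule_ge0// lee_fin ltW.
rewrite -ge0_integralD//; try (by move=> l _; exact: ge0c); try exact: mc.
apply: ge0_le_integral => //.
- by move=> l _; rewrite adde_ge0// ge0c.
- by apply: emeasurable_funD; exact: mc.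
- by apply: measurable_funTS; exact: (@measurable_superlevel _ RR R leb).
have ms (f : RR -> \bar R) l : measurable_fun setT f ->
    measurable [set x | l%:E < f x].
  by move=> mf; rewrite -[X in measurable X]setTI; apply: measurable_lte.
move=> l /=; rewrite in_itv /= => l01.
apply: brunn_minkowski1 => //; try exact: ms.
- exact: neu.
- exact: nev.
- by move=> x y /= ux vy; exact: uvw.
Qed.

Lemma integral_truncation d (T : measurableType d)
    (m : {measure set T -> \bar R}) (u : T -> \bar R) (a : R) :
  measurable_fun setT u -> (forall x, 0 <= u x) -> a%:E < \int[m]_x u x ->
  \forall k \near \oo, a%:E < \int[m]_x mine (u x) k%:R%:E.
Proof.
move=> mu u0 au.
have cvg : \int[m]_x mine (u x) k%:R%:E @[k --> \oo] --> \int[m]_x u x.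
  rewrite (_ : \int[m]_x u x =
      \int[m]_x limn (fun k => mine (u x) k%:R%:E)); last first.
    apply: eq_integral => x _; apply/esym/cvg_lim => //.
    have := u0 x; case: (u x) => [r r0| _|//].
      apply: cvg_near_cst; near=> k; apply/min_idPl; rewrite lee_fin.
      by near: k; exact: nbhs_infty_ger.
    apply/cvgeyPgt => A; near=> k; rewrite minye lte_fin.
    by near: k; exact: nbhs_infty_gtr.
  apply: cvg_monotone_convergence => //.
  - by move=> k; apply: measurable_mine => //; exact: measurable_cst.
  - by move=> k x _; rewrite le_min u0 lee_fin ler0n.
  - move=> x _ k l kl; rewrite le_min !ge_min lexx /=.
    by rewrite lee_fin ler_nat kl orbT.
exact: cvg _ (open_ereal_gt' au).
Unshelve. all: by end_near. Qed.

Lemma bounded_sup (T : Type) (f : T -> \bar R) (K : R) :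
  (forall x, 0 <= f x <= K%:E) -> (exists x, 0 < f x) ->
  exists al : R, [/\ (0 < al)%R, forall x, f x <= al%:E &
    forall c : R, (c < al)%R -> exists x, c%:E < f x].
Proof.
move=> fK [x0 fx0].
have ub x : f x <= ereal_sup (range f) by apply: ereal_sup_ubound; exists x.
have sK : ereal_sup (range f) <= K%:E.
  by apply: ge_ereal_sup => _ [x _ <-]; case/andP: (fK x).
have s0 : 0 < ereal_sup (range f) by exact: lt_le_trans fx0 (ub _).
case E : (ereal_sup (range f)) ub sK s0 => [al| |] // ub sK s0.
exists al; split => // c; rewrite -lte_fin -E => /ereal_sup_gt[_ [x _ <-] cx].
by exists x.
Qed.

(** After truncation the suprema [al], [be] of [u], [v] are finite; dividing by
    them (and [w] by their geometric mean) gives the normalized case, and the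
    inequality of arithmetic and geometric means turns the additive conclusion
    into the multiplicative one. *)
Theorem prekopa_leindler1 (t : R) (u v w : RR -> \bar R) :
  (0 < t < 1)%R ->
  measurable_fun setT u -> measurable_fun setT v -> measurable_fun setT w ->
  (forall x, 0 <= u x) -> (forall x, 0 <= v x) -> (forall x, 0 <= w x) ->
  pl_le1 t u v w ->
  forall a b : R, (0 < a)%R -> (0 < b)%R ->
    a%:E < \int[leb]_x u x -> b%:E < \int[leb]_x v x ->
    (a `^ t * b `^ (1 - t))%:E <= \int[leb]_x w x.
Proof.
move=> t01 mu mv mw u0 v0 w0 uvw a b a0 b0 au bv.
have /andP[t0 t1] := t01; have s0 : (0 < 1 - t)%R by rewrite subr_gt0.
have [K [aK bK]] : exists K : nat, a%:E < \int[leb]_x mine (u x) K%:R%:E /\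
    b%:E < \int[leb]_x mine (v x) K%:R%:E.
  have [K _ hK] := filterI (integral_truncation mu u0 au)
                           (integral_truncation mv v0 bv).
  by exists K; exact: (hK K (leqnn K)).
have pos (f : RR -> \bar R) (c : R) : (0 < c)%R -> (forall x, 0 <= f x) ->
    c%:E < \int[leb]_x f x -> exists x, 0 < f x.
  move=> c0 f0 cf; apply: contrapT => /forallNP nf.
  move: cf; rewrite (_ : \int[leb]_x f x = 0) ?lte_fin ?ltNge ?(ltW c0)//.
  apply: integral0_eq => x _; apply/eqP; rewrite eq_le f0 andbT leNgt.
  exact/negP/nf.
have cut0 (f : RR -> \bar R) : (forall x, 0 <= f x) ->
    forall x, 0 <= mine (f x) K%:R%:E <= K%:R%:E.
  by move=> f0 x; rewrite le_min f0 lee_fin ler0n ge_min lexx orbT.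
have u'K := cut0 u u0; have v'K := cut0 v v0.
set u' := fun x => mine (u x) K%:R%:E in aK u'K.
set v' := fun x => mine (v x) K%:R%:E in bK v'K.
have u'0 x : 0 <= u' x by case/andP: (u'K x).
have v'0 x : 0 <= v' x by case/andP: (v'K x).
have mu' : measurable_fun setT u' by exact: measurable_mine.
have mv' : measurable_fun setT v' by exact: measurable_mine.
have [al [al0 ual alu]] := bounded_sup u'K (pos _ _ a0 u'0 aK).
have [be [be0 vbe bev]] := bounded_sup v'K (pos _ _ b0 v'0 bK).
pose ga := (al `^ t * be `^ (1 - t))%R.
have ga0 : (0 < ga)%R by rewrite mulr_gt0// powR_gt0.
have norm01 (f : RR -> \bar R) (c : R) : (0 < c)%R -> (forall x, 0 <= f x) ->
    (forall x, f x <= c%:E) -> forall x, 0 <= (c^-1)%:E * f x <= 1.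
  move=> c0 f0 fc x; rewrite mule_ge0 ?lee_fin ?invr_ge0 ?(ltW c0)//=.
  by rewrite lee_pdivrMl// mule1.
have := @prekopa_leindler1_normalized t (fun x => (al^-1)%:E * u' x)
  (fun x => (be^-1)%:E * v' x) (fun x => (ga^-1)%:E * w x) t01.
move=> /(_ (measurable_funeM _ mu') (measurable_funeM _ mv')
  (measurable_funeM _ mw) (norm01 _ _ al0 u'0 ual) (norm01 _ _ be0 v'0 vbe)).
have w1 x : 0 <= (ga^-1)%:E * w x.
  by rewrite mule_ge0// lee_fin invr_ge0 ltW.
have u1 l : (0 < l < 1)%R -> exists x, l%:E < (al^-1)%:E * u' x.
  move=> /andP[l0 l1]; have [|x] := alu (al * l)%R; first by rewrite gtr_pMr.
  by exists x; rewrite lte_pdivlMl// -EFinM.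
have v1 l : (0 < l < 1)%R -> exists x, l%:E < (be^-1)%:E * v' x.
  move=> /andP[l0 l1]; have [|x] := bev (be * l)%R; first by rewrite gtr_pMr.
  by exists x; rewrite lte_pdivlMl// -EFinM.
move=> /(_ w1 u1 v1) H.
have {}H : t%:E * ((al^-1)%:E * \int[leb]_x u' x) +
    (1 - t)%:E * ((be^-1)%:E * \int[leb]_x v' x) <=
    (ga^-1)%:E * \int[leb]_x w x.
  have Z (c : R) (f : RR -> \bar R) : (0 < c)%R -> measurable_fun setT f ->
      (forall x, 0 <= f x) ->
      (c^-1)%:E * \int[leb]_x f x = \int[leb]_x ((c^-1)%:E * f x).
    by move=> c0 mf f0; rewrite ge0_integralZl// lee_fin invr_ge0 ltW.
  rewrite !Z//.
  apply: H => l x y /andP[l0 l1]; rewrite !lte_pdivlMl// -!EFinM => lu lv.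
  have [p pE] : exists p : R, u' x = p%:E.
    exists (fine (u' x)); rewrite fineK// ge0_fin_numE//.
    by case/andP: (u'K x) => _ /le_lt_trans; apply; rewrite ltry.
  have [q qE] : exists q : R, v' y = q%:E.
    exists (fine (v' y)); rewrite fineK// ge0_fin_numE//.
    by case/andP: (v'K y) => _ /le_lt_trans; apply; rewrite ltry.
  move: lu lv; rewrite pE qE !lte_fin => lu lv.
  (* The hypothesis gives [w >= ga l'], and a strict [w > ga l] is wanted. *)
  pose l' := ((l + Num.min (p / al) (q / be)) / 2)%R.
  have lmin : (l < Num.min (p / al) (q / be))%R.
    by rewrite lt_min !ltr_pdivlMr// ![(l * _)%R]mulrC lu.
  have ll' : (l < l')%R by rewrite /l'; lra.
  have l'p : (al * l' < p)%R.
    rewrite mulrC -ltr_pdivlMr//.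
    apply: (@lt_le_trans _ _ (Num.min (p / al) (q / be))%R); first by rewrite /l'; lra.
    by rewrite ge_min lexx.
  have l'q : (be * l' < q)%R.
    rewrite mulrC -ltr_pdivlMr//.
    apply: (@lt_le_trans _ _ (Num.min (p / al) (q / be))%R); first by rewrite /l'; lra.
    by rewrite ge_min lexx orbT.
  have l'0 : (0 < l')%R by exact: lt_trans ll'.
  apply: (@lt_le_trans _ _ (ga * l')%:E); first by rewrite lte_fin ltr_pM2l.
  have -> : (ga * l' = (al * l') `^ t * (be * l') `^ (1 - t))%R.
    rewrite (powRM _ (ltW al0) (ltW l'0)) (powRM _ (ltW be0) (ltW l'0)).
    rewrite [RHS]mulrACA -powRD.
      by rewrite subrKC powRr1// ltW.
    by rewrite subrKC oner_eq0.
  apply: uvw; [exact: mulr_gt0|exact: mulr_gt0| |].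
    apply: (@lt_le_trans _ _ (u' x)); first by rewrite pE lte_fin.
    by rewrite ge_min lexx.
  apply: (@lt_le_trans _ _ (v' y)); first by rewrite qE lte_fin.
  by rewrite ge_min lexx.
move: H; rewrite lee_pdivlMl//; apply: le_trans.
apply: (@le_trans _ _ (ga%:E * (t%:E * ((al^-1)%:E * a%:E) +
    (1 - t)%:E * ((be^-1)%:E * b%:E)))); last first.
  apply: lee_wpmul2l; first by rewrite lee_fin ltW.
  by apply: leeD; do 2 (apply: lee_wpmul2l; first by rewrite lee_fin ?invr_ge0 ltW);
    exact: ltW.
rewrite -[leRHS]/((ga * (t * (al^-1 * a) + (1 - t) * (be^-1 * b)))%R%:E) lee_fin.
have pV (c r : R) : (0 < c)%R -> (c `^ r * c^-1 `^ r = 1)%R.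
  by move=> c0; rewrite -powRM ?invr_ge0 ?ltW// divff ?gt_eqF// powR1.
have p0 : (0 < al^-1 * a)%R by rewrite mulr_gt0 ?invr_gt0.
have q0 : (0 < be^-1 * b)%R by rewrite mulr_gt0 ?invr_gt0.
have -> : (a `^ t * b `^ (1 - t) =
    ga * ((al^-1 * a) `^ t * (be^-1 * b) `^ (1 - t)))%R.
  have e1 := pV al t al0; have e2 := pV be (1 - t)%R be0.
  rewrite powRM ?invr_ge0 ?(ltW al0) ?(ltW a0)//.
  rewrite [X in (_ = _ * (_ * X))%R]powRM ?invr_ge0 ?(ltW be0) ?(ltW b0)// /ga.
  rewrite -[LHS]mul1r -[X in (X * _ = _)%R]mul1r -{1}e1 -{1}e2; ring.
by rewrite ler_pM2l//; exact: powR_AMGM.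
Qed.

End prekopa_leindler1.

(** * The Prekopa-Leindler inequality in any dimension *)

Section prekopa_leindler.
Context {R : realType}.
Local Notation leb := (@lebesgue_measure R).
Local Notation RR := (measurableTypeR R).
Local Open Scope ereal_scope.

Lemma ge0_integral_lebesgue_rVS n (h : 'rV[R]_n.+1 -> \bar R) :
  measurable_fun setT h -> (forall x, 0 <= h x) ->
  \int[lebesgue_rV n.+1]_x h x =
  \int[leb]_a \int[lebesgue_rV n]_x h (cons_rV (a, x)).
Proof.
move=> mh h0.
have mc := @measurable_cons_rV R n.
rewrite /= (@ge0_integral_pushforward _ _ _ _ _ _ mc)//.
rewrite preimage_setT (fubini_tonelli1 (m1 := leb) (m2 := lebesgue_rV n)
  (h \o @cons_rV R n))//.
- by apply: measurableT_comp.
- by move=> x; exact: h0.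
Qed.

Lemma measurable_integral_cons n (h : 'rV[R]_n.+1 -> \bar R) :
  measurable_fun setT h -> (forall x, 0 <= h x) ->
  measurable_fun [set: RR] (fun a => \int[lebesgue_rV n]_x h (cons_rV (a, x))).
Proof.
move=> mh h0.
apply: (measurable_fun_fubini_tonelli_F (m2 := lebesgue_rV n)
  (h \o @cons_rV R n)); last by move=> x; exact: h0.
by apply: measurableT_comp => //; exact: measurable_cons_rV.
Qed.

Lemma measurable_cons_rVr n (a : R) :
  measurable_fun [set: 'rV[R]_n] (fun x => cons_rV ((a : RR), x)).
Proof.
by apply: measurableT_comp; [exact: measurable_cons_rV|exact: pair1_measurable].
Qed.

Definition pl_le n (t : R) (u v w : 'rV[R]_n -> \bar R) :=
  forall (x y : 'rV[R]_n) (a b : R), (0 < a)%R -> (0 < b)%R ->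
    a%:E < u x -> b%:E < v y ->
    (a `^ t * b `^ (1 - t))%:E <= w (t *: x + (1 - t) *: y)%R.

Lemma cons_rV_combine n (t s a b : R) (x y : 'rV[R]_n) :
  (t *: cons_rV ((a : RR), x) + s *: cons_rV ((b : RR), y) =
   cons_rV ((t * a + s * b : RR), t *: x + s *: y))%R.
Proof.
apply/rowP => i; rewrite !mxE; case: (unlift ord0 i) => [j|] //=.
by rewrite !mxE.
Qed.

(** The one-dimensional inequality is the inductive step: by the induction
    hypothesis, the integrals of [u], [v], [w] over the last coordinates satisfy
    [pl_le1] as functions of the first one. *)
Theorem prekopa_leindler n (t : R) (u v w : 'rV[R]_n -> \bar R) :
  (0 < t < 1)%R ->
  measurable_fun setT u -> measurable_fun setT v -> measurable_fun setT w ->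
  (forall x, 0 <= u x) -> (forall x, 0 <= v x) -> (forall x, 0 <= w x) ->
  pl_le t u v w ->
  forall a b : R, (0 < a)%R -> (0 < b)%R ->
    a%:E < \int[lebesgue_rV n]_x u x -> b%:E < \int[lebesgue_rV n]_x v x ->
    (a `^ t * b `^ (1 - t))%:E <= \int[lebesgue_rV n]_x w x.
Proof.
move=> t01; elim: n u v w => [|n IH] u v w mu mv mw u0 v0 w0 uvw a b a0 b0.
  rewrite /= !integral_dirac// !diracT !mul1e => au bv.
  by have := uvw _ _ _ _ a0 b0 au bv; congr (_ <= w _); apply/rowP; case.
rewrite !ge0_integral_lebesgue_rVS// => au bv.
apply: (prekopa_leindler1 t01 _ _ _ _ _ _ _ a0 b0 au bv).
- exact: measurable_integral_cons.
- exact: measurable_integral_cons.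
- exact: measurable_integral_cons.
- by move=> x; exact: integral_ge0.
- by move=> x; exact: integral_ge0.
- by move=> x; exact: integral_ge0.
move=> x y c d c0 d0 cu dv.
apply: (IH _ _ _ _ _ _ _ _ _ _ c d c0 d0 cu dv) => //.
- by apply: measurableT_comp => //; exact: measurable_cons_rVr.
- by apply: measurableT_comp => //; exact: measurable_cons_rVr.
- by apply: measurableT_comp => //; exact: measurable_cons_rVr.
move=> x' y' a' b' a'0 b'0 a'u b'v.
by rewrite -cons_rV_combine; exact: uvw.
Qed.

End prekopa_leindler.

(** * Measures with a density *)

Section density.
Context d (T : measurableType d) {R : realType}
  (m : {measure set T -> \bar R}) (p : T -> R).
Hypothesis mp : measurable_fun setT p.
Hypothesis p0 : forall x, 0 <= p x.
Local Open Scope ereal_scope.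

Definition mdensity (A : set T) : \bar R := \int[m]_(x in A) (p x)%:E.

Let mdensity0 : mdensity set0 = 0.
Proof. exact: integral_set0. Qed.

Let mdensity_ge0 A : 0 <= mdensity A.
Proof. by apply: integral_ge0 => x _; rewrite lee_fin. Qed.

Let mdensity_sigma_additive : semi_sigma_additive mdensity.
Proof.
move=> F mF tF mUF; rewrite /mdensity ge0_integral_bigcup//.
- by apply: is_cvg_ereal_nneg_natsum => k _; exact: mdensity_ge0.
- by apply/measurable_EFinP; exact: measurable_funTS.
- by move=> x _; rewrite lee_fin.
Qed.

HB.instance Definition _ := isMeasure.Build _ _ _ mdensity
  mdensity0 mdensity_ge0 mdensity_sigma_additive.

Definition density_measure : {measure set T -> \bar R} := mdensity.

End density.

Section integral_density.
Context d (T : measurableType d) {R : realType}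
  (m nu : {measure set T -> \bar R}) (p : T -> R).
Hypothesis mp : measurable_fun setT p.
Hypothesis p0 : forall x, 0 <= p x.
Local Open Scope ereal_scope.
Hypothesis nuE : forall A, measurable A -> nu A = \int[m]_(x in A) (p x)%:E.

Import HBNNSimple.

Lemma ge0_integral_density (H : T -> \bar R) :
  measurable_fun setT H -> (forall x, 0 <= H x) ->
  \int[nu]_x H x = \int[m]_x (H x * (p x)%:E).
Proof.
move=> mH H0; pose h := nnsfun_approx measurableT mH.
have mpE : measurable_fun setT (EFin \o p) by exact/measurable_EFinP.
have mh n : measurable_fun setT (EFin \o h n) by exact/measurable_EFinP.
have hc x : (h n x)%:E @[n --> \oo] --> H x.
  by apply: cvg_nnsfun_approx => // ? _; exact: H0.
have hH x : H x = limn (fun n => (h n x)%:E) by exact/esym/cvg_lim.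
have hnd x : {homo (fun n => (h n x)%:E) : a b / (a <= b)%N >-> a <= b}.
  by move=> a b ab; rewrite lee_fin; exact/lefP/nd_nnsfun_approx.
have -> : \int[nu]_x H x = limn (fun n => \int[nu]_x (h n x)%:E).
  rewrite -monotone_convergence//.
  - by apply: eq_integral => x _; exact: hH.
  - by move=> n x _; rewrite lee_fin.
have -> : \int[m]_x (H x * (p x)%:E) =
    limn (fun n => \int[m]_x ((h n x)%:E * (p x)%:E)).
  rewrite -monotone_convergence//.
  - apply: eq_integral => x _; apply/esym/cvg_lim => //.
    by apply: cvgeZr.
  - by move=> n; exact: (emeasurable_funM (mh n) mpE).
  - by move=> n x _; rewrite mule_ge0// lee_fin.
  - by move=> x _ a b ab; rewrite lee_wpmul2r ?lee_fin// -lee_fin; exact: hnd.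
congr (limn _); apply/funext => n.
have ms r : measurable_fun setT (fun x => (r * \1_(h n @^-1` [set r]) x)%:E).
  by apply/measurable_EFinP; exact: measurable_funM.
transitivity (\sum_(r \in range (h n))
    \int[nu]_x (r * \1_(h n @^-1` [set r]) x)%:E).
  rewrite -ge0_integral_fsum//; last by move=> r x _; exact: nnfun_muleindic_ge0.
  by apply: eq_integral => x _; rewrite fsumEFin// -fimfunE.
transitivity (\sum_(r \in range (h n))
    \int[m]_x ((r * \1_(h n @^-1` [set r]) x)%:E * (p x)%:E)); last first.
  rewrite -ge0_integral_fsum//.
  - apply: eq_integral => x _; rewrite -ge0_mule_fsuml.
      by rewrite fsumEFin// -fimfunE.
    by move=> r; exact: nnfun_muleindic_ge0.
  - by move=> r; exact: (emeasurable_funM (ms r) mpE).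
  - by move=> r x _; apply: mule_ge0; rewrite ?lee_fin ?p0//;
      exact: nnfun_muleindic_ge0.
apply: eq_fsbigr => r; rewrite inE => -[y _ <-].
have hy0 : (0 <= h n y)%R by [].
under eq_integral do rewrite EFinM.
have mi : measurable_fun setT
    (fun x => (\1_(h n @^-1` [set h n y]) x)%:E : \bar R).
  by apply/measurable_EFinP.
rewrite (@ge0_integralZl _ _ _ nu _ measurableT _ mi); last 2 first.
- by move=> x _; rewrite lee_fin.
- by rewrite lee_fin.
under [RHS]eq_integral do rewrite EFinM -muleA.
rewrite (@ge0_integralZl _ _ _ m _ measurableT _ (emeasurable_funM mi mpE));
  last 2 first.
- by move=> x _; rewrite mule_ge0 ?lee_fin.
- by rewrite lee_fin.
congr (_ * _); rewrite integral_indic// setIT nuE// integral_mkcond.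
apply: eq_integral => x _; rewrite patchE indicE.
by case: ifPn => _; rewrite ?mul1e ?mul0e.
Qed.

End integral_density.

(** * The Euclidean norm *)

Section euclidean_norm.
Context {R : realType} {n : nat}.
Implicit Types x y : 'rV[R]_n.

Lemma sum_sqr_ge0 x : 0 <= \sum_(i < n) x ord0 i ^+ 2.
Proof. by apply: sumr_ge0 => i _; exact: sqr_ge0. Qed.

Lemma enorm_sq x : enorm x ^+ 2 = \sum_(i < n) x ord0 i ^+ 2.
Proof. by rewrite sqr_sqrtr// sum_sqr_ge0. Qed.

Lemma enorm_ge0 x : 0 <= enorm x. Proof. exact: sqrtr_ge0. Qed.

Lemma enorm0 : enorm (0 : 'rV[R]_n) = 0.
Proof.
rewrite /enorm big1 ?sqrtr0// => i _; by rewrite mxE expr0n.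
Qed.

Lemma enormZ (t : R) x : enorm (t *: x) = `|t| * enorm x.
Proof.
rewrite /enorm -sqrtr_sqr -sqrtrM ?sqr_ge0// mulr_sumr; congr Num.sqrt.
by apply: eq_bigr => i _; rewrite mxE exprMn.
Qed.

Lemma enormN x : enorm (- x) = enorm x.
Proof. by rewrite -scaleN1r enormZ normrN normr1 mul1r. Qed.

Lemma enorm_distC x y : enorm (x - y) = enorm (y - x).
Proof. by rewrite -enormN opprB. Qed.

Lemma coord_le_enorm x i : `|x ord0 i| <= enorm x.
Proof.
rewrite -sqrtr_sqr; apply: ler_wsqrtr.
by rewrite (bigD1 i)//= lerDl; apply: sumr_ge0 => j _; exact: sqr_ge0.
Qed.

Lemma enorm_eq0 x : enorm x = 0 -> x = 0.
Proof.
move=> x0; apply/rowP => i; rewrite mxE; apply/normr0_eq0/eqP.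
by rewrite eq_le normr_ge0 andbT -x0 coord_le_enorm.
Qed.

Lemma cauchy_schwarz x y :
  `|\sum_(i < n) x ord0 i * y ord0 i| <= enorm x * enorm y.
Proof.
have main (z w : 'rV[R]_n) :
    \sum_(i < n) z ord0 i * w ord0 i <= enorm z * enorm w.
  have [/enorm_eq0 ->|z0] := eqVneq (enorm z) 0.
    by rewrite enorm0 mul0r big1// => i _; rewrite mxE mul0r.
  have [/enorm_eq0 ->|w0] := eqVneq (enorm w) 0.
    by rewrite enorm0 mulr0 big1// => i _; rewrite mxE mulr0.
  have a0 : 0 < enorm z by rewrite lt_def z0 enorm_ge0.
  have b0 : 0 < enorm w by rewrite lt_def w0 enorm_ge0.
  (* AM-GM on each term, weighted so that both halves sum to |z| |w| / 2. *)
  apply: (@le_trans _ _ (\sum_(i < n) (enorm w / enorm z / 2 * z ord0 i ^+ 2 +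
      enorm z / enorm w / 2 * w ord0 i ^+ 2))).
    apply: ler_sum => i _; rewrite -subr_ge0.
    set p := z ord0 i; set q := w ord0 i.
    set a := enorm z in a0 *; set b := enorm w in b0 *.
    have -> : b / a / 2 * p ^+ 2 + a / b / 2 * q ^+ 2 - p * q =
        (b * p - a * q) ^+ 2 / (2 * a * b) by field; rewrite !gt_eqF.
    by rewrite divr_ge0 ?sqr_ge0// !mulr_ge0// ltW.
  rewrite big_split /= -!mulr_sumr -!enorm_sq le_eqVlt; apply/orP; left.
  by apply/eqP; field; rewrite !gt_eqF.
rewrite ler_norml main andbT lerNl -(enormN x) -sumrN.
apply: le_trans (main (- x) y); rewrite le_eqVlt; apply/orP; left; apply/eqP.
by apply: eq_bigr => i _; rewrite mxE mulNr.
Qed.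

Lemma ler_enormD x y : enorm (x + y) <= enorm x + enorm y.
Proof.
rewrite -(@ler_pXn2r _ 2)// ?nnegrE ?addr_ge0 ?enorm_ge0//.
have -> : enorm (x + y) ^+ 2 = enorm x ^+ 2 + enorm y ^+ 2 +
    2 * \sum_(i < n) x ord0 i * y ord0 i.
  rewrite !enorm_sq mulr_sumr -!big_split /=.
  by apply: eq_bigr => i _; rewrite mxE; ring.
have := le_trans (ler_norm _) (cauchy_schwarz x y); nra.
Qed.

Lemma ler_dist_enorm x y : `|enorm x - enorm y| <= enorm (x - y).
Proof.
have main (z w : 'rV[R]_n) : enorm z - enorm w <= enorm (z - w).
  by rewrite lerBlDr; have := ler_enormD (z - w) w; rewrite subrK.
by rewrite ler_norml main andbT lerNl opprB enorm_distC main.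
Qed.

(** The parallelogram law at a general convex combination: the defect of
    convexity of the squared norm. *)
Lemma enorm_sq_combine (t : R) x y :
  enorm (t *: x + (1 - t) *: y) ^+ 2 =
  t * enorm x ^+ 2 + (1 - t) * enorm y ^+ 2 -
  t * (1 - t) * enorm (x - y) ^+ 2.
Proof.
rewrite !enorm_sq !mulr_sumr -big_split /= -sumrB.
by apply: eq_bigr => i _; rewrite !mxE; ring.
Qed.

Lemma measurable_entry (i : 'I_n) :
  measurable_fun [set: 'rV[R]_n] (fun x : 'rV[R]_n => x ord0 i : R).
Proof. exact: measurable_coord_rV. Qed.

Lemma measurable_enorm : measurable_fun [set: 'rV[R]_n] (@enorm R n).
Proof.
apply: (measurableT_comp (f := @Num.sqrt R)).
  by apply: continuous_measurable_fun; exact: sqrt_continuous.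
by apply: measurable_sum => i; apply: measurable_funX; exact: measurable_entry.
Qed.

Lemma measurable_scale (t : R) :
  measurable_fun [set: 'rV[R]_n] (fun x : 'rV[R]_n => t *: x).
Proof.
apply: measurable_fun_rV => i.
rewrite (_ : _ \o _ = fun x : 'rV[R]_n => t * x ord0 i); last first.
  by apply/funext => x; rewrite /coord_rV /= mxE.
by apply: measurable_funM => //; exact: measurable_entry.
Qed.

Lemma continuous_measurable_rV (f : 'rV[R]_n -> R) :
  continuous f -> measurable_fun setT f.
Proof.
move=> cf; apply: (measurability (@RGenOpens.G R)).
  exact: RGenOpens.measurableE.
move=> _ [_ [a [b ->]] <-]; rewrite setTI.
apply: open_measurable_rV; apply: open_comp; last exact: interval_open.
by move=> x _; exact: cf.
Qed.

End euclidean_norm.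

(** * Entropy under a strongly log-concave measure *)

(** Convexity of [- ln p - c |x|^2 / 2], in the multiplicative form that makes
    sense where [p] vanishes. *)
Definition strongly_log_concave {R : realType} n (c : R) (p : 'rV[R]_n -> R) :=
  forall (x y : 'rV[R]_n) (t : R), 0 < t < 1 ->
    p x `^ t * p y `^ (1 - t) *
      expR (c * (t * (1 - t)) / 2 * enorm (x - y) ^+ 2) <=
    p (t *: x + (1 - t) *: y).

Lemma measurable_expR_comp d (T : measurableType d) (R : realType) (f : T -> R) :
  measurable_fun setT f -> measurable_fun setT (fun x => expR (f x)).
Proof. by move=> mf; exact: (measurableT_comp (@measurable_expR R)). Qed.

Section real_integrable.
Context d (T : measurableType d) {R : realType} (m : {measure set T -> \bar R}).
Implicit Types f g : T -> R.

Lemma integrable_addr f g :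
  m.-integrable setT (EFin \o f) -> m.-integrable setT (EFin \o g) ->
  m.-integrable setT (EFin \o (fun x => f x + g x)).
Proof. by move=> hf hg; exact: (integrableD measurableT hf hg). Qed.

Lemma integrable_subr f g :
  m.-integrable setT (EFin \o f) -> m.-integrable setT (EFin \o g) ->
  m.-integrable setT (EFin \o (fun x => f x - g x)).
Proof. by move=> hf hg; exact: (integrableB measurableT hf hg). Qed.

Lemma integrable_mull (k : R) f :
  m.-integrable setT (EFin \o f) ->
  m.-integrable setT (EFin \o (fun x => k * f x)).
Proof. by move=> hf; exact: (integrableZl measurableT k hf). Qed.

Lemma bounded_integrable f (B : R) : (m setT < +oo)%E ->
  measurable_fun setT f -> (forall x, `|f x| <= B) ->
  m.-integrable setT (EFin \o f).
Proof.
move=> moo mf fB; apply: measurable_bounded_integrable => //.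
exists B; split; first exact: num_real.
by move=> B' BB' y _ /=; apply: le_trans (fB y) (ltW BB').
Qed.

End real_integrable.

(** The function [g] is only asked for a one-sided second-order bound on its
    increments, with slope [G] and curvature [A] at almost every base point, both
    possibly unbounded: it will be composed with a map that is singular on a null
    set and Lipschitz with a constant that depends on the base point. *)
Section strongly_log_concave_entropy.
Context {R : realType} {n : nat}.
Variables (c : R) (p : 'rV[R]_n -> R) (m : {measure set 'rV[R]_n -> \bar R}).
Hypotheses (c0 : 0 < c) (mp : measurable_fun setT p) (p0 : forall x, 0 <= p x).
Hypothesis slcp : strongly_log_concave c p.
Hypothesis mE : forall A, measurable A ->
  m A = (\int[lebesgue_rV n]_(x in A) (p x)%:E)%E.
Hypotheses (moo : (m setT < +oo)%E) (m0 : (0 < m setT)%E).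
Variables (g G A : 'rV[R]_n -> R) (M : R) (D : 'rV[R]_n -> bool).
Hypotheses (mg : measurable_fun setT g) (mG : measurable_fun setT G)
  (mA : measurable_fun setT A) (mD : measurable_fun setT D).
Hypotheses (M0 : 0 < M) (gM : forall x, `|g x| <= M)
  (G0 : forall x, 0 <= G x) (A0 : forall x, 0 <= A x)
  (Dnull : m [set x | ~~ D x] = 0%E).
Hypothesis gGA : forall x z, 0 < p x -> 0 < p z -> D z ->
  g x <= g z + G z * enorm (x - z) + A z * enorm (x - z) ^+ 2.
Hypotheses (iG : m.-integrable setT (fun x => (G x ^+ 2)%:E))
  (iA : m.-integrable setT (fun x => (A x)%:E)).

Let Z := fine (m setT).

Let mZ : m setT = Z%:E.
Proof. by rewrite fineK// ge0_fin_numE. Qed.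

Let Z0 : 0 < Z.
Proof. by rewrite -lte_fin -mZ. Qed.

Let gleM x : g x <= M. Proof. exact: le_trans (ler_norm _) (gM x). Qed.

Let geNM x : - M <= g x.
Proof. by rewrite lerNl; apply: le_trans (gM x); rewrite -normrN ler_norm. Qed.

Let bounded_int f B := @bounded_integrable _ _ R m f B moo.

Let Rint_density (f : 'rV[R]_n -> R) (B : R) : measurable_fun setT f ->
  (forall x, 0 <= f x <= B) ->
  (\int[lebesgue_rV n]_x (f x * p x)%:E = (\int[m]_x f x)%:E)%E.
Proof.
move=> mf fB.
transitivity (\int[m]_x (f x)%:E)%E.
  rewrite (ge0_integral_density mp p0 mE)//; first exact/measurable_EFinP.
  by move=> x; rewrite lee_fin; case/andP: (fB x).
rewrite /Rintegral fineK// integrable_fin_num// (@bounded_int _ B)// => x.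
by case/andP: (fB x) => f0 fb; rewrite ger0_norm.
Qed.

(** An upper bound for [g x - g z - c (1 - s) / (2 s) |x - z|^2], uniform in [x]:
    it comes from the increments of [g] where the quadratic term dominates the
    curvature [A z], and from the bound [M] elsewhere. *)
Let Delta (s : R) z : R :=
  if D z && (4 * s * A z <= c * (1 - s)) then
    s * (G z ^+ 2 / (2 * (c * (1 - s))) * (1 + 4 * s * A z / (c * (1 - s))))
  else 2 * M.

Let Delta_ge0 s z : 0 < s < 1 -> 0 <= Delta s z.
Proof.
move=> /andP[s0 s1]; rewrite /Delta; case: ifP => _; last first.
  by rewrite mulr_ge0// ltW.
have t0 : 0 < 1 - s by rewrite subr_gt0.
rewrite mulr_ge0 ?(ltW s0)// mulr_ge0 ?divr_ge0 ?sqr_ge0//.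
  by rewrite !mulr_ge0// ltW.
by rewrite addr_ge0// divr_ge0// !mulr_ge0// ltW.
Qed.

Let measurable_Delta s : measurable_fun setT (Delta s).
Proof.
apply: measurable_fun_ifT => //.
  apply: measurable_and => //; apply: measurable_fun_ler => //.
  exact: measurable_funM.
apply: measurable_funM => //; apply: measurable_funM.
  by apply: measurable_funM => //; exact: measurable_funX.
by apply: measurable_funD => //; apply: measurable_funM => //; exact: measurable_funM.
Qed.

(** The quadratic term is what the exponential gain of strong log-concavity
    pays for, when [z] is the barycenter of weights [1 - s] and [s] of [x] and
    another point. *)
Let absorb s x z : 0 < s < 1 -> 0 < p x -> 0 < p z ->
  g x <= g z + Delta s z + c * (1 - s) / (2 * s) * enorm (x - z) ^+ 2.
Proof.
move=> s01 px pz; have /andP[s0 s1] := s01.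
have t0 : 0 < 1 - s by rewrite subr_gt0.
set r := enorm (x - z); have r0 : 0 <= r by exact: enorm_ge0.
have k0 : 0 < c * (1 - s) / (2 * s) by rewrite divr_gt0 ?mulr_gt0.
set k := c * (1 - s) / (2 * s) in k0 *.
rewrite /Delta; case: ifP => [/andP[Dz hA]|_]; last first.
  have := gleM x; have := geNM z; have := mulr_ge0 (ltW k0) (sqr_ge0 r); lra.
apply: le_trans (gGA px pz Dz) _; rewrite -/r -!addrA lerD2l.
have A2k : 2 * A z <= k.
  by rewrite /k ler_pdivlMr ?mulr_gt0//; move: hA; lra.
have -> : s * (G z ^+ 2 / (2 * (c * (1 - s))) *
    (1 + 4 * s * A z / (c * (1 - s)))) =
    G z ^+ 2 * (k + 2 * A z) / (4 * k ^+ 2).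
  by rewrite /k; field; rewrite !gt_eqF.
have Az := A0 z; have Gz := G0 z.
rewrite -(ler_pM2l (_ : 0 < 4 * k ^+ 2)); last by rewrite mulr_gt0// exprn_gt0.
rewrite [leRHS]mulrDr [X in _ <= X + _]mulrC divfK; last first.
  by rewrite gt_eqF// mulr_gt0// exprn_gt0.
set a := A z in A2k Az *; set G' := G z in Gz *.
rewrite -subr_ge0 -(pmulr_rge0 _ (_ : 0 < k + 2 * a)); last by lra.
(* A quadratic form in [(G, r)] of nonpositive discriminant, completed. *)
have -> : (k + 2 * a) * (G' ^+ 2 * (k + 2 * a) + 4 * k ^+ 2 * (k * r ^+ 2) -
    4 * k ^+ 2 * (G' * r + a * r ^+ 2)) =
    ((k + 2 * a) * G' - 2 * k ^+ 2 * r) ^+ 2 +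
    4 * k ^+ 2 * r ^+ 2 * (a * (k - 2 * a)) by ring.
apply: addr_ge0; first exact: sqr_ge0.
by apply: mulr_ge0; apply: mulr_ge0; rewrite ?subr_ge0 ?sqr_ge0//;
  apply: mulr_ge0; rewrite ?sqr_ge0.
Qed.

(** The Prekopa-Leindler inequality with weights [1 - s], [s], applied to
    [exp (g / (1 - s)) p], [p] and [exp (min (g + Delta) M) p]. *)
Let pl_integrated s : 0 < s < 1 ->
  (\int[m]_x expR (g x / (1 - s))) `^ (1 - s) * Z `^ s <=
  \int[m]_x expR (Num.min (g x + Delta s x) M).
Proof.
move=> s01; have /andP[s0 s1] := s01.
have t0 : 0 < 1 - s by rewrite subr_gt0.
have t01 : 0 < 1 - s < 1 by rewrite t0 ltrBlDr ltrDl.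
set t := 1 - s in t0 t01 *; have st : 1 - t = s by rewrite /t opprB addrC subrK.
set U := \int[m]_x _; set W := \int[m]_x _.
have mu : measurable_fun setT (fun x => expR (g x / t)).
  by apply: measurable_expR_comp; exact: measurable_funM.
have mw : measurable_fun setT (fun x => expR (Num.min (g x + Delta s x) M)).
  apply: measurable_expR_comp; apply: measurable_minr => //.
  exact: measurable_funD.
have ub x : 0 <= expR (g x / t) <= expR (M / t).
  by rewrite expR_ge0 ler_expR ler_pM2r ?invr_gt0 ?gleM.
have wb x : 0 <= expR (Num.min (g x + Delta s x) M) <= expR M.
  by rewrite expR_ge0 ler_expR ge_min lexx orbT.
have UE := Rint_density mu ub; have WE := Rint_density mw wb.
have ZE : (\int[lebesgue_rV n]_x (p x)%:E = Z%:E)%E.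
  by rewrite -mZ mE.
have U0 : 0 < U.
  apply: (@lt_le_trans _ _ (expR (- M / t) * Z)).
    by rewrite mulr_gt0// expR_gt0.
  rewrite -Rintegral_cst//; apply: le_Rintegral => //.
  - apply: (@bounded_int _ (expR (- M / t))); first exact: measurable_cst.
    by move=> x; rewrite ger0_norm ?expR_ge0.
  - apply: (@bounded_int _ (expR (M / t)) mu) => x.
    by rewrite ger0_norm ?expR_ge0//; case/andP: (ub x).
  - by move=> x _; rewrite ler_expR ler_pM2r ?invr_gt0 ?geNM.
have key (r : R) : 0 < r < 1 -> r * (U `^ t * Z `^ s) <= W.
  move=> /andP[r0 r1].
  have -> : r * (U `^ t * Z `^ s) = (r * U) `^ t * (r * Z) `^ (1 - t).
    rewrite st !powRM ?(ltW r0) ?(ltW U0) ?(ltW Z0)// mulrACA -powRD.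
      by rewrite /t subrK powRr1// ltW.
    by rewrite /t subrK oner_eq0.
  rewrite -lee_fin -WE.
  apply: (@prekopa_leindler _ _ _ (fun x => (expR (g x / t) * p x)%:E)
    (fun x => (p x)%:E) _ t01); rewrite ?mulr_gt0//.
  - by apply/measurable_EFinP; exact: measurable_funM.
  - exact/measurable_EFinP.
  - by apply/measurable_EFinP; exact: measurable_funM.
  - by move=> x; rewrite lee_fin mulr_ge0// expR_ge0.
  - by move=> x; rewrite lee_fin mulr_ge0// expR_ge0.
  - move=> x y a b a0 b0; rewrite !lte_fin lee_fin st => ax byy.
    have px : 0 < p x.
      by have := lt_trans a0 ax; rewrite pmulr_rgt0 ?expR_gt0.
    have py : 0 < p y by exact: lt_trans byy.
    set z := t *: x + s *: y.
    have xz : enorm (x - z) = s * enorm (x - y).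
      have -> : x - z = s *: (x - y).
        by apply/rowP => i; rewrite !mxE /t; ring.
      by rewrite enormZ ger0_norm// ltW.
    have slc := slcp x y t01; rewrite st -/z in slc.
    have pxy0 : 0 < p x `^ t * p y `^ s by apply: mulr_gt0; exact: powR_gt0.
    have pz : 0 < p z.
      by apply: lt_le_trans slc; apply: mulr_gt0 => //; exact: expR_gt0.
    apply: (@le_trans _ _ ((expR (g x / t) * p x) `^ t * p y `^ s)).
      apply: ler_pM; rewrite ?powR_ge0//; apply: ge0_ler_powR => //;
        rewrite ?nnegrE ?(ltW a0) ?(ltW b0) ?(ltW px) ?(ltW py) ?(ltW t0)
          ?(ltW s0)// ?mulr_ge0 ?expR_ge0 ?(ltW px) ?(ltW ax) ?(ltW byy)//.
    rewrite powRM ?expR_ge0// -expRM divfK ?gt_eqF// -mulrA.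
    apply: (@le_trans _ _ (expR (Num.min (g z + Delta s z) M) *
      (p x `^ t * p y `^ s * expR (c * (t * s) / 2 * enorm (x - y) ^+ 2)))).
      rewrite [leRHS]mulrCA [leRHS]mulrA [leLHS]mulrC -mulrA ler_pM2l//.
      rewrite -expRD ler_expR.
      have -> : c * (t * s) / 2 * enorm (x - y) ^+ 2 =
          c * t / (2 * s) * enorm (x - z) ^+ 2.
        by rewrite xz; field; rewrite gt_eqF.
      have := absorb s01 px pz; rewrite -/t => ab.
      have k0 : 0 <= c * t / (2 * s) * enorm (x - z) ^+ 2.
        by rewrite mulr_ge0 ?sqr_ge0// divr_ge0 ?mulr_ge0 ?ltW.
      rewrite -lerBlDr le_min; apply/andP; split; first by rewrite lerBlDr.
      by rewrite lerBlDr; have := gleM x; lra.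
    by rewrite ler_pM2l// expR_gt0.
  - by rewrite UE lte_fin gtr_pMl.
  - by rewrite ZE lte_fin gtr_pMl.
(* The strict inequalities required of [r U] and [r Z] leave [r < 1], to be
   sent to 1. *)
set Q := U `^ t * Z `^ s.
have Q0 : 0 < Q by apply: mulr_gt0; exact: powR_gt0.
rewrite leNgt; apply/negP => WQ.
have W0 : 0 <= W by apply: Rintegral_ge0 => x _; exact: expR_ge0.
have := key ((W / Q + 1) / 2).
have e : W / Q * Q = W by rewrite divfK// gt_eqF.
have h1 : W / Q < 1 by rewrite ltr_pdivrMr// mul1r.
have h0 : 0 <= W / Q by rewrite divr_ge0// ltW.
have h : 0 < (W / Q + 1) / 2 < 1 by apply/andP; split; lra.
move=> /(_ h); rewrite -/Q; set q := W / Q in e h1 h0 h *; nra.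
Qed.

Let S := \int[m]_x expR (g x).
Let Q := \int[m]_x (g x * expR (g x)).

Let expg_bound x : `|expR (g x)| <= expR M.
Proof. by rewrite ger0_norm ?expR_ge0// ler_expR. Qed.

Let int_expg : m.-integrable setT (EFin \o (fun x => expR (g x))).
Proof. by apply: (@bounded_int _ (expR M)) => //; exact: measurable_expR_comp. Qed.

Let int_gexpg : m.-integrable setT (EFin \o (fun x => g x * expR (g x))).
Proof.
apply: (@bounded_int _ (M * expR M)).
  by apply: measurable_funM => //; exact: measurable_expR_comp.
by move=> x; rewrite normrM ler_pM.
Qed.

Let S0 : 0 < S.
Proof.
apply: (@lt_le_trans _ _ (expR (- M) * Z)).
  by rewrite mulr_gt0// expR_gt0.
rewrite -Rintegral_cst//; apply: le_Rintegral => //.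
- apply: (@bounded_int _ (expR (- M))); first exact: measurable_cst.
  by move=> x; rewrite ger0_norm ?expR_ge0.
- by move=> x _; rewrite ler_expR geNM.
Qed.

(** Jensen's inequality for the exponential, under the probability measure
    proportional to [exp g], bounds the left-hand side of [pl_integrated] from
    below by [S + s Ent]. *)
Let entropy_difference s : 0 < s < 1 ->
  s * (Q - S * ln (S / Z)) <=
  \int[m]_x expR (Num.min (g x + Delta s x) M) - S.
Proof.
move=> s01; have := pl_integrated s01.
have /andP[s0 s1] := s01; have t0 : 0 < 1 - s by rewrite subr_gt0.
set t := 1 - s in t0 *; set W := \int[m]_x expR (Num.min _ _).
set U := \int[m]_x _ => UW.
pose q := Q / S.
have US : S * expR (s / t * q) <= U.
  have -> : S * expR (s / t * q) = \int[m]_x (expR (s / t * q) *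
      ((1 - s / t * q) * expR (g x) + s / t * (g x * expR (g x)))).
    rewrite RintegralZl//; last first.
      by apply: integrable_addr; exact: integrable_mull.
    rewrite RintegralD//; last 2 first.
    - exact: integrable_mull.
    - exact: integrable_mull.
    rewrite !RintegralZl// -/S -/Q mulrC; congr (_ * _).
    by rewrite /q; field; rewrite !gt_eqF.
  apply: le_Rintegral => //.
  - apply: integrable_mull => //.
    by apply: integrable_addr; exact: integrable_mull.
  - apply: (@bounded_int _ (expR (M / t))).
      by apply: measurable_expR_comp; exact: measurable_funM.
    by move=> x; rewrite ger0_norm ?expR_ge0// ler_expR ler_pM2r ?invr_gt0 ?gleM.
  - move=> x _.
    have -> : g x / t = s / t * q + (g x + s / t * (g x - q)).
      rewrite /t; field; by rewrite gt_eqF// subr_gt0.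
    rewrite [leRHS]expRD ler_pM2l ?expR_gt0// expRD.
    have H := ler_wpM2l (expR_ge0 (g x)) (expR_ge1Dx (s / t * (g x - q))).
    apply: le_trans _ H.
    by rewrite le_eqVlt; apply/orP; left; apply/eqP; ring.
have {}US : (S * expR (s / t * q)) `^ t * Z `^ s <= W.
  apply: le_trans UW; apply: ler_wpM2r; first exact: powR_ge0.
  have E0 : 0 < S * expR (s / t * q) by rewrite mulr_gt0// expR_gt0.
  apply: ge0_ler_powR; rewrite ?nnegrE ?(ltW t0)// ?(ltW E0)//.
  exact: le_trans (ltW E0) US.
rewrite lerBrDr; apply: le_trans US.
have -> : (S * expR (s / t * q)) `^ t * Z `^ s =
    S * expR (s * (q - ln (S / Z))).
  rewrite powRM ?(ltW S0) ?expR_ge0// -expRM /powR !gt_eqF//.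
  rewrite -[X in _ = X * _]lnK ?posrE// ln_div ?posrE// -!expRD.
  by congr expR; rewrite /t; field; rewrite gt_eqF.
have H := ler_wpM2l (ltW S0) (expR_ge1Dx (s * (q - ln (S / Z)))).
apply: le_trans _ H.
rewrite le_eqVlt; apply/orP; left; apply/eqP.
by rewrite /q; field; rewrite gt_eqF.
Qed.

(** A pointwise bound for [(exp (min (g + Delta) M) - exp g) / s], from
    [exp u - 1 <= u exp u]; it stays bounded by an integrable function as [s]
    tends to 0. *)
Let h (s : R) x := expR (g x) *
  ((Delta s x / s) * expR (Num.min (Delta s x) (2 * M))).

Let h_ge0 s x : 0 < s < 1 -> 0 <= h s x.
Proof.
move=> s01; have /andP[s0 _] := s01.
by rewrite !mulr_ge0 ?expR_ge0 ?Delta_ge0 ?invr_ge0// ltW.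
Qed.

Let measurable_h s : measurable_fun setT (h s).
Proof.
apply: measurable_funM; first exact: measurable_expR_comp.
apply: measurable_funM; first exact: measurable_funM.
by apply: measurable_expR_comp; exact: measurable_minr.
Qed.

Let entropy_le_h s : 0 < s < 1 ->
  ((Q - S * ln (S / Z))%:E <= \int[m]_x (h s x)%:E)%E.
Proof.
move=> s01; have /andP[s0 s1] := s01.
have mw : measurable_fun setT (fun x => expR (Num.min (g x + Delta s x) M)).
  apply: measurable_expR_comp; apply: measurable_minr => //.
  exact: measurable_funD.
have iw : m.-integrable setT
    (EFin \o (fun x => expR (Num.min (g x + Delta s x) M))).
  apply: (@bounded_int _ (expR M) mw) => x.
  by rewrite ger0_norm ?expR_ge0// ler_expR ge_min lexx orbT.
have step : Q - S * ln (S / Z) <= \int[m]_x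
    (s^-1 * (expR (Num.min (g x + Delta s x) M) - expR (g x))).
  rewrite RintegralZl//; last by apply: integrable_subr.
  rewrite RintegralB// -/S ler_pdivlMl//.
  exact: entropy_difference.
apply: (@le_trans _ _ (\int[m]_x
    (s^-1 * (expR (Num.min (g x + Delta s x) M) - expR (g x))))%:E).
  by rewrite lee_fin.
have gmin x : g x <= Num.min (g x + Delta s x) M.
  by rewrite le_min lerDl Delta_ge0//= gleM.
rewrite /Rintegral fineK; last first.
  apply: integrable_fin_num => //; apply: integrable_mull => //.
  exact: integrable_subr.
apply: ge0_le_integral => //.
- by move=> x _; rewrite lee_fin mulr_ge0 ?invr_ge0 ?(ltW s0)// subr_ge0 ler_expR.
- apply/measurable_EFinP; apply: measurable_funM => //.
  by apply: measurable_funB => //; exact: measurable_expR_comp.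
- exact/measurable_EFinP.
move=> x _; rewrite lee_fin /h.
set w := Num.min (g x + Delta s x) M.
pose de := w - g x.
have de0 : 0 <= de by rewrite subr_ge0.
have deD : de <= Delta s x by rewrite /de lerBlDr addrC /w ge_min lexx.
have de2M : de <= 2 * M.
  rewrite /de lerBlDr; apply: (@le_trans _ _ M); first by rewrite /w ge_min lexx orbT.
  by have := geNM x; lra.
have -> : w = g x + de by rewrite /de addrC subrK.
rewrite expRD -{2}(mulr1 (expR (g x))) -mulrBr mulrCA ler_pM2l ?expR_gt0//.
rewrite [leRHS]mulrAC mulrC ler_pM2r ?invr_gt0//.
apply: (@le_trans _ _ (de * expR de)).
  have := ler_wpM2l (expR_ge0 de) (expR_ge1Dx (- de)).
  by rewrite expRN divff ?gt_eqF ?expR_gt0//; lra.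
by apply: ler_pM => //; rewrite ?expR_ge0// ler_expR le_min deD.
Qed.

Let h_dominated s x : 0 < s <= 2^-1 -> D x ->
  h s x <= expR M * ((2 / c * G x ^+ 2 + 16 * M / c * A x) * expR (2 * M)).
Proof.
move=> /andP[s0 s2] Dx.
have s01 : 0 < s < 1 by rewrite s0 (le_lt_trans s2)// invf_lt1// ltr1n.
have t2 : 2^-1 <= 1 - s by lra.
have t0 : 0 < 1 - s by lra.
have ct0 : 0 < c * (1 - s) by rewrite mulr_gt0.
have cV : (c * (1 - s))^-1 <= 2 / c.
  by rewrite ler_pdivlMr// ler_pdivrMl//; nra.
have D0 : 0 <= Delta s x / s by rewrite mulr_ge0 ?Delta_ge0 ?invr_ge0 ?ltW.
have G2 := sqr_ge0 (G x); have Ax := A0 x.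
rewrite /h; apply: ler_pM; first exact: expR_ge0.
- by apply: mulr_ge0 => //; exact: expR_ge0.
- by rewrite ler_expR gleM.
apply: ler_pM; [exact: D0|exact: expR_ge0| |]; last first.
  by rewrite ler_expR ge_min lexx orbT.
rewrite /Delta Dx /=; case: ifP => [hA|/negbT]; last rewrite -ltNge => hA.
  rewrite mulrAC divff ?gt_eqF// mul1r.
  apply: (@le_trans _ _ (2 / c * G x ^+ 2)); last first.
    by rewrite lerDl !mulr_ge0 ?invr_ge0// ltW.
  have -> : G x ^+ 2 / (2 * (c * (1 - s))) * (1 + 4 * s * A x / (c * (1 - s))) =
      (1 + 4 * s * A x / (c * (1 - s))) / 2 * (c * (1 - s))^-1 * G x ^+ 2.
    by field; rewrite !gt_eqF.
  rewrite ler_wpM2r//.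
  have e1 : 4 * s * A x / (c * (1 - s)) <= 1 by rewrite ler_pdivrMr// mul1r.
  have e0 : 0 <= (c * (1 - s))^-1 by rewrite invr_ge0 ltW.
  apply: le_trans cV.
  by rewrite -[leRHS]mul1r ler_wpM2r// ler_pdivrMr// mul1r; lra.
apply: (@le_trans _ _ (16 * M / c * A x)); last first.
  by rewrite lerDr mulr_ge0// divr_ge0// ltW.
have -> : 16 * M / c * A x = 2 * M * (4 * A x * (2 / c)).
  by field; rewrite gt_eqF.
apply: ler_wpM2l; first by rewrite mulr_ge0// ltW.
apply: (@le_trans _ _ (4 * A x * (c * (1 - s))^-1)); last first.
  by apply: ler_wpM2l => //; rewrite mulr_ge0.
by rewrite ler_pdivlMr// ler_pdivrMl//; lra.
Qed.

Let h_cvg (s_ : nat -> R) x : D x -> (forall k, 0 < s_ k < 1) ->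
  s_ k @[k --> \oo] --> (0 : R) ->
  h (s_ k) x @[k --> \oo] --> expR (g x) * (G x ^+ 2 / (2 * c)).
Proof.
move=> Dx s01 s_0.
have ct : c * (1 - s_ k) @[k --> \oo] --> c.
  rewrite -{2}[c]mulr1 -{2}[1]subr0.
  by apply: cvgM; [exact: cvg_cst|apply: cvgB => //; exact: cvg_cst].
have ctV : (c * (1 - s_ k))^-1 @[k --> \oo] --> c^-1.
  by apply: cvgV => //; rewrite gt_eqF.
have ct2V : (2 * (c * (1 - s_ k)))^-1 @[k --> \oo] --> (2 * c)^-1.
  apply: cvgV; first by rewrite gt_eqF// mulr_gt0.
  by apply: cvgM => //; exact: cvg_cst.
have sA : 4 * s_ k * A x @[k --> \oo] --> (0 : R).
  rewrite (_ : (0 : R) = 4 * 0 * A x); last by ring.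
  by apply: cvgM; [apply: cvgM => //; exact: cvg_cst|exact: cvg_cst].
pose q k := G x ^+ 2 / (2 * (c * (1 - s_ k))) *
  (1 + 4 * s_ k * A x / (c * (1 - s_ k))).
have qc : q k @[k --> \oo] --> G x ^+ 2 / (2 * c).
  rewrite (_ : G x ^+ 2 / (2 * c) = G x ^+ 2 / (2 * c) * (1 + 0 * c^-1)); last by ring.
  apply: cvgM; first by apply: cvgM => //; exact: cvg_cst.
  by apply: cvgD; [exact: cvg_cst|exact: cvgM].
have sq : s_ k * q k @[k --> \oo] --> (0 : R).
  by rewrite (_ : (0 : R) = 0 * (G x ^+ 2 / (2 * c))); [exact: cvgM|ring].
have lim : expR (g x) * (q k * expR (s_ k * q k)) @[k --> \oo] -->
    expR (g x) * (G x ^+ 2 / (2 * c)).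
  apply: cvgM; first exact: cvg_cst.
  rewrite (_ : G x ^+ 2 / (2 * c) = G x ^+ 2 / (2 * c) * expR 0); last first.
    by rewrite expR0 mulr1.
  apply: cvgM => //.
  by apply: (cvg_comp _ _ sq); exact: continuous_expR.
apply: cvg_trans lim; apply: near_eq_cvg; near=> k.
have /andP[sk0 sk1] := s01 k.
have cond : 4 * s_ k * A x <= c * (1 - s_ k).
  apply: (@le_trans _ _ (c / 2)); near: k.
    by apply: (cvgr_le _ sA); rewrite divr_gt0.
  by apply: (cvgr_ge _ ct); rewrite ltr_pdivrMr// ltr_pMr// ltr1n.
have De : Delta (s_ k) x = s_ k * q k by rewrite /Delta Dx cond.
rewrite /h De (_ : s_ k * q k / s_ k = q k); last first.
  by rewrite mulrAC divff ?gt_eqF// mul1r.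
congr (_ * (_ * expR _)).
apply/esym/min_idPl; near: k; apply: (cvgr_le _ sq).
by rewrite mulr_gt0.
Unshelve. all: by end_near. Qed.

(** The entropy of [exp g] is the derivative at [s = 0] of the left-hand side of
    the integrated inequality; dividing [entropy_difference] by [s] and letting
    [s] tend to 0, the right-hand side converges by domination, since
    [Delta / s] tends to [G^2 / (2 c)]. This is the route of Bobkov and Ledoux
    from Prekopa-Leindler to log-Sobolev. *)
Theorem strongly_log_concave_entropy_le :
  ((Q - S * ln (S / Z))%:E <=
   \int[m]_x (expR (g x) * (G x ^+ 2 / (2 * c)))%:E)%E.
Proof.
pose s_ k : R := k.+2%:R^-1.
have s_0 k : 0 < s_ k by rewrite invr_gt0.
have s_2 k : s_ k <= 2^-1 by rewrite lef_pV2 ?posrE// ler_nat.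
have s_1 k : 0 < s_ k < 1.
  by rewrite s_0 (le_lt_trans (s_2 k))// invf_lt1// ltr1n.
have s_c : s_ k @[k --> \oo] --> (0 : R).
  have := @cvg_harmonic R; rewrite -cvg_shiftS; exact.
have mh_ k : measurable_fun setT (fun x => (h (s_ k) x)%:E).
  exact/measurable_EFinP.
have mf : measurable_fun setT
    (fun x => (expR (g x) * (G x ^+ 2 / (2 * c)))%:E).
  apply/measurable_EFinP; apply: measurable_funM.
    exact: measurable_expR_comp.
  by apply: measurable_funM => //; exact: measurable_funX.
have aeD (P : 'rV[R]_n -> Prop) : (forall x, D x -> P x) -> {ae m, forall x, P x}.
  move=> DP; exists [set x | ~~ D x]; split => //.
    rewrite (_ : [set x | ~~ D x] = setT `&` D @^-1` [set false]).
      exact: mD.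
    by apply/seteqP; split=> x /=; [move=> /negbTE ->|case=> _ ->].
  by move=> x /= nP; apply/negP => /DP.
pose K x := expR M * ((2 / c * G x ^+ 2 + 16 * M / c * A x) * expR (2 * M)).
have iK : m.-integrable setT (EFin \o K).
  apply: integrable_mull.
  rewrite (_ : (fun x => _) = fun x => expR (2 * M) *
    (2 / c * G x ^+ 2 + 16 * M / c * A x)); last by apply/funext => x; rewrite mulrC.
  by apply: integrable_mull; apply: integrable_addr; exact: integrable_mull.
have hc : {ae m, forall x, setT x ->
    (h (s_ k) x)%:E @[k --> \oo] --> (expR (g x) * (G x ^+ 2 / (2 * c)))%:E}.
  by apply: aeD => x Dx _; apply: cvg_EFin; [exact: nearW|exact: h_cvg].
have hd : {ae m, forall x k, setT x -> (`|(h (s_ k) x)%:E| <= (EFin \o K) x)%E}.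
  apply: aeD => x Dx k _; rewrite /= lee_fin ger0_norm ?h_ge0//.
  by apply: h_dominated => //; rewrite s_0 s_2.
have [_ _ cvg] := dominated_convergence measurableT mh_ mf hc iK hd.
rewrite -(cvg_lim _ cvg)//; apply: lime_ge; first by apply: cvgP cvg.
by apply: nearW => k; exact: entropy_le_h.
Qed.

End strongly_log_concave_entropy.

(** * Increments of smooth functions on balls *)

Section increments.
Context {R : realType} {n : nat}.
Implicit Types (f u : 'rV[R]_n -> R) (a b x : 'rV[R]_n) (r : R).

Lemma derive_grad f a v : differentiable f a ->
  'D_v f a = \sum_(i < n) v ord0 i * grad f a ord0 i.
Proof.
move=> df; rewrite deriveE// {1}[v]row_sum_delta linear_sum.
by apply: eq_bigr => i _; rewrite linearZ /= mxE deriveE.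
Qed.

Lemma segment_mean_value f a b : (forall x, differentiable f x) ->
  exists2 t : R, 0 < t < 1 &
    f b - f a = \sum_(i < n) (b - a) ord0 i * grad f (t *: (b - a) + a) ord0 i.
Proof.
move=> df; pose h (t : R) := f (t *: (b - a) + a).
have hD (t : R) : is_derive t 1 h ('D_(b - a) f (t *: (b - a) + a)).
  have E : (fun s : R => s^-1 *: ((h \o shift t) (s *: (1 : R)) - h t)) =
      (fun s : R => s^-1 *: ((f \o shift (t *: (b - a) + a)) (s *: (b - a)) -
        f (t *: (b - a) + a))).
    apply/funext => s /=; congr (_ *: (f _ - _)).
    by rewrite /shift /= scalerDl addrA /GRing.scale /= mulr1.
  apply: DeriveDef; first by rewrite /derivable E; exact: diff_derivable.
  by rewrite /derive E.
have hc : {within `[0, 1], continuous h}.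
  apply: continuous_subspaceT => t; apply: differentiable_continuous.
  by apply/derivable1_diffP; case: (hD t).
have [t t01 ht] := MVT ltr01 (fun t _ => hD t) hc.
exists t; first by rewrite in_itv /= in t01.
move: ht; rewrite /h scale1r scale0r add0r subrK => ->.
by rewrite subr0 mulr1; exact: derive_grad.
Qed.

Lemma continuous_ball_bounded (f : 'rV[R]_n -> R) r : continuous f ->
  exists2 B : R, 0 <= B & forall x, enorm x <= r -> `|f x| <= B.
Proof.
move=> cf.
pose K := [set x : 'rV[R]_n | forall i, `[- r, r]%classic (x ord0 i)].
have cK : compact K.
  apply: (@rV_compact R n (fun=> `[- r, r]%classic)) => i; exact: segment_compact.
have : bounded_set [set f x | x in K].
  apply: compact_bounded; apply: continuous_compact => //.
  exact: continuous_subspaceT.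
move=> [B [_ hB]]; exists (`|B| + 1) => [|x xr]; first by rewrite addr_ge0.
apply: (hB (`|B| + 1)); first by rewrite ltr_pwDr// ler_norm.
exists x => // i /=; rewrite in_itv /= -ler_norml.
exact: le_trans (coord_le_enorm _ _) xr.
Qed.

Lemma grad_ball_bounded u r : (forall i, continuous (fun x => grad u x ord0 i)) ->
  exists2 B : R, 0 <= B & forall x, enorm x <= r -> enorm (grad u x) <= B.
Proof.
move=> cu.
pose B i := sval (cid2 (continuous_ball_bounded r (cu i))).
have hB i x : enorm x <= r -> `|grad u x ord0 i| <= B i.
  by rewrite /B; case: cid2 => /= B' _; apply.
exists (Num.sqrt (\sum_(i < n) B i ^+ 2)); first exact: sqrtr_ge0.
move=> x xr; apply: ler_wsqrtr; apply: ler_sum => i _.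
rewrite -[leLHS]real_normK ?num_real// ler_pXn2r ?nnegrE ?hB//.
exact: le_trans (hB i x xr).
Qed.

Lemma ball_segment a b r (t : R) : enorm a <= r -> enorm b <= r -> 0 < t < 1 ->
  enorm (t *: (b - a) + a) <= r.
Proof.
move=> ar br /andP[t0 t1].
have -> : t *: (b - a) + a = t *: b + (1 - t) *: a.
  by rewrite scalerBr scalerBl scale1r -addrA [- _ + _]addrC.
have s0 : 0 <= 1 - t by rewrite subr_ge0 ltW.
apply: le_trans (ler_enormD _ _) _; rewrite !enormZ (ger0_norm (ltW t0)) ger0_norm//.
by have := ler_wpM2l (ltW t0) br; have := ler_wpM2l s0 ar; lra.
Qed.

Lemma lipschitz_ball u r : (forall x, differentiable u x) ->
  (forall i, continuous (fun x => grad u x ord0 i)) ->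
  exists2 L : R, 0 <= L & forall a b, enorm a <= r -> enorm b <= r ->
    `|u b - u a| <= L * enorm (b - a).
Proof.
move=> du cu; have [L L0 hL] := grad_ball_bounded r cu.
exists L => // a b ar br; have [t t01 ->] := segment_mean_value a b du.
apply: le_trans (cauchy_schwarz _ _) _; rewrite mulrC.
by apply: ler_wpM2r; [exact: enorm_ge0|apply/hL/ball_segment].
Qed.

(** A second-order bound with the slope at the base point kept exact: the slope
    becomes the gradient in the final inequality, whereas the constant [L], which
    depends on [f], must disappear in the limit. *)
Lemma smooth_increment f r : smooth f ->
  exists L F N : R, [/\ 0 <= L, 0 <= F, 0 <= N,
    (forall x, enorm x <= r -> `|f x| <= F /\ enorm (grad f x) <= N) &
    forall a b, enorm a <= r -> enorm b <= r ->
      `|f b - f a| <=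
        (enorm (grad f a) + L * enorm (b - a)) * enorm (b - a)].
Proof.
move=> sf; have [df d2f] := sf 2; have cf := sf 0.
have dgf i x : differentiable (fun x => grad f x ord0 i) x by have [] := d2f i.
have cgf i : continuous (fun x => grad f x ord0 i).
  by move=> x; exact: differentiable_continuous.
have ex i : exists2 L : R, 0 <= L & forall a b, enorm a <= r -> enorm b <= r ->
    `|grad f b ord0 i - grad f a ord0 i| <= L * enorm (b - a).
  by apply: (lipschitz_ball r (dgf i)) => j; have [_ /(_ j)] := d2f i.
pose Li i := sval (cid2 (ex i)).
have Lip i : forall a b, enorm a <= r -> enorm b <= r ->
    `|grad f b ord0 i - grad f a ord0 i| <= Li i * enorm (b - a).
  by rewrite /Li; case: cid2 => /= L' _; apply.
have [F F0 hF] := continuous_ball_bounded r cf.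
have [N N0 hN] := grad_ball_bounded r cgf.
exists (Num.sqrt (\sum_(i < n) Li i ^+ 2)), F, N; split => //.
  by move=> x xr; split; [exact: hF|exact: hN].
move=> a b ar br; have [t t01 ->] := segment_mean_value a b df.
set y := t *: (b - a) + a; have yr : enorm y <= r by exact: ball_segment.
apply: le_trans (cauchy_schwarz _ _) _; rewrite mulrC.
apply: ler_wpM2r; first exact: enorm_ge0.
have -> : grad f y = grad f a + (grad f y - grad f a) by rewrite addrC subrK.
apply: le_trans (ler_enormD _ _) _; rewrite lerD2l.
have yba : enorm (y - a) <= enorm (b - a).
  case/andP: t01 => t0 t1.
  rewrite /y addrK enormZ ger0_norm ?(ltW t0)//.
  by rewrite ler_piMl ?enorm_ge0// ltW.
apply: (@le_trans _ _ (Num.sqrt (\sum_(i < n) Li i ^+ 2) * enorm (y - a)));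
  last by apply: ler_wpM2l; rewrite ?sqrtr_ge0.
rewrite /enorm -sqrtrM; last by apply: sumr_ge0 => i _; exact: sqr_ge0.
apply: ler_wsqrtr; rewrite -[X in _ * X]enorm_sq mulr_suml.
apply: ler_sum => i _; rewrite -exprMn.
have -> : (grad f y - grad f a) ord0 i = grad f y ord0 i - grad f a ord0 i.
  by rewrite [LHS]mxE [X in _ + X]mxE.
rewrite -[leLHS]real_normK ?num_real//.
rewrite ler_pXn2r ?nnegrE//; last exact: le_trans (Lip i a y ar yr).
exact: Lip.
Qed.

End increments.

(** * The variational formula for the entropy *)

(** The integrand of the variational formula for the entropy: under a probability
    measure, the entropy of a function is the minimum over [b > 0] of the integral
    of its [relative_entropy b]. The integrand being nonnegative, this formula
    makes the entropies under two comparable measures comparable. *)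
Definition relative_entropy {R : realType} (b y : R) := y * ln y - y * ln b - y + b.

Section relative_entropy.
Context {R : realType}.
Implicit Types b y e : R.

Lemma ln_le_subr1 (x : R) : 0 < x -> ln x <= x - 1.
Proof.
move=> x0; rewrite -{1}(subrKC 1 x) le_ln1Dx//; lra.
Qed.

Lemma relative_entropy_ge0 b y : 0 < b -> 0 <= y -> 0 <= relative_entropy b y.
Proof.
rewrite /relative_entropy le_eqVlt => b0 /predU1P[<-|y0].
  by rewrite !mul0r !subr0 add0r ltW.
have := ler_wpM2l (ltW y0) (ln_le_subr1 (divr_gt0 b0 y0)).
rewrite ln_div ?posrE// mulrBr [X in _ <= X]mulrBr mulr1 [y * (b / y)]mulrC.
by rewrite divfK ?gt_eqF//; lra.
Qed.

Lemma mulr_ln_bound y (B : R) : 0 <= y <= B -> `|y * ln y| <= 1 + B ^+ 2.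
Proof.
move=> /andP[]; rewrite le_eqVlt => /predU1P[<-|y0] yB.
  by rewrite mul0r normr0 addr_ge0 ?sqr_ge0.
have h1 := ler_wpM2l (ltW y0) (ln_le_subr1 y0).
have := ler_wpM2l (ltW y0) (ln_le_subr1 (_ : 0 < y^-1)).
rewrite invr_gt0 => /(_ y0); rewrite lnV ?posrE// mulrBr divff ?gt_eqF// => h2.
have h3 : y ^+ 2 <= B ^+ 2 by rewrite ler_pXn2r ?nnegrE ?(ltW y0)// (le_trans (ltW y0)).
by rewrite ler_norml; apply/andP; split; nra.
Qed.

(** The increments of the convex function [y ln y] over steps of length
    [d^2] are smallest at the origin, where they are at least [- 2 d]. *)
Lemma relative_entropy_shift b y d (B : R) : 0 < b -> b <= B + d ^+ 2 ->
  0 <= y -> 0 < d <= 1 -> 0 <= B ->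
  relative_entropy b y <= relative_entropy b (y + d ^+ 2) + d * (B + 3).
Proof.
move=> b0 bB y0 /andP[d0 d1] B0; rewrite /relative_entropy.
have d20 : 0 < d ^+ 2 by rewrite exprn_gt0.
have yd : 0 < y + d ^+ 2 by rewrite ltr_wpDl.
have h1 : y * ln y <= y * ln (y + d ^+ 2).
  move: y0 yd; rewrite le_eqVlt => /predU1P[<-|y0] yd; first by rewrite !mul0r.
  by apply: ler_wpM2l; [exact: ltW|rewrite ler_ln ?posrE// lerDl ltW].
have h2 : d ^+ 2 * ln (d ^+ 2) <= d ^+ 2 * ln (y + d ^+ 2).
  by apply: ler_wpM2l; [exact: ltW|rewrite ler_ln ?posrE// lerDr].
have h3 : - (d ^+ 2 * ln (d ^+ 2)) <= 2 * d.
  have := ln_le_subr1 (_ : 0 < d^-1); rewrite invr_gt0 => /(_ d0).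
  rewrite lnV ?posrE// lnXn// => h.
  have := ler_wpM2l (ltW d20) h.
  rewrite [X in _ <= X]mulrBr mulr1 {2}expr2 mulfK ?gt_eqF// mulrN => h'.
  by rewrite -mulr_natl; nra.
have h4 := ln_le_subr1 b0.
have h5 : d ^+ 2 * ln b <= d ^+ 2 * B.
  by apply: ler_wpM2l; [exact: ltW|nra].
have h6 : d ^+ 2 <= d by rewrite expr2 ler_piMr// ltW.
have h7 : d ^+ 2 * B <= d * B by apply: ler_wpM2r.
nra.
Qed.

End relative_entropy.

(** * Log-Sobolev inequalities for images of strongly log-concave measures *)

(** Transport of the entropy inequality from a strongly log-concave measure [m]
    to a measure [mu] comparable with its image under [Phi]. The two comparisons
    are separate because the second one carries the squared local Lipschitz
    constant [kap] of [Phi], which need only be bounded on average. *)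
Section log_sobolev_image.
Context {R : realType} {N n : nat}.
Variables (c : R) (p : 'rV[R]_N -> R) (m : {measure set 'rV[R]_N -> \bar R}).
Hypotheses (c0 : 0 < c) (mp : measurable_fun setT p) (p0 : forall x, 0 <= p x).
Hypothesis slcp : strongly_log_concave c p.
Hypothesis mE : forall A, measurable A ->
  m A = (\int[lebesgue_rV N]_(x in A) (p x)%:E)%E.
Hypotheses (moo : (m setT < +oo)%E) (m0 : (0 < m setT)%E).
Variables (Phi : 'rV[R]_N -> 'rV[R]_n) (kap : 'rV[R]_N -> R)
  (D : 'rV[R]_N -> bool) (r : R).
Hypotheses (mPhi : measurable_fun setT Phi) (mkap : measurable_fun setT kap)
  (mD : measurable_fun setT D).
Hypotheses (kap0 : forall x, 0 <= kap x) (Dnull : m [set x | ~~ D x] = 0%E).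
Hypothesis Phi_ball : forall x, 0 < p x -> enorm (Phi x) <= r.
Hypothesis Phi_lip : forall x z, 0 < p x -> 0 < p z -> D z ->
  enorm (Phi x - Phi z) <= kap z * enorm (x - z).
Hypothesis ikap : m.-integrable setT (EFin \o (fun x => kap x ^+ 2)).
Variables (mu : probability 'rV[R]_n R) (al be : R).
Hypotheses (al0 : 0 < al) (be0 : 0 < be).
Hypothesis mu_le : forall H : 'rV[R]_n -> \bar R,
  measurable_fun setT H -> (forall x, 0 <= H x)%E ->
  (\int[mu]_x H x <= al%:E * \int[m]_x H (Phi x))%E.
Hypothesis mu_ge : forall H : 'rV[R]_n -> \bar R,
  measurable_fun setT H -> (forall x, 0 <= H x)%E ->
  (\int[m]_x (H (Phi x) * (kap x ^+ 2)%:E) <= be%:E * \int[mu]_x H x)%E.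

Variable f : 'rV[R]_n -> R.
Hypothesis sf : smooth f.

Let Z := fine (m setT).

Let mZ : m setT = Z%:E.
Proof. by rewrite fineK// ge0_fin_numE. Qed.

Let Z0 : 0 < Z.
Proof. by rewrite -lte_fin -mZ. Qed.

Let muoo : (mu setT < +oo)%E.
Proof. by rewrite probability_setT ltry. Qed.

Let ball (y : 'rV[R]_n) : bool := enorm y <= r.

Let mball : measurable_fun setT ball.
Proof. by apply: measurable_fun_ler => //; exact: measurable_enorm. Qed.

Let ball_ae : {ae mu, forall y, ball y}.
Proof.
exists [set y | ~~ ball y].
have mB : measurable [set y | ~~ ball y].
  rewrite (_ : [set y | ~~ ball y] = setT `&` ball @^-1` [set false]).
    exact: mball.
  by apply/seteqP; split=> x /=; [move=> /negbTE ->|case=> _ ->].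
split => //; last by move=> y /= /negP.
apply/eqP; rewrite eq_le measure_ge0 andbT.
rewrite -[X in mu X]setIT -(@integral_indic _ _ _ mu setT measurableT)//.
have mI : measurable_fun setT (fun y => (\1_[set y | ~~ ball y] y)%:E : \bar R).
  by apply/measurable_EFinP.
apply: le_trans (mu_le mI _) _; first by move=> y; rewrite lee_fin.
rewrite (ge0_integral_density mp p0 mE); last 2 first.
- exact: (measurableT_comp mI mPhi).
- by move=> y; rewrite lee_fin.
rewrite integral0_eq ?mule0// => x _; have := p0 x; rewrite le_eqVlt.
move=> /predU1P[<-|px]; first by rewrite mule0.
by rewrite indicE memNset ?mul0e//= /ball Phi_ball.
Qed.

Let mf : measurable_fun setT f.
Proof. by apply: continuous_measurable_rV; exact: (sf 0). Qed.

Let mgrad : measurable_fun setT (fun y => enorm (grad f y)).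
Proof.
apply: (measurableT_comp measurable_enorm); apply: measurable_fun_rV => i.
apply: continuous_measurable_rV => y; apply: differentiable_continuous.
by have [_ /(_ i)[]] := sf 2.
Qed.

(** [f] and the norm of its gradient, cut off outside the ball that carries the
    measure, so that they are bounded. *)
Let fc y := if ball y then f y else 0.
Let Nc y := if ball y then enorm (grad f y) else 0.

Let mfc : measurable_fun setT fc.
Proof. exact: measurable_fun_ifT. Qed.

Let mNc : measurable_fun setT Nc.
Proof. exact: measurable_fun_ifT. Qed.

Let Nc0 y : 0 <= Nc y.
Proof. by rewrite /Nc; case: ifP => // _; exact: enorm_ge0. Qed.

Section bounds.
Variables (L F K : R).
Hypotheses (L0 : 0 <= L) (F0 : 0 <= F) (K0 : 0 <= K).
Hypothesis fNbound :
  forall x, enorm x <= r -> `|f x| <= F /\ enorm (grad f x) <= K.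
Hypothesis incr : forall a b, enorm a <= r -> enorm b <= r ->
  `|f b - f a| <= (enorm (grad f a) + L * enorm (b - a)) * enorm (b - a).

Let fcF y : fc y ^+ 2 <= F ^+ 2.
Proof.
rewrite -[leLHS]real_normK ?num_real// ler_pXn2r ?nnegrE// /fc.
by case: ifP => [yr|_]; [case: (fNbound yr)|rewrite normr0].
Qed.

Let fcabs y : `|fc y| <= F.
Proof. by rewrite /fc; case: ifP => [yr|_]; [case: (fNbound yr)|rewrite normr0]. Qed.

Let NcK y : Nc y <= K.
Proof. by rewrite /Nc; case: ifP => [yr|_//]; case: (fNbound yr). Qed.

Let T := \int[mu]_y (fc y ^+ 2).
Let X := \int[mu]_y (fc y ^+ 2 * ln (fc y ^+ 2)).

Let mfc2 : measurable_fun setT (fun y => fc y ^+ 2).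
Proof. exact: measurable_funX. Qed.

Let mfcln : measurable_fun setT (fun y => fc y ^+ 2 * ln (fc y ^+ 2)).
Proof.
by apply: measurable_funM => //; exact: (measurableT_comp (@measurable_ln R)).
Qed.

Let ifc2 : mu.-integrable setT (EFin \o (fun y => fc y ^+ 2)).
Proof.
by apply: (bounded_integrable muoo mfc2) => y; rewrite ger0_norm ?sqr_ge0 ?fcF.
Qed.

Let ifcln : mu.-integrable setT (EFin \o (fun y => fc y ^+ 2 * ln (fc y ^+ 2))).
Proof.
apply: (@bounded_integrable _ _ _ _ _ (1 + (F ^+ 2) ^+ 2) muoo mfcln) => y.
by apply: mulr_ln_bound; rewrite sqr_ge0 fcF.
Qed.

Let T0 : 0 <= T.
Proof. by apply: Rintegral_ge0 => y _; exact: sqr_ge0. Qed.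

Let entropy_cutoff : entropy_sq mu f = (X - T * ln T)%:E.
Proof.
have ae (h : R -> R) : measurable_fun setT h ->
    (\int[mu]_y (h (f y))%:E = \int[mu]_y (h (fc y))%:E)%E.
  move=> mh; apply: ae_eq_integral => //.
  - by apply/measurable_EFinP; exact: measurableT_comp.
  - by apply/measurable_EFinP; exact: measurableT_comp.
  - by apply: filterS ball_ae => y yB _; rewrite /fc yB.
have msq : measurable_fun setT (fun t : R => t ^+ 2) by exact: measurable_funX.
have ml : measurable_fun setT (fun t : R => t ^+ 2 * ln (t ^+ 2)).
  apply: measurable_funM => //.
  exact: (measurableT_comp (@measurable_ln R)).
rewrite /entropy_sq (ae _ ml) (ae _ msq).
have -> : (\int[mu]_y (fc y ^+ 2)%:E = T%:E)%E.
  by rewrite /T /Rintegral fineK// integrable_fin_num.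
have -> : (\int[mu]_y (fc y ^+ 2 * ln (fc y ^+ 2))%:E = X%:E)%E.
  by rewrite /X /Rintegral fineK// integrable_fin_num.
rewrite /lne; case: ifP => [T_le0|_]; last by rewrite -EFinM -EFinB.
have -> : T = 0 by apply/eqP; rewrite eq_le T_le0.
by rewrite mul0e mul0r sube0 subr0.
Qed.

(** The variational formula: every [b] gives an upper bound for the entropy. *)
Let entropy_le_relative b : 0 < b ->
  ((X - T * ln T)%:E <= \int[mu]_y (relative_entropy b (fc y ^+ 2))%:E)%E.
Proof.
move=> b0.
have -> : (\int[mu]_y (relative_entropy b (fc y ^+ 2))%:E =
    (X - T * ln b - T + b)%:E)%E.
  have -> : (fun y => (relative_entropy b (fc y ^+ 2))%:E) = (EFin \o (fun y =>
      (fc y ^+ 2 * ln (fc y ^+ 2) - (ln b + 1) * fc y ^+ 2) + b)).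
    by apply/funext => y /=; congr _%:E; rewrite /relative_entropy; ring.
  have i1 := integrable_mull (ln b + 1) ifc2.
  have ib : mu.-integrable setT (EFin \o (fun=> b)).
    by apply: (@bounded_integrable _ _ _ _ _ `|b|) => //; exact: measurable_cst.
  rewrite -[LHS]fineK; last first.
    apply: integrable_fin_num => //; apply: integrable_addr => //.
    exact: integrable_subr.
  congr _%:E; rewrite -/(Rintegral mu setT _).
  rewrite (@RintegralD _ _ _ mu setT (fun y => fc y ^+ 2 * ln (fc y ^+ 2) -
    (ln b + 1) * fc y ^+ 2) (fun=> b))//; last exact: integrable_subr.
  rewrite RintegralB// RintegralZl// Rintegral_cst// -/T -/X.
  have -> : fine (mu [set: _]) = 1.
    by have e : mu setT = 1%E := probability_setT mu; rewrite e.
  by ring.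
rewrite lee_fin; have := relative_entropy_ge0 b0 T0; rewrite /relative_entropy; lra.
Qed.

Section regularization.
Variable d : R.
Hypothesis d01 : 0 < d <= 1.
Let d0 : 0 < d. Proof. by case/andP: d01. Qed.

Let e0 : 0 < d ^+ 2. Proof. exact: exprn_gt0. Qed.

(** Adding [d^2] makes the logarithm of the square of the function bounded. *)
Let v x := fc (Phi x) ^+ 2 + d ^+ 2.

Let v0 x : 0 < v x.
Proof. by rewrite ltr_wpDl// sqr_ge0. Qed.

Let vF x : v x <= F ^+ 2 + d ^+ 2.
Proof. by rewrite lerD2r. Qed.

Let mv : measurable_fun setT v.
Proof. by apply: measurable_funD => //; exact: (measurableT_comp mfc2). Qed.

Let g x := ln (v x).

Let expg x : expR (g x) = v x.
Proof. by rewrite lnK ?posrE. Qed.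

Let mg : measurable_fun setT g.
Proof. exact: (measurableT_comp (@measurable_ln R)). Qed.

Let M := `|ln (d ^+ 2)| + `|ln (F ^+ 2 + d ^+ 2)| + 1.

Let gM x : `|g x| <= M.
Proof.
have h1 : ln (d ^+ 2) <= g x by rewrite ler_ln ?posrE// lerDr sqr_ge0.
have h2 : g x <= ln (F ^+ 2 + d ^+ 2).
  by rewrite ler_ln ?posrE ?(lt_le_trans (v0 x)).
have h3 := ler_norm (ln (F ^+ 2 + d ^+ 2)).
have h4 := ler_norm (- ln (d ^+ 2)); rewrite normrN in h4.
have h5 := normr_ge0 (ln (F ^+ 2 + d ^+ 2)).
have h6 := normr_ge0 (ln (d ^+ 2)).
by rewrite /M ler_norml; apply/andP; split; lra.
Qed.

(** [2 |u| / (u^2 + d^2)] is the slope of [ln (u^2 + d^2)]. *)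
Let slope x := 2 * `|fc (Phi x)| * (expR (- g x)).

Let G x := slope x * (Nc (Phi x) * kap x).
Let B := d ^- 2 * (2 * F * L + (K + 2 * L * r) ^+ 2).
Let A x := B * kap x ^+ 2.

Let vinv x : expR (- g x) = (v x)^-1.
Proof. by rewrite expRN expg. Qed.

Let vinv_le x : (v x)^-1 <= d ^- 2.
Proof. by rewrite lef_pV2 ?posrE// lerDr sqr_ge0. Qed.

Let slope_ge0 x : 0 <= slope x.
Proof. by rewrite /slope !mulr_ge0// expR_ge0. Qed.

Let slope_le x : slope x <= 2 * F * d ^- 2.
Proof.
rewrite /slope vinv; apply: ler_pM; rewrite ?mulr_ge0 ?invr_ge0 ?(ltW (v0 x))//.
by rewrite ler_pM2l ?fcabs.
Qed.

Let G0 x : 0 <= G x.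
Proof. by rewrite /G !mulr_ge0. Qed.

Let r0 : 0 <= r.
Proof.
have [x px] : exists x, 0 < p x.
  apply: contrapT => /forallNP np.
  move: m0; rewrite mE// integral0_eq ?ltxx// => x _.
  by congr _%:E; apply/eqP; rewrite eq_le p0 andbT leNgt; exact/negP/np.
exact: le_trans (enorm_ge0 _) (Phi_ball px).
Qed.

Let A0 x : 0 <= A x.
Proof.
rewrite /A mulr_ge0 ?sqr_ge0// mulr_ge0 ?invr_ge0 ?(ltW e0)//.
by rewrite addr_ge0 ?sqr_ge0// !mulr_ge0.
Qed.

Let mG : measurable_fun setT G.
Proof.
apply: measurable_funM.
  apply: measurable_funM; last first.
    by apply: measurable_expR_comp; exact: measurable_funN.
  apply: measurable_funM => //; apply: measurableT_comp => //.
  exact: (measurableT_comp mfc).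
by apply: measurable_funM => //; exact: (measurableT_comp mNc).
Qed.

Let mA : measurable_fun setT A.
Proof. by apply: measurable_funM => //; exact: measurable_funX. Qed.

Let iA : m.-integrable setT (fun x => (A x)%:E).
Proof. exact: integrable_mull. Qed.

Let iG : m.-integrable setT (fun x => (G x ^+ 2)%:E).
Proof.
apply: (le_integrable measurableT _ _
  (integrable_mull ((2 * F * d ^- 2 * K) ^+ 2) ikap)).
  by apply/measurable_EFinP; exact: measurable_funX.
have C0 : 0 <= 2 * F * d ^- 2 * K.
  by apply: mulr_ge0 => //; apply: mulr_ge0; rewrite ?invr_ge0 ?(ltW e0)// mulr_ge0.
move=> x _ /=; rewrite lee_fin ger0_norm ?sqr_ge0// ger0_norm; last first.
  by apply: mulr_ge0; exact: sqr_ge0.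
rewrite -exprMn ler_pXn2r ?nnegrE ?G0//; last exact: mulr_ge0.
rewrite /G mulrA; apply: ler_wpM2r => //.
apply: ler_pM; [exact: slope_ge0|exact: Nc0|exact: slope_le|exact: NcK].
Qed.

Let gGA x z : 0 < p x -> 0 < p z -> D z ->
  g x <= g z + G z * enorm (x - z) + A z * enorm (x - z) ^+ 2.
Proof.
move=> px pz Dz.
have xr := Phi_ball px; have zr := Phi_ball pz.
have lip : enorm (Phi x - Phi z) <= kap z * enorm (x - z) by exact: Phi_lip.
have := incr zr xr; rewrite -/(ball _).
have Ncz : Nc (Phi z) = enorm (grad f (Phi z)) by rewrite /Nc /ball zr.
have fz : fc (Phi z) = f (Phi z) by rewrite /fc /ball zr.
have fx : fc (Phi x) = f (Phi x) by rewrite /fc /ball xr.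
rewrite -Ncz -fz -fx.
set q := enorm (Phi x - Phi z) in lip *; set rho := enorm (x - z) in lip *.
have q0 : 0 <= q by exact: enorm_ge0.
have q2r : q <= 2 * r.
  rewrite mulr2n mulrDl mul1r; apply: le_trans (ler_enormD _ _) _.
  by rewrite enormN lerD.
set u := fc (Phi z); set w := fc (Phi x) => hw.
have lnle : g x <= g z + (v z)^-1 * (v x - v z).
  have -> : g x = g z + ln (v x / v z) by rewrite ln_div ?posrE// addrC subrK.
  rewrite lerD2l; apply: le_trans (ln_le_subr1 (divr_gt0 (v0 x) (v0 z))) _.
  by rewrite mulrBr mulVf ?gt_eqF// mulrC.
apply: le_trans lnle _; rewrite -[leRHS]addrA lerD2l.
have i0 : 0 <= (v z)^-1 by rewrite invr_ge0 ltW.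
have vxz : v x - v z <= 2 * `|u| * `|w - u| + `|w - u| ^+ 2.
  have -> : v x - v z = 2 * (u * (w - u)) + (w - u) ^+ 2 by rewrite /v -/u -/w; ring.
  have := ler_norm (u * (w - u)); rewrite normrM real_normK ?num_real//; lra.
apply: le_trans (ler_wpM2l i0 vxz) _.
rewrite mulrDr; apply: (@le_trans _ _ (G z * rho +
    2 * F * d ^- 2 * L * (kap z * rho) ^+ 2 +
    d ^- 2 * (K + 2 * L * r) ^+ 2 * (kap z * rho) ^+ 2)); last first.
  by rewrite -addrA lerD2l /A /B le_eqVlt; apply/orP; left; apply/eqP; ring.
have q2 : q ^+ 2 <= (kap z * rho) ^+ 2.
  by rewrite ler_pXn2r ?nnegrE// (le_trans q0).
apply: lerD.
  rewrite mulrA [_ * (2 * _)]mulrC -vinv -/(slope z).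
  apply: (@le_trans _ _ (slope z * ((Nc (Phi z) + L * q) * q))).
    by apply: ler_wpM2l.
  rewrite mulrDl mulrDr; apply: lerD.
    have -> : G z * rho = slope z * (Nc (Phi z) * (kap z * rho)) by rewrite /G; ring.
    by apply: ler_wpM2l => //; apply: ler_wpM2l.
  have -> : slope z * (L * q * q) = slope z * L * q ^+ 2 by ring.
  apply: ler_pM; [by rewrite mulr_ge0|exact: sqr_ge0| |exact: q2].
  by apply: ler_wpM2r.
rewrite -mulrA; apply: ler_pM; [exact: i0|exact: sqr_ge0|exact: vinv_le|].
apply: (@le_trans _ _ (((K + 2 * L * r) * q) ^+ 2)).
  rewrite ler_pXn2r ?nnegrE//; last by rewrite mulr_ge0// addr_ge0// !mulr_ge0.
  apply: le_trans hw _; apply: ler_wpM2r => //; apply: lerD; first exact: NcK.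
  by have := ler_wpM2l L0 q2r; lra.
by rewrite exprMn; apply: ler_wpM2l => //; exact: sqr_ge0.
Qed.

Let I := (\int[mu]_y (enorm (grad f y) ^+ 2)%:E)%E.
Let S := \int[m]_x expR (g x).
Let Q := \int[m]_x (g x * expR (g x)).

Let dirichlet_le :
  (\int[m]_x (expR (g x) * (G x ^+ 2 / (2 * c)))%:E <= (2 * be / c)%:E * I)%E.
Proof.
have mN2 : measurable_fun setT (fun y => (Nc y ^+ 2)%:E : \bar R).
  by apply/measurable_EFinP; exact: measurable_funX.
have mk2 : measurable_fun setT (fun x => (kap x ^+ 2)%:E : \bar R).
  by apply/measurable_EFinP; exact: measurable_funX.
have mNk : measurable_fun setT
    (fun x => ((Nc (Phi x) ^+ 2)%:E * (kap x ^+ 2)%:E)%E).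
  by apply: emeasurable_funM => //; exact: (measurableT_comp mN2 mPhi).
have NI : (\int[mu]_y (Nc y ^+ 2)%:E <= I)%E.
  apply: ge0_le_integral => //.
  - by move=> y _; rewrite lee_fin sqr_ge0.
  - by apply/measurable_EFinP; exact: measurable_funX.
  - move=> y _; rewrite lee_fin /Nc; case: ifP => // _.
    by rewrite expr0n sqr_ge0.
apply: (@le_trans _ _ ((2 / c)%:E *
    \int[m]_x ((Nc (Phi x) ^+ 2)%:E * (kap x ^+ 2)%:E))%E); last first.
  rewrite (_ : 2 * be / c = 2 / c * be); last by ring.
  rewrite (EFinM (2 / c) be) -muleA.
  apply: lee_wpmul2l; first by rewrite lee_fin divr_ge0 ?ltW.
  apply: le_trans (mu_ge mN2 _) _; first by move=> y; rewrite lee_fin sqr_ge0.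
  by apply: lee_wpmul2l => //; rewrite lee_fin ltW.
rewrite -ge0_integralZl//; last 2 first.
- by move=> x _; rewrite mule_ge0// lee_fin sqr_ge0.
- by rewrite lee_fin divr_ge0 ?ltW.
apply: ge0_le_integral => //.
- by move=> x _; rewrite lee_fin mulr_ge0 ?expR_ge0// divr_ge0 ?sqr_ge0// mulr_ge0 ?ltW.
- apply/measurable_EFinP; apply: measurable_funM.
    exact: measurable_expR_comp.
  by apply: measurable_funM => //; exact: measurable_funX.
- exact: measurable_funeM.
move=> x _; rewrite -!EFinM lee_fin expg /G /slope vinv.
have -> : v x * ((2 * `|fc (Phi x)| / v x * (Nc (Phi x) * kap x)) ^+ 2 / (2 * c)) =
    2 / c * (`|fc (Phi x)| ^+ 2 / v x * (Nc (Phi x) ^+ 2 * kap x ^+ 2)).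
  by field; rewrite !gt_eqF.
apply: ler_wpM2l; first by rewrite divr_ge0 ?ltW.
rewrite ler_piMl ?mulr_ge0 ?sqr_ge0// ler_pdivrMr// mul1r real_normK ?num_real//.
by rewrite lerDl ltW.
Qed.

(** The entropy under [mu] is at most [al] times the integral of
    [relative_entropy] under [m], by the variational formula at the mean [b] of
    [exp g]; this integral is at most the entropy of [exp g] under [m] plus an
    error of order [d]. *)
Lemma entropy_regularized :
  ((X - T * ln T)%:E <=
   al%:E * ((2 * be / c)%:E * I + (d * (F ^+ 2 + 3) * Z)%:E))%E.
Proof.
have M0 : 0 < M by rewrite ltr_pwDr// addr_ge0.
have core := strongly_log_concave_entropy_le c0 mp p0 slcp mE moo m0 mg mG mA
  mD M0 gM G0 A0 Dnull gGA iG iA.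
rewrite -/S -/Q -/Z in core.
have SE : S = \int[m]_x v x by apply: eq_Rintegral => x _; rewrite expg.
have iv : m.-integrable setT (EFin \o v).
  apply: (@bounded_integrable _ _ _ _ _ (F ^+ 2 + d ^+ 2)) => // x.
  by rewrite ger0_norm// ltW.
have ic (k : R) : m.-integrable setT (EFin \o (fun=> k)).
  by apply: (@bounded_integrable _ _ _ _ _ `|k|) => //; exact: measurable_cst.
have S0 : 0 < S.
  apply: (@lt_le_trans _ _ (d ^+ 2 * Z)); first exact: mulr_gt0.
  rewrite SE -Rintegral_cst//; apply: le_Rintegral => // x _.
  by rewrite lerDr sqr_ge0.
have SF : S <= (F ^+ 2 + d ^+ 2) * Z.
  by rewrite SE -Rintegral_cst//; apply: le_Rintegral => // x _; exact: vF.
have b0 : 0 < S / Z by exact: divr_gt0.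
set b := S / Z in b0 core.
have bF : b <= F ^+ 2 + d ^+ 2 by rewrite ler_pdivrMr.
apply: le_trans (entropy_le_relative b0) _.
have mre : measurable_fun setT (fun y => (relative_entropy b (fc y ^+ 2))%:E).
  apply/measurable_EFinP; apply: measurable_funD => //.
  apply: measurable_funB => //; apply: measurable_funB => //.
  exact: measurable_funM.
have re0 y : (0 <= (relative_entropy b (fc y ^+ 2))%:E)%E.
  by rewrite lee_fin relative_entropy_ge0// sqr_ge0.
apply: le_trans (mu_le mre re0) _.
apply: lee_wpmul2l; first by rewrite lee_fin ltW.
have iglng : m.-integrable setT (EFin \o (fun x => g x * expR (g x))).
  apply: (@bounded_integrable _ _ _ _ _ (M * (F ^+ 2 + d ^+ 2))) => //.
    by apply: measurable_funM => //; exact: measurable_expR_comp.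
  move=> x; rewrite normrM; apply: ler_pM => //.
  by rewrite expg ger0_norm// ltW.
have Eb : (\int[m]_x (relative_entropy b (v x) + d * (F ^+ 2 + 3))%:E =
    (Q - S * ln b + d * (F ^+ 2 + 3) * Z)%:E)%E.
  have -> : (fun x => (relative_entropy b (v x) + d * (F ^+ 2 + 3))%:E) =
      (EFin \o (fun x => (g x * expR (g x) - (ln b + 1) * v x) +
        (b + d * (F ^+ 2 + 3)))).
    apply/funext => x /=; congr _%:E; rewrite /relative_entropy expg /g; ring.
  have i1 := integrable_mull (ln b + 1) iv.
  rewrite -[LHS]fineK; last first.
    apply: integrable_fin_num => //; apply: integrable_addr => //.
    exact: integrable_subr.
  congr _%:E; rewrite -/(Rintegral m setT _).
  rewrite (@RintegralD _ _ _ m setT (fun x => g x * expR (g x) -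
    (ln b + 1) * v x) (fun=> b + d * (F ^+ 2 + 3)))//; last exact: integrable_subr.
  rewrite RintegralB// RintegralZl// Rintegral_cst// -/Q -SE -/Z.
  have bZ : b * Z = S by rewrite /b divfK// gt_eqF.
  by rewrite [X in _ + X = _]mulrDl bZ; ring.
apply: (@le_trans _ _ (Q - S * ln b + d * (F ^+ 2 + 3) * Z)%:E).
  rewrite -Eb; apply: ge0_le_integral => //.
  - exact: (measurableT_comp mre mPhi).
  - apply/measurable_EFinP; apply: measurable_funD => //.
    apply: measurable_funD => //; apply: measurable_funB => //.
    apply: measurable_funB => //; last exact: measurable_funM.
    by apply: measurable_funM => //; exact: (measurableT_comp (@measurable_ln R)).
  - move=> x _; rewrite lee_fin; apply: relative_entropy_shift => //.
    + exact: sqr_ge0.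
    + exact: sqr_ge0.
rewrite EFinD leeD2r//; exact: le_trans core dirichlet_le.
Qed.

End regularization.

Lemma entropy_le_dirichlet : (entropy_sq mu f <=
  (2 * al * be / c)%:E * \int[mu]_y (enorm (grad f y) ^+ 2)%:E)%E.
Proof.
rewrite entropy_cutoff.
have C0 : 0 < 2 * al * be / c by rewrite divr_gt0 ?mulr_gt0.
set I := (\int[mu]_y (enorm (grad f y) ^+ 2)%:E)%E.
have I0 : (0 <= I)%E by apply: integral_ge0 => y _; rewrite lee_fin sqr_ge0.
case E : I I0 => [i| |//] I0; last by rewrite gt0_muley ?lte_fin// leey.
rewrite -EFinM lee_fin; apply/ler_addgt0Pr => e e0.
pose k := al * ((F ^+ 2 + 3) * Z).
have k0 : 0 < k by rewrite !mulr_gt0// ltr_wpDl ?sqr_ge0.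
pose d := Num.min 1 (e / k).
have d01 : 0 < d <= 1 by rewrite lt_min ltr01 divr_gt0//= ge_min lexx.
have := entropy_regularized d01; rewrite -/I E.
rewrite -[X in (_ <= X)%E]/((al * (2 * be / c * i + d * (F ^+ 2 + 3) * Z))%:E) lee_fin.
move=> /le_trans; apply; rewrite mulrDr; apply: lerD.
  by rewrite le_eqVlt; apply/orP; left; apply/eqP; ring.
have -> : al * (d * (F ^+ 2 + 3) * Z) = d * k by rewrite /k; ring.
by rewrite -ler_pdivlMr// /d ge_min lexx orbT.
Qed.

End bounds.

(** With [g = ln (f^2 + d^2)] composed with [Phi], the bound [exp g G^2 / (2 c)]
    is [4 f^2 / (f^2 + d^2)] times [|grad f|^2 kap^2 / (2 c)], so at most
    [2 / c |grad f|^2 kap^2], for every [d]; the errors vanish with [d]. *)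
Lemma log_sobolev_entropy_le : (entropy_sq mu f <=
  (2 * al * be / c)%:E * \int[mu]_y (enorm (grad f y) ^+ 2)%:E)%E.
Proof.
have [L [F [K [L0 F0 K0 bd incr]]]] := smooth_increment r sf.
exact: entropy_le_dirichlet bd incr.
Qed.

End log_sobolev_image.

(** * Polar coordinates *)

Lemma measurable_funV d (T : measurableType d) (R : realType) (f : T -> R) :
  measurable_fun setT f -> measurable_fun setT (fun x => (f x)^-1).
Proof.
move=> mf.
have -> : (fun x => (f x)^-1) = (fun x => f x * ((f x ^+ 2) `^ (- 1))).
  apply/funext => x; rewrite powR_inv1 ?sqr_ge0//.
  have [->|fx] := eqVneq (f x) 0; first by rewrite invr0 mul0r.
  by rewrite expr2 invfM mulrA divff// mul1r.
apply: measurable_funM => //.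
apply: (measurableT_comp (@measurable_powR R (- 1))); exact: measurable_funX.
Qed.

Section polar.
Context {R : realType}.
Local Notation leb := (@lebesgue_measure R).
Local Notation RR := (measurableTypeR R).
Local Open Scope ereal_scope.

Lemma ge0_integral_scale n (t : R) (H : 'rV[R]_n -> \bar R) : (0 < t)%R ->
  measurable_fun setT H -> (forall x, 0 <= H x) ->
  (t ^+ n)%:E * \int[lebesgue_rV n]_x H (t *: x)%R = \int[lebesgue_rV n]_x H x.
Proof.
move=> t0; elim: n H => [|n IH] H mH H0.
  rewrite expr0 mul1e; apply: eq_integral => x _; congr H.
  by apply/rowP; case.
have mHt : measurable_fun setT (fun x : 'rV[R]_n.+1 => H (t *: x)%R).
  by apply: measurableT_comp => //; exact: measurable_scale.
rewrite !ge0_integral_lebesgue_rVS//.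
have consZ (a : R) (x : 'rV[R]_n) :
    (t *: cons_rV ((a : RR), x) = cons_rV (((t * a + 0)%R : RR), t *: x))%R.
  apply/rowP => i; rewrite !mxE addr0.
  by case: (unlift ord0 i) => [j|] //=; rewrite !mxE.
rewrite -(@ge0_integral_affine R t 0 (fun a =>
  \int[lebesgue_rV n]_x H (cons_rV (a, x))))//; last 2 first.
- exact: measurable_integral_cons.
- by move=> a; exact: integral_ge0.
have tn0 : 0 <= (t ^+ n)%:E by rewrite lee_fin exprn_ge0// ltW.
rewrite exprS EFinM -muleA -ge0_integralZl//; last 2 first.
- exact: (measurable_integral_cons mHt).
- by move=> a _; exact: integral_ge0.
congr (_ * _); apply: eq_integral => a _.
under eq_integral do rewrite consZ.
rewrite (IH (fun x => H (cons_rV (((t * a + 0)%R : RR), x))))//.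
by apply: measurableT_comp => //; exact: measurable_cons_rVr.
Qed.

Lemma lebesgue_rV_set0 n : lebesgue_rV n.+1 [set (0 : 'rV[R]_n.+1)%R] = 0.
Proof.
have -> : [set (0 : 'rV[R]_n.+1)%R] =
    [set x | forall i, [set (0 : RR)%R] (x ord0 i)].
  apply/seteqP; split=> x /=; first by move=> -> i; rewrite mxE.
  by move=> x0; apply/rowP => i; rewrite mxE x0.
rewrite (@lebesgue_rV_box R n.+1 (fun=> [set 0%R]))//.
by rewrite big_ord_recl lebesgue_measure_set1 mul0e.
Qed.

Lemma enorm_gt0 n (x : 'rV[R]_n) : (0 < enorm x)%R = (x != 0%R).
Proof.
apply/idP/idP => [|x0].
  by apply: contraTneq => ->; rewrite enorm0 ltxx.
by rewrite lt_def enorm_ge0 andbT; apply: contra_neq x0; exact: enorm_eq0.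
Qed.

Lemma ae_enorm_gt0 n :
  {ae lebesgue_rV (R := R) n.+1, forall x, (0 < enorm x)%R}.
Proof.
exists [set 0%R]; split; [|exact: lebesgue_rV_set0|].
  rewrite (_ : [set 0%R] = (fun x => enorm x) @^-1` [set 0%R]).
    rewrite -[X in measurable X]setTI; exact: measurable_enorm.
  apply/seteqP; split=> x /=; first by move=> ->; exact: enorm0.
  exact: enorm_eq0.
by move=> x /= /negP; rewrite enorm_gt0 negbK => /eqP.
Qed.

Definition direction n (x : 'rV[R]_n) : 'rV[R]_n := (enorm x)^-1 *: x.

Lemma enorm_direction n (x : 'rV[R]_n) : (0 < enorm x)%R ->
  enorm (direction x) = 1%R.
Proof.
move=> x0; rewrite /direction enormZ ger0_norm ?invr_ge0 ?enorm_ge0//.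
by rewrite mulVf// gt_eqF.
Qed.

Lemma enorm_direction_le1 n (x : 'rV[R]_n) : (enorm (direction x) <= 1)%R.
Proof.
have := enorm_ge0 x; rewrite le_eqVlt => /predU1P[x0|x0]; last by rewrite enorm_direction.
by rewrite /direction -x0 invr0 scale0r enorm0.
Qed.

Lemma direction_scale n (t : R) (x : 'rV[R]_n) : (0 < t)%R ->
  direction (t *: x) = direction x.
Proof.
move=> t0; rewrite /direction enormZ ger0_norm ?(ltW t0)// invfM scalerA.
by rewrite mulrAC mulVf ?gt_eqF// mul1r.
Qed.

Lemma measurable_scale2 n d (T : measurableType d) (a : T -> R)
    (v : T -> 'rV[R]_n) :
  measurable_fun setT a -> measurable_fun setT v ->
  measurable_fun setT (fun z => a z *: v z)%R.
Proof.
move=> ma mv; apply: measurable_fun_rV => i.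
rewrite (_ : _ \o _ = (fun z => a z * v z ord0 i)%R); last first.
  by apply/funext => z; rewrite /coord_rV /= mxE.
by apply: measurable_funM => //; apply: (measurableT_comp (measurable_entry i)).
Qed.

Lemma measurable_direction n : measurable_fun setT (@direction n).
Proof.
apply: measurable_scale2 => //; apply: measurable_funV; exact: measurable_enorm.
Qed.

(** The Jacobian of polar coordinates in dimension [n.+1], extended by zero so
    that radial integrals run over the whole line. *)
Definition radial_weight n (rho : R) : R := if (0 < rho)%R then (rho ^+ n)%R else 0%R.

(** In place of the surface measure of the sphere, directions are averaged
    against this density on the shell [1/2 <= |x| <= 1]; the exponent makes the
    polar formula exact. *)
Definition shell_weight n (x : 'rV[R]_n.+1) : R :=
  if (2^-1 <= enorm x <= 1)%R then (enorm x ^- n.+2)%R else 0%R.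

Lemma radial_weight_ge0 n rho : (0 <= radial_weight n rho)%R.
Proof. by rewrite /radial_weight; case: ifP => // r0; rewrite exprn_ge0// ltW. Qed.

Lemma measurable_radial_weight n : measurable_fun [set: RR] (radial_weight n).
Proof.
by apply: measurable_fun_ifT; [exact: measurable_fun_ltr|exact: measurable_funX|].
Qed.

Lemma shell_weight_ge0 n (x : 'rV[R]_n.+1) : (0 <= shell_weight x)%R.
Proof.
by rewrite /shell_weight; case: ifP => // _; rewrite invr_ge0 exprn_ge0// enorm_ge0.
Qed.

Lemma measurable_shell_weight n : measurable_fun setT (@shell_weight n).
Proof.
apply: measurable_fun_ifT => //.
  apply: measurable_and; apply: measurable_fun_ler => //; exact: measurable_enorm.
by apply: measurable_funV; apply: measurable_funX; exact: measurable_enorm.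
Qed.

(** Insert [1], the average over [tau] in [|y|, 2 |y|], then substitute
    [y = tau x] at fixed [tau] and [tau = rho / |x|] at fixed [x]: only scalings
    of Lebesgue measure are involved. *)
Lemma ge0_integral_polar n (H : 'rV[R]_n.+1 -> \bar R) :
  measurable_fun setT H -> (forall x, 0 <= H x) ->
  \int[lebesgue_rV n.+1]_x H x =
  \int[lebesgue_rV n.+1]_x \int[leb]_rho
    (H (rho *: direction x)%R * (radial_weight n rho * shell_weight x)%:E).
Proof.
move=> mH H0; pose la := lebesgue_rV (R := R) n.+1.
pose psi (tau e : R) : R := (if (0 < e) && (e <= tau <= 2 * e) then e^-1 else 0)%R.
have psi0 tau e : (0 <= psi tau e)%R.
  by rewrite /psi; case: ifP => // /andP[e0 _]; rewrite invr_ge0 ltW.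
have mpsi d (T : measurableType d) (a b : T -> R) : measurable_fun setT a ->
    measurable_fun setT b -> measurable_fun setT (fun z => psi (a z) (b z)).
  move=> ma mb; apply: measurable_fun_ifT => //; last exact: measurable_funV.
  apply: measurable_and; first exact: measurable_fun_ltr.
  apply: measurable_and; apply: measurable_fun_ler => //.
  exact: measurable_funM.
have psi1 e : (0 < e)%R -> \int[leb]_tau (psi tau e)%:E = 1.
  move=> e0.
  transitivity (\int[leb]_tau ((e^-1)%:E * (\1_(`[e, 2 * e]%classic : set RR) tau)%:E)).
    apply: eq_integral => tau _; rewrite indicE /psi e0 /= mem_setE in_itv /=.
    by case: ifP => _; rewrite ?mule1 ?mule0.
  rewrite ge0_integralZl//; last 2 first.
  - by apply/measurable_EFinP; exact: measurable_indic.
  - by rewrite lee_fin invr_ge0 ltW.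
  rewrite (@integral_indic _ _ _ leb setT measurableT)//.
  rewrite [X in _ * X](_ : _ = e%:E); last first.
    rewrite setIT; apply: etrans (lebesgue_measure_itv _) _; rewrite /= lte_fin.
    have ee : (e < 2 * e)%R by lra.
    by rewrite ee -EFinB; congr _%:E; ring.
  by rewrite -EFinM mulVf// gt_eqF.
(* For [y] nonzero, [psi tau |y|] integrates to 1 over [tau]. *)
transitivity (\int[la]_y \int[leb]_tau (H y * (psi tau (enorm y))%:E)).
  apply: ge0_ae_eq_integral => //.
  - apply: (measurable_fun_fubini_tonelli_F (m2 := leb)
      (fun p : 'rV[R]_n.+1 * RR => H p.1 * (psi p.2 (enorm p.1))%:E)).
    + apply: emeasurable_funM; first exact: (measurableT_comp mH measurable_fst).
      apply/measurable_EFinP; apply: mpsi; first exact: measurable_snd.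
      exact: (measurableT_comp measurable_enorm measurable_fst).
    + by move=> p; rewrite mule_ge0// lee_fin.
  - by move=> y _; apply: integral_ge0 => tau _; rewrite mule_ge0// lee_fin.
  apply: filterS (@ae_enorm_gt0 n) => y ey _.
  rewrite ge0_integralZl ?psi1 ?mule1//.
  - by apply/measurable_EFinP; apply: mpsi.
  - by move=> tau _; rewrite lee_fin.
rewrite (fubini_tonelli (m1 := la) (m2 := leb)
  (fun p : 'rV[R]_n.+1 * RR => H p.1 * (psi p.2 (enorm p.1))%:E)); last 2 first.
- apply: emeasurable_funM; first exact: (measurableT_comp mH measurable_fst).
  apply/measurable_EFinP; apply: mpsi; first exact: measurable_snd.
  exact: (measurableT_comp measurable_enorm measurable_fst).
- by move=> p; rewrite mule_ge0// lee_fin.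
pose sh (x : 'rV[R]_n.+1) : R :=
  (if 2^-1 <= enorm x <= 1 then (enorm x)^-1 else 0)%R.
have sh0 x : (0 <= sh x)%R.
  by rewrite /sh; case: ifP => // _; rewrite invr_ge0 enorm_ge0.
have msh : measurable_fun setT sh.
  apply: measurable_fun_ifT => //.
    apply: measurable_and; apply: measurable_fun_ler => //; exact: measurable_enorm.
  by apply: measurable_funV; exact: measurable_enorm.
(* At fixed [tau], substitute [y = tau x]. *)
transitivity (\int[leb]_tau \int[la]_x
    (H (tau *: x)%R * (radial_weight n tau * sh x)%:E)).
  apply: eq_integral => tau _; rewrite /radial_weight; case: ifPn => [t0|].
    rewrite -(@ge0_integral_scale n.+1 tau)//; last 2 first.
    - apply: emeasurable_funM => //; apply/measurable_EFinP.
      by apply: mpsi => //; exact: measurable_enorm.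
    - by move=> y; rewrite mule_ge0// lee_fin.
    rewrite -ge0_integralZl//; last 3 first.
    - apply: emeasurable_funM.
        by apply: (measurableT_comp mH); exact: measurable_scale.
      apply/measurable_EFinP; apply: mpsi => //.
      by apply: (measurableT_comp measurable_enorm); exact: measurable_scale.
    - by move=> y _; rewrite mule_ge0// lee_fin.
    - by rewrite lee_fin exprn_ge0// ltW.
    apply: eq_integral => x _; rewrite muleCA -EFinM; congr (_ * _%:E).
    rewrite /psi /sh enormZ ger0_norm ?(ltW t0)//.
    have -> : ((0 < tau * enorm x) && (tau * enorm x <= tau <= 2 * (tau * enorm x)) =
        (2^-1 <= enorm x <= 1))%R.
      rewrite -[X in (_ <= X <= _)%R]mulr1 mulrCA !ler_pM2l//.
      rewrite -[(2^-1)%R]mulr1 ler_pdivrMl// andbA pmulr_rgt0//.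
      apply/idP/idP => [/andP[/andP[_ ->] ->]//|/andP[h1 h2]].
      by rewrite h1 h2 andbT; lra.
    case: ifPn => [/andP[e2 _]|_]; last by rewrite !mulr0.
    have e0 : (0 < enorm x)%R by lra.
    by rewrite exprS; field; rewrite !gt_eqF.
  rewrite -leNgt => t0.
  rewrite !integral0_eq//; first by move=> x _; rewrite mul0r mule0.
  move=> y _; rewrite /psi; case: ifP; rewrite ?mule0// => /and3P[e0 et _].
  by exfalso; move: e0; rewrite ltNge (le_trans et t0).
rewrite -(fubini_tonelli (m1 := la) (m2 := leb) (fun p : 'rV[R]_n.+1 * RR =>
  H (p.2 *: p.1)%R * (radial_weight n p.2 * sh p.1)%:E)); last 2 first.
- apply: emeasurable_funM.
    by apply: (measurableT_comp mH); apply: measurable_scale2.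
  apply/measurable_EFinP; apply: measurable_funM.
    exact: (measurableT_comp (@measurable_radial_weight n) measurable_snd).
  exact: (measurableT_comp msh measurable_fst).
- by move=> p; rewrite mule_ge0// lee_fin mulr_ge0// radial_weight_ge0.
(* At fixed [x], substitute [tau = rho / |x|]. *)
apply: eq_integral => x _.
have mr (y : 'rV[R]_n.+1) : measurable_fun setT
    (fun rho : RR => H (rho *: y)%R * (radial_weight n rho)%:E).
  apply: emeasurable_funM.
    by apply: (measurableT_comp mH); apply: measurable_scale2.
  by apply/measurable_EFinP; exact: measurable_radial_weight.
have mr0 (y : 'rV[R]_n.+1) (rho : RR) :
    0 <= H (rho *: y)%R * (radial_weight n rho)%:E.
  by rewrite mule_ge0// lee_fin radial_weight_ge0.
have pull (y : 'rV[R]_n.+1) (k : R) : (0 <= k)%R ->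
    \int[leb]_rho (H (rho *: y)%R * (radial_weight n rho * k)%:E) =
    k%:E * \int[leb]_rho (H (rho *: y)%R * (radial_weight n rho)%:E).
  move=> k0; rewrite -ge0_integralZl//.
  by apply: eq_integral => rho _; rewrite EFinM muleCA [in RHS]muleC -muleA muleCA.
rewrite /= !pull ?shell_weight_ge0// /sh /shell_weight.
case: ifPn => [/andP[e2 _]|_]; last by rewrite !mul0e.
have e0 : (0 < enorm x)%R by lra.
rewrite -(@ge0_integral_affine R (enorm x)^-1 0 (fun rho =>
  H (rho *: x)%R * (radial_weight n rho)%:E))//; last by rewrite invr_gt0.
rewrite muleA -EFinM.
transitivity ((enorm x ^- 2)%:E * ((enorm x ^- n)%:E * \int[leb]_rho
    (H (rho *: direction x)%R * (radial_weight n rho)%:E))); last first.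
  by rewrite muleA -EFinM -invfM -exprD.
rewrite expr2 invfM; congr (_ * _).
rewrite -ge0_integralZl//; last by rewrite lee_fin invr_ge0 exprn_ge0// ltW.
apply: eq_integral => rho _; rewrite addr0 /direction scalerA mulrC muleCA.
congr (_ * _); rewrite -EFinM; congr _%:E; rewrite /radial_weight.
rewrite pmulr_lgt0 ?invr_gt0//; case: ifP => _; last by rewrite mulr0.
by rewrite exprMn exprVn mulrC.
Qed.

End polar.

(** * Independence of norm and direction, and Gaussian moments *)

Section radial_product.
Context {R : realType} {n : nat}.
Local Notation leb := (@lebesgue_measure R).
Local Notation RR := (measurableTypeR R).
Local Notation la := (lebesgue_rV (R := R) n.+1).
Local Notation w := (@radial_weight R n).
Local Notation eta := (@shell_weight R n).
Local Open Scope ereal_scope.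

Lemma enorm_ray (x : 'rV[R]_n.+1) (rho : R) : (0 < enorm x)%R -> (0 < rho)%R ->
  enorm (rho *: direction x) = rho.
Proof.
by move=> x0 r0; rewrite enormZ enorm_direction// mulr1 ger0_norm// ltW.
Qed.

Lemma shell_weight_gt0 (x : 'rV[R]_n.+1) : eta x != 0%R -> (0 < enorm x)%R.
Proof.
by rewrite /shell_weight; case: ifPn => [/andP[h _] _|]; [lra|rewrite eqxx].
Qed.

Lemma radial_weight_gt0 (rho : R) : w rho != 0%R -> (0 < rho)%R.
Proof. by rewrite /radial_weight; case: ifP => //; rewrite eqxx. Qed.

(** Under a measure of radial density, norm and direction are independent. *)
Lemma ge0_integral_direction_radial (G : 'rV[R]_n.+1 -> \bar R) (q : R -> R) :
  measurable_fun setT G -> (forall x, 0 <= G x) ->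
  measurable_fun setT q -> (forall t, (0 <= q t)%R) ->
  \int[la]_x (G (direction x) * (q (enorm x))%:E) =
  \int[leb]_rho (w rho * q rho)%:E *
  \int[la]_x (G (direction x) * (eta x)%:E).
Proof.
move=> mG G0 mq q0.
have mGd : measurable_fun setT (G \o @direction R n.+1).
  exact: (measurableT_comp mG (@measurable_direction R n.+1)).
rewrite ge0_integral_polar; last 2 first.
- apply: emeasurable_funM => //; apply/measurable_EFinP.
  exact: (measurableT_comp mq measurable_enorm).
- by move=> x; rewrite mule_ge0// lee_fin.
have mwq : measurable_fun setT (fun rho : RR => (w rho * q rho)%:E).
  by apply/measurable_EFinP/measurable_funM => //; exact: measurable_radial_weight.
have wq0 rho : 0 <= (w rho * q rho)%:E.
  by rewrite lee_fin mulr_ge0// radial_weight_ge0.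
rewrite muleC -ge0_integralZr//; last 3 first.
- apply: emeasurable_funM => //; apply/measurable_EFinP.
  exact: measurable_shell_weight.
- by move=> x _; rewrite mule_ge0// lee_fin shell_weight_ge0.
- exact: integral_ge0.
apply: eq_integral => x _; rewrite -ge0_integralZl//; last first.
  by rewrite mule_ge0// lee_fin shell_weight_ge0.
apply: eq_integral => rho _.
have [->|/shell_weight_gt0 x0] := eqVneq (eta x) 0%R.
  by rewrite !mulr0 !mule0 mul0e.
have [->|/radial_weight_gt0 r0] := eqVneq (w rho) 0%R.
  by rewrite !mul0r !mule0.
rewrite enorm_ray// direction_scale// [direction (direction x)]direction_scale ?invr_gt0//.
by rewrite -!muleA -!EFinM; congr (_ * _%:E); ring.
Qed.

(** If [rho] has density proportional to [w k] and [x] is an independent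
    vector with radial density [q], then [rho x / |x|] has density proportional
    to [k (|y|)]. *)
Lemma ge0_integral_ray (H : 'rV[R]_n.+1 -> \bar R) (k q : R -> R) :
  measurable_fun setT H -> (forall x, 0 <= H x) ->
  measurable_fun setT k -> (forall t, (0 <= k t)%R) ->
  measurable_fun setT q -> (forall t, (0 <= q t)%R) ->
  \int[leb]_rho \int[la]_x
    (H (rho *: direction x)%R * (w rho * k rho * q (enorm x))%:E) =
  \int[leb]_rho (w rho * q rho)%:E * \int[la]_y (H y * (k (enorm y))%:E).
Proof.
move=> mH H0 mk k0 mq q0.
have mHr : measurable_fun setT (fun p : RR * 'rV[R]_n.+1 => H (p.1 *: direction p.2)%R).
  apply: (measurableT_comp mH); apply: measurable_scale2 => //.
  exact: (measurableT_comp (@measurable_direction R n.+1) measurable_snd).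
have mHk : measurable_fun setT (fun y => H y * (k (enorm y))%:E).
  apply: emeasurable_funM => //; apply/measurable_EFinP.
  exact: (measurableT_comp mk measurable_enorm).
have mwk : measurable_fun setT (fun p : RR * 'rV[R]_n.+1 => (w p.1 * k p.1)%R).
  apply: measurable_funM.
    exact: (measurableT_comp (@measurable_radial_weight R n) measurable_fst).
  exact: (measurableT_comp mk measurable_fst).
have wk0 rho : (0 <= w rho * k rho)%R by rewrite mulr_ge0// radial_weight_ge0.
have meta : measurable_fun setT (fun p : RR * 'rV[R]_n.+1 => eta p.2).
  exact: (measurableT_comp (@measurable_shell_weight R n) measurable_snd).
pose h (p : RR * 'rV[R]_n.+1) :=
  H (p.1 *: direction p.2)%R * (w p.1 * k p.1 * eta p.2)%:E.
have mh : measurable_fun setT h.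
  by apply: emeasurable_funM => //; apply/measurable_EFinP/measurable_funM.
have h0 p : 0 <= h p by rewrite mule_ge0// lee_fin mulr_ge0// shell_weight_ge0.
set J := \int[leb]_rho (w rho * q rho)%:E.
have J0 : 0 <= J.
  by apply: integral_ge0 => rho _; rewrite lee_fin mulr_ge0// radial_weight_ge0.
transitivity (\int[leb]_rho (J * \int[la]_x h (rho, x))).
  apply: eq_integral => rho _.
  have mHrho : measurable_fun setT (fun y : 'rV[R]_n.+1 => H (rho *: y)%R).
    by apply: (measurableT_comp mH); exact: measurable_scale.
  transitivity ((w rho * k rho)%:E *
      \int[la]_x (H (rho *: direction x)%R * (q (enorm x))%:E)).
    rewrite -ge0_integralZl//.
    - by apply: eq_integral => x _; rewrite EFinM muleCA.
    - apply: emeasurable_funM.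
        exact: (measurableT_comp mHrho (@measurable_direction R n.+1)).
      by apply/measurable_EFinP; exact: (measurableT_comp mq measurable_enorm).
    - by move=> x _; rewrite mule_ge0// lee_fin.
    - by rewrite lee_fin.
  rewrite (@ge0_integral_direction_radial (fun y => H (rho *: y)%R) q)//.
  rewrite -/J muleCA; congr (_ * _); rewrite -ge0_integralZl//.
  - by apply: eq_integral => x _; rewrite /h /= EFinM muleCA.
  - apply: emeasurable_funM.
      exact: (measurableT_comp mHrho (@measurable_direction R n.+1)).
    by apply/measurable_EFinP; exact: measurable_shell_weight.
  - by move=> x _; rewrite mule_ge0// lee_fin shell_weight_ge0.
  - by rewrite lee_fin.
rewrite ge0_integralZl//; last 2 first.
- exact: (measurable_fun_fubini_tonelli_F (m2 := la) h).
- by move=> rho _; exact: integral_ge0.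
congr (_ * _); rewrite (fubini_tonelli (m1 := leb) (m2 := la) h)//.
rewrite [RHS]ge0_integral_polar//; last by move=> y; rewrite mule_ge0// lee_fin.
apply: eq_integral => x _; apply: eq_integral => rho _; rewrite /h /=.
have [->|/shell_weight_gt0 x0] := eqVneq (eta x) 0%R.
  by rewrite !mulr0 !mule0.
have [->|/radial_weight_gt0 r0] := eqVneq (w rho) 0%R.
  by rewrite !mul0r !mule0.
rewrite enorm_ray// -muleA -EFinM; congr (_ * _%:E); ring.
Qed.

End radial_product.

Section gaussian_moment.
Context {R : realType} (c : R).
Hypothesis c0 : 0 < c.
Local Notation leb := (@lebesgue_measure R).
Local Notation RR := (measurableTypeR R).

Definition gaussian_weight (t : R) : R := expR (- (c * t ^+ 2 / 2)).

Lemma measurable_gaussian_weight : measurable_fun setT gaussian_weight.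
Proof.
apply: measurable_expR_comp; apply: measurable_funN; apply: measurable_funM => //.
by apply: measurable_funM => //; exact: measurable_funX.
Qed.

Definition gaussian_moment k : \bar R :=
  (\int[leb]_r (radial_weight k r * gaussian_weight r)%:E)%E.

Let j k (r : R) := radial_weight k r * gaussian_weight r.

Let j0 k r : 0 <= j k r.
Proof. by rewrite mulr_ge0 ?radial_weight_ge0// expR_ge0. Qed.

Let mj k : measurable_fun [set: RR] (j k).
Proof.
apply: measurable_funM; first exact: measurable_radial_weight.
exact: measurable_gaussian_weight.
Qed.

Lemma gaussian_moment_lty k : (gaussian_moment k < +oo)%E.
Proof.
have kf0 : 0 < k`!%:R :> R by rewrite ltr0n fact_gt0.
pose C : R := k`!%:R * expR (2 / c).
apply: (@le_lt_trans _ _ (C%:E * \int[leb]_r (exponential_pdf 1 r)%:E)%E); last first.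
  by rewrite integral_exponential_pdf// mule1 ltry.
have C0 : 0 <= C by rewrite mulr_ge0 ?expR_ge0 ?ltW.
have me : measurable_fun [set: RR] (fun r : RR => (exponential_pdf 1 r)%:E : \bar R).
  by apply/measurable_EFinP; exact: measurable_exponential_pdf.
have e0 (r : R) : 0 <= exponential_pdf 1 r by exact: exponential_pdf_ge0.
rewrite -ge0_integralZl//; last by move=> r _; rewrite lee_fin.
apply: ge0_le_integral => //.
- by move=> r _; rewrite lee_fin; exact: j0.
- by apply/measurable_EFinP; exact: mj.
- exact: measurable_funeM.
move=> r _; rewrite -EFinM lee_fin /radial_weight; case: ifPn => [r0|_]; last first.
  by rewrite mul0r mulr_ge0.
rewrite exponential_pdfE ?(ltW r0)//= mul1r mulN1r.
(* [r^k <= k! exp r], and completing the square bounds [exp (2 r)] times the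
   Gaussian weight by [exp (2 / c)]. *)
have h1 : r ^+ k <= k`!%:R * expR r.
  rewrite -ler_pdivrMl// mulrC; case: k {C C0} kf0 => [|k] kf0.
    by rewrite expr0 fact0 invr1 mulr1 -expR0 ler_expR ltW.
  by apply: le_trans (expR_ge1Dxn k (ltW r0)); rewrite lerDr.
apply: (@le_trans _ _ (k`!%:R * expR r * gaussian_weight r)).
  by apply: ler_wpM2r => //; exact: expR_ge0.
rewrite /C -!mulrA; apply: ler_wpM2l; first exact: ltW.
rewrite -!expRD ler_expR -subr_ge0.
have -> : 2 / c - r - (r + - (c * r ^+ 2 / 2)) = c / 2 * (r - 2 / c) ^+ 2.
  by field; rewrite gt_eqF.
by rewrite mulr_ge0 ?sqr_ge0// divr_ge0// ltW.
Qed.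

Lemma gaussian_moment_gt0 k : (0 < gaussian_moment k)%E.
Proof.
pose D := `[1, 2]%classic : set RR.
have lD : leb D = 1%E.
  apply: etrans (lebesgue_measure_itv _) _; rewrite /= lte_fin.
  have h : (1 : R) < 2 by lra.
  by rewrite h -EFinB; congr _%:E; ring.
apply: (@lt_le_trans _ _ ((expR (- (c * 2)))%:E * \int[leb]_r (\1_D r)%:E)%E).
  rewrite (@integral_indic _ _ _ leb setT measurableT)//; last exact: measurable_itv.
  by rewrite [X in (_ * X)%E](_ : _ = 1%E) ?mule1 ?lte_fin ?expR_gt0// setIT.
have mDi : measurable_fun [set: RR] (fun r : RR => (\1_D r)%:E : \bar R).
  by apply/measurable_EFinP; apply: measurable_indic; exact: measurable_itv.
rewrite -(ge0_integralZl leb measurableT mDi) ?lee_fin ?expR_ge0//.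
apply: ge0_le_integral => //.
- exact: measurable_funeM.
- by apply/measurable_EFinP; exact: mj.
move=> r _; rewrite -EFinM lee_fin indicE.
case: (boolP (r \in D)) => [|_]; last by rewrite mulr0; exact: j0.
rewrite inE /D /= in_itv /= => /andP[r1 r2].
rewrite mulr1 /radial_weight (lt_le_trans ltr01 r1).
apply: (@le_trans _ _ (gaussian_weight r)).
  have r4 : r ^+ 2 <= 4 by nra.
  by rewrite ler_expR lerN2; have := ler_wpM2l (ltW c0) r4; lra.
by rewrite ler_peMl ?expR_ge0// exprn_ege1.
Qed.

(** Rescaling by 2 multiplies the integrand of the [k]-th moment by
    [exp ((k + 1) ln 2 - 3 c r^2 / 2) >= 1 + (k + 1) ln 2 - 3 c r^2 / 2] and
    leaves the moment unchanged. *)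
Lemma gaussian_moment_ratio k :
  (k.+1%:R%:E * gaussian_moment k <= (3 * c)%:E * gaussian_moment k.+2)%E.
Proof.
have mjE i : measurable_fun [set: RR] (fun r : RR => (j i r)%:E : \bar R).
  by apply/measurable_EFinP.
have jE0 i (r : R) : (0 <= (j i r)%:E)%E by rewrite lee_fin.
have scale : (gaussian_moment k = \int[leb]_r (2 * j k (2 * r))%:E)%E.
  rewrite /gaussian_moment -(@ge0_integral_affine R 2 0 (fun r => (j k r)%:E))//.
  rewrite -ge0_integralZl//.
  - by apply: eq_integral => r _; rewrite addr0 EFinM.
  - by apply: (measurableT_comp (mjE k)); exact: measurable_affine.
have ln2 : 2^-1 <= ln 2 :> R.
  have h2 : 0 < (2 : R)^-1 by rewrite invr_gt0.
  by have := ln_le_subr1 h2; rewrite lnV ?posrE//; lra.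
have J0 i : (0 <= gaussian_moment i)%E by exact/ltW/gaussian_moment_gt0.
have fin i : gaussian_moment i \is a fin_num.
  by rewrite ge0_fin_numE// gaussian_moment_lty.
have m2j : measurable_fun [set: RR] (fun r : RR => (2 * j k (2 * r))%:E : \bar R).
  apply/measurable_EFinP; apply: measurable_funM => //.
  apply: (measurableT_comp (mj k)); exact: measurable_funM.
have key : ((1 + k.+1%:R / 2)%:E * gaussian_moment k <=
    gaussian_moment k + (3 * c / 2)%:E * gaussian_moment k.+2)%E.
  have c32 : 0 <= 3 * c / 2 by rewrite divr_ge0// mulr_ge0// ltW.
  rewrite {2}scale /gaussian_moment.
  rewrite -(ge0_integralZl leb measurableT (mjE k.+2))//.
  rewrite -ge0_integralD//; last 3 first.
  - by move=> r _; rewrite lee_fin mulr_ge0.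
  - by move=> r _; rewrite -EFinM lee_fin mulr_ge0.
  - exact: (measurable_funeM _ (mjE k.+2)).
  have k0 : 0 <= 1 + k.+1%:R / 2 :> R by rewrite addr_ge0// divr_ge0.
  rewrite -(ge0_integralZl leb measurableT (mjE k))//.
  apply: ge0_le_integral => //.
  - by move=> r _; rewrite -EFinM lee_fin mulr_ge0.
  - exact: (measurable_funeM _ (mjE k)).
  - apply: emeasurable_funD => //; exact: (measurable_funeM _ (mjE k.+2)).
  move=> r _; rewrite -!EFinM -EFinD lee_fin /j /radial_weight.
  rewrite pmulr_rgt0//; case: ifPn => [r0|_]; last by rewrite !mul0r !mulr0 addr0.
  have -> : 2 * ((2 * r) ^+ k * gaussian_weight (2 * r)) =
      r ^+ k * gaussian_weight r *
        expR (k.+1%:R * ln 2 - 3 * c / 2 * r ^+ 2).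
    have -> : gaussian_weight (2 * r) =
        gaussian_weight r * expR (- (3 * c / 2 * r ^+ 2)).
      by rewrite -expRD; congr expR; field.
    by rewrite expRD expRM_natl lnK ?posrE// exprMn (exprS (2 : R) k); ring.
  have -> : r ^+ k.+2 = r ^+ k * r ^+ 2 by rewrite -exprD addn2.
  have h := expR_ge1Dx (k.+1%:R * ln 2 - 3 * c / 2 * r ^+ 2).
  have g0 : 0 <= r ^+ k * gaussian_weight r.
    by rewrite mulr_ge0 ?expR_ge0// exprn_ge0// ltW.
  have h2 : k.+1%:R / 2 <= k.+1%:R * ln 2 :> R by apply: ler_wpM2l.
  have H1 := ler_wpM2l g0 h; have H2 := ler_wpM2l g0 h2.
  rewrite [X in X <= _](_ : _ = r ^+ k * gaussian_weight r +
    r ^+ k * gaussian_weight r * (k.+1%:R / 2)); last by ring.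
  rewrite [X in _ <= _ + X](_ : _ = r ^+ k * gaussian_weight r *
    (3 * c / 2 * r ^+ 2)); last by ring.
  move: H1 H2; rewrite mulrDr mulr1 mulrBr; lra.
move: key; rewrite -(fineK (fin k)) -(fineK (fin k.+2)) -!EFinM -EFinD !lee_fin.
lra.
Qed.
End gaussian_moment.

(** * The planar case: bounded perturbation *)

Section radial_profile.
Context {R : realType}.

(** The density as a real function on the whole line, constant on the negative
    half-line so that it is monotone there too. *)
Definition radial_profile (V : R -> \bar R) (t : R) : R :=
  fine (expeR (- V (Num.max t 0)%R))%E.

Definition log_concave_on_nneg (k : R -> R) := forall a b t : R,
  0 <= a -> 0 <= b -> 0 < t < 1 ->
  k a `^ t * k b `^ (1 - t) <= k (t * a + (1 - t) * b).

Variable V : R -> \bar R.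
Hypothesis Voo : forall r, 0 <= r -> (-oo < V r)%E.
Hypothesis Vconvex : convex_on_nneg V.
Hypothesis Vmono : nondecreasing_on_nneg V.

Let maxr0 (t : R) : 0 <= Num.max t 0.
Proof. by rewrite le_max lexx orbT. Qed.

Lemma radial_profile_ge0 t : 0 <= radial_profile V t.
Proof. by apply: fine_ge0; exact: expeR_ge0. Qed.

Lemma EFin_radial_profile t : 0 <= t -> (radial_profile V t)%:E = expeR (- V t)%E.
Proof.
move=> t0; rewrite /radial_profile max_l// fineK//.
by have := Voo t0; case: (V t).
Qed.

Lemma radial_profile_nonincreasing : nonincreasing_fun (radial_profile V).
Proof.
move=> a b ab.
have h : Num.max a 0 <= Num.max b 0 by rewrite ge_max !le_max ab lexx /= orbT.
have E t : (radial_profile V t)%:E = (expeR (- V (Num.max t 0)%R))%E.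
  by rewrite -EFin_radial_profile ?maxr0// /radial_profile (max_l (maxr0 t)).
by rewrite -lee_fin !E lee_expeR leeN2; exact: Vmono.
Qed.

Lemma radial_profile_log_concave : log_concave_on_nneg (radial_profile V).
Proof.
move=> a b t a0 b0 /andP[t0 t1].
have s0 : 0 < 1 - t by rewrite subr_gt0.
have m0 : 0 <= t * a + (1 - t) * b by rewrite addr_ge0// mulr_ge0// ltW.
have t01 : 0 <= t <= 1 by rewrite !ltW.
have := Vconvex a0 b0 t01.
have := Voo a0; have := Voo b0; have := Voo m0.
have := radial_profile_ge0 (t * a + (1 - t) * b).
rewrite /radial_profile !max_l//.
case: (V a) => [va| |] //; case: (V b) => [vb| |] //= km; last 3 first.
- by rewrite powR0 ?mulr0// gt_eqF.
- by rewrite powR0 ?mul0r// gt_eqF.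
- by rewrite powR0 ?mul0r// gt_eqF.
case: (V _) km => [vm| |] //= _ _ _ _; rewrite lee_fin => h.
by rewrite -!expRM -expRD ler_expR; lra.
Qed.

End radial_profile.

(** The equality case of strong log-concavity. *)
Lemma gaussian_weight_combine {R : realType} n (c t : R) (x y : 'rV[R]_n) :
  gaussian_weight c (enorm x) `^ t * gaussian_weight c (enorm y) `^ (1 - t) *
    expR (c * (t * (1 - t)) / 2 * enorm (x - y) ^+ 2) =
  gaussian_weight c (enorm (t *: x + (1 - t) *: y)).
Proof.
rewrite -!expRM -!expRD /gaussian_weight enorm_sq_combine; congr expR.
by field.
Qed.

Section perturbation.
Context {R : realType} {n : nat} (mu : probability 'rV[R]_n R) (k : R -> R) (r : R).
Local Notation la := (lebesgue_rV (R := R) n).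
Hypotheses (k0 : forall t, 0 <= k t) (kni : nonincreasing_fun k)
  (klc : log_concave_on_nneg k) (r0 : 0 < r) (kr : forall t, 0 < k t -> t <= r).
Hypothesis muE : forall A, measurable A ->
  mu A = (\int[la]_(x in A) (k (enorm x))%:E)%E.

Let c : R := r ^- 2.
Let c0 : 0 < c. Proof. by rewrite invr_gt0 exprn_gt0. Qed.

Let p (x : 'rV[R]_n) : R := k (enorm x) * gaussian_weight c (enorm x).

Let p0 x : 0 <= p x.
Proof. by rewrite mulr_ge0// expR_ge0. Qed.

Let mke : measurable_fun [set: 'rV[R]_n] (fun x => k (enorm x)).
Proof.
apply: (measurableT_comp _ measurable_enorm).
exact: (nonincreasing_measurable _ kni).
Qed.

Let mp : measurable_fun setT p.
Proof.
apply: measurable_funM => //.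
exact: (measurableT_comp (measurable_gaussian_weight c) measurable_enorm).
Qed.

Let slcp : strongly_log_concave c p.
Proof.
move=> x y t t01; have /andP[t0 t1] := t01.
have s0 : 0 < 1 - t by rewrite subr_gt0.
rewrite /p (powRM _ (k0 (enorm x)) (expR_ge0 _)).
rewrite (powRM _ (k0 (enorm y)) (expR_ge0 _)).
rewrite [X in X * expR _]mulrACA -[leLHS]mulrA gaussian_weight_combine.
apply: ler_wpM2r; first exact: expR_ge0.
apply: le_trans (klc (enorm_ge0 x) (enorm_ge0 y) t01) _; apply: kni.
apply: le_trans (ler_enormD _ _) _.
by rewrite !enormZ (ger0_norm (ltW t0)) (ger0_norm (ltW s0)).
Qed.

Let m := density_measure la mp p0.

Let mE A : measurable A -> m A = (\int[la]_(x in A) (p x)%:E)%E.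
Proof. by []. Qed.

Let pk x : p x <= k (enorm x).
Proof.
rewrite ler_piMr// -[leRHS](@expR0 R) ler_expR oppr_le0.
by rewrite divr_ge0// mulr_ge0 ?sqr_ge0// ltW.
Qed.

Let kp x : k (enorm x) <= expR 2^-1 * p x.
Proof.
have [kx|kx] := ltP 0 (k (enorm x)); last first.
  by apply: le_trans kx _; rewrite mulr_ge0// expR_ge0.
rewrite /p mulrCA ler_peMr// /gaussian_weight -expRD -[leLHS](@expR0 R) ler_expR.
rewrite subr_ge0 ler_pdivrMr// mulVf// /c mulrC ler_pdivrMr ?exprn_gt0// mul1r.
by rewrite ler_pXn2r ?nnegrE ?enorm_ge0 ?(ltW r0)// kr.
Qed.

Let mu_int (H : 'rV[R]_n -> \bar R) : measurable_fun setT H ->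
  (forall x, 0 <= H x)%E ->
  (\int[mu]_x H x = \int[la]_x (H x * (k (enorm x))%:E))%E.
Proof. by move=> mH H0; rewrite (ge0_integral_density mke _ muE). Qed.

Let m_int (H : 'rV[R]_n -> \bar R) : measurable_fun setT H ->
  (forall x, 0 <= H x)%E ->
  (\int[m]_x H x = \int[la]_x (H x * (p x)%:E))%E.
Proof. by move=> mH H0; rewrite (ge0_integral_density mp _ mE). Qed.

Let mHk (H : 'rV[R]_n -> \bar R) (q : 'rV[R]_n -> R) : measurable_fun setT H ->
  measurable_fun setT q -> measurable_fun setT (fun x => H x * (q x)%:E)%E.
Proof. by move=> mH mq; apply: emeasurable_funM => //; exact/measurable_EFinP. Qed.

Let mu_le (H : 'rV[R]_n -> \bar R) : measurable_fun setT H ->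
  (forall x, 0 <= H x)%E ->
  (\int[mu]_x H x <= (expR 2^-1)%:E * \int[m]_x H x)%E.
Proof.
move=> mH H0; rewrite mu_int// m_int//.
have Hp0 x : (0 <= H x * (p x)%:E)%E by rewrite mule_ge0// lee_fin.
rewrite -(ge0_integralZl la measurableT (mHk mH mp)) ?lee_fin ?expR_ge0//.
apply: ge0_le_integral => //.
- by move=> x _; rewrite mule_ge0// lee_fin.
- exact: mHk.
- by apply: measurable_funeM; exact: mHk.
by move=> x _; rewrite muleCA -EFinM; apply: lee_wpmul2l; rewrite ?lee_fin.
Qed.

Let mu_ge (H : 'rV[R]_n -> \bar R) : measurable_fun setT H ->
  (forall x, 0 <= H x)%E -> (\int[m]_x H x <= \int[mu]_x H x)%E.
Proof.
move=> mH H0; rewrite mu_int// m_int//; apply: ge0_le_integral => //.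
- by move=> x _; rewrite mule_ge0// lee_fin.
- exact: mHk.
- exact: mHk.
by move=> x _; apply: lee_wpmul2l; rewrite ?lee_fin.
Qed.

Let mass (nu : {measure set 'rV[R]_n -> \bar R}) :
  (\int[nu]_x 1 = nu setT)%E.
Proof. by rewrite integral_cst// mul1e. Qed.

(** The Holley-Stroock perturbation argument: on the support [|x| <= r] the
    Gaussian factor that makes the density strongly log-concave varies by a
    factor [exp (1 / 2)] at most. *)
Lemma log_sobolev_perturbation : log_sobolev mu (2 * expR 2^-1 * r ^+ 2).
Proof.
move=> f sf.
have one0 (x : 'rV[R]_n) : (0 <= (1 : \bar R))%E by [].
have mc : measurable_fun [set: 'rV[R]_n] (fun=> 1%E : \bar R).
  exact: measurable_cst.
have m1 := mu_ge mc one0; have m2 := mu_le mc one0.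
have mu1 : (\int[mu]_x 1 = 1)%E.
  by apply: etrans (mass _) _; exact: probability_setT.
rewrite mu1 mass in m1 m2.
have moo : (m setT < +oo)%E by apply: le_lt_trans m1 _; rewrite ltry.
have m0 : (0 < m setT)%E.
  rewrite lt_def measure_ge0 andbT; apply: contraTneq m2 => ->.
  by rewrite mule0 -ltNge lte01.
have ikap : m.-integrable setT (EFin \o (fun x : 'rV[R]_n => (1 : R) ^+ 2)).
  apply: (@bounded_integrable _ _ _ _ _ 1 moo); first exact: measurable_cst.
  by move=> x; rewrite expr1n normr1.
have m1f : measurable_fun [set: 'rV[R]_n] (fun=> 1 : R) by exact: measurable_cst.
have mtt : measurable_fun [set: 'rV[R]_n] xpredT by exact: measurable_cst.
have := @log_sobolev_entropy_le R n n c p m c0 mp p0 slcp mE moo m0 id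
  (fun=> 1) xpredT r (@measurable_id _ _ _) m1f
  mtt (fun=> ler01) _ _ _ ikap mu (expR 2^-1) 1
  (expR_gt0 _) ltr01 mu_le _ f sf.
have -> : 2 * expR 2^-1 * 1 / c = 2 * expR 2^-1 * r ^+ 2.
  by rewrite mulr1 /c invrK.
apply.
- by rewrite (_ : [set x | ~~ xpredT x] = set0) ?measure0//; apply/seteqP; split=> x.
- move=> x px; apply: kr; move: px; rewrite pmulr_lgt0 ?expR_gt0//.
- by move=> x z _ _ _; rewrite mul1r.
- move=> H mH H0; rewrite mul1e; apply: le_trans (mu_ge mH H0).
  rewrite le_eqVlt; apply/orP; left; apply/eqP.
  by apply: eq_integral => x _; rewrite expr1n mule1.
Qed.

End perturbation.

(** * Strong concavity of the logarithm, and the ray map *)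

Section strong_concavity_ln.
Context {R : realType}.
Implicit Types a b r t : R.

(** Second-order upper bound for the logarithm at scale [r]; it comes from
    [ln u = 2 ln (sqrt u) <= 2 (sqrt u - 1) = (u - 1) - (sqrt u - 1)^2]. *)
Lemma ln_le_tangent a m r : 0 < a <= r -> 0 < m <= r ->
  ln a <= ln m + (a - m) / m - (a - m) ^+ 2 / (4 * r ^+ 2).
Proof.
move=> /andP[a0 ar] /andP[m0 mr]; have r0 : 0 < r by exact: lt_le_trans ar.
have root (u : R) : 0 < u -> exists2 x, 0 < x & u = x ^+ 2.
  by move=> u0; exists (Num.sqrt u); rewrite ?sqrtr_gt0// sqr_sqrtr// ltW.
have [x x0 ax] := root a a0; have [y y0 my] := root m m0; clear root.
have h := ln_le_subr1 (divr_gt0 x0 y0); rewrite ln_div ?posrE// in h.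
rewrite {1}ax {1}my (lnXn 2 x0) (lnXn 2 y0) -[ln x *+ 2]mulr_natl.
rewrite -[ln y *+ 2]mulr_natl -addrA -lerBlDl -mulrBr.
apply: le_trans (ler_wpM2l (ler0n R 2) h) _.
have -> : 2 * (x / y - 1) = (a - m) / m - (x - y) ^+ 2 / m.
  by rewrite ax my; field; rewrite gt_eqF.
rewrite lerD2l lerN2 ler_pdivrMr ?mulr_gt0 ?exprn_gt0//.
have -> : (x - y) ^+ 2 / m * (4 * r ^+ 2) =
    (x - y) ^+ 2 * (4 * r ^+ 2 / m) by field; rewrite gt_eqF.
have -> : (a - m) ^+ 2 = (x - y) ^+ 2 * (x + y) ^+ 2 by rewrite ax my; ring.
apply: ler_wpM2l; first exact: sqr_ge0.
have xy4 : (x + y) ^+ 2 <= 4 * r.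
  have := sqr_ge0 (x - y); rewrite ax in ar; rewrite my in mr; lra.
rewrite ler_pdivlMr//; apply: (@le_trans _ _ ((4 * r) * r)); last first.
  by rewrite le_eqVlt; apply/orP; left; apply/eqP; ring.
by apply: ler_pM => //; rewrite ?sqr_ge0 ?(ltW m0).
Qed.

Lemma ln_strongly_concave a b t r : 0 < a <= r -> 0 < b <= r -> 0 < t < 1 ->
  t * ln a + (1 - t) * ln b + t * (1 - t) / (4 * r ^+ 2) * (a - b) ^+ 2 <=
  ln (t * a + (1 - t) * b).
Proof.
move=> ha hb /andP[t0 t1]; have s0 : 0 < 1 - t by rewrite subr_gt0.
have /andP[a0 ar] := ha; have /andP[b0 br] := hb.
have hm : 0 < t * a + (1 - t) * b <= r.
  rewrite addr_gt0 ?mulr_gt0//=.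
  have := ler_wpM2l (ltW t0) ar; have := ler_wpM2l (ltW s0) br; lra.
have := ler_wpM2l (ltW t0) (ln_le_tangent ha hm).
have := ler_wpM2l (ltW s0) (ln_le_tangent hb hm).
have /andP[m0 _] := hm; set m := t * a + _ in hm m0 *.
have r0 : 0 < r by exact: lt_le_trans ar.
have e1 : t * ((a - m) / m) + (1 - t) * ((b - m) / m) = 0.
  by rewrite !mulrA -mulrDl /m; apply/eqP; rewrite mulf_eq0; apply/orP; left; apply/eqP; ring.
have e2 : t * ((a - m) ^+ 2 / (4 * r ^+ 2)) + (1 - t) * ((b - m) ^+ 2 / (4 * r ^+ 2)) =
    t * (1 - t) / (4 * r ^+ 2) * (a - b) ^+ 2.
  by rewrite /m; field; rewrite gt_eqF.
lra.
Qed.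

(** The second derivative of [d ln rho] is at most [- d / r^2] on [(0, r]]; this is
    where the dimension enters the log-Sobolev constant. *)
Lemma radial_weight_strongly_log_concave d a b t r :
  0 < a <= r -> 0 < b <= r -> 0 < t < 1 ->
  radial_weight d a `^ t * radial_weight d b `^ (1 - t) *
    expR (d%:R / (2 * r ^+ 2) * (t * (1 - t)) / 2 * (a - b) ^+ 2) <=
  radial_weight d (t * a + (1 - t) * b).
Proof.
move=> ha hb t01; have /andP[t0 t1] := t01.
have s0 : 0 < 1 - t by rewrite subr_gt0.
have /andP[a0 ar] := ha; have /andP[b0 br] := hb.
have r0 : 0 < r by exact: lt_le_trans ar.
have m0 : 0 < t * a + (1 - t) * b by rewrite addr_gt0 ?mulr_gt0.
rewrite /radial_weight a0 b0 m0 /powR !gt_eqF ?exprn_gt0//.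
rewrite -[leRHS]lnK ?posrE ?exprn_gt0// -!expRD ler_expR (lnXn d a0) (lnXn d b0) (lnXn d m0).
rewrite -[ln a *+ d]mulr_natl -[ln b *+ d]mulr_natl -[leRHS]mulr_natl.
have := ler_wpM2l (ler0n R d) (ln_strongly_concave ha hb t01).
apply: le_trans; rewrite le_eqVlt; apply/orP; left; apply/eqP.
by field; rewrite gt_eqF.
Qed.

End strong_concavity_ln.

Section ray_coordinates.
Context {R : realType} {n : nat}.
Local Notation RR := (measurableTypeR R).

Definition head_rV (z : 'rV[R]_n.+1) : R := z ord0 ord0.
Definition tail_rV (z : 'rV[R]_n.+1) : 'rV[R]_n := (uncons_rV z).2.

Lemma head_cons (a : R) (x : 'rV[R]_n) : head_rV (cons_rV ((a : RR), x)) = a.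
Proof. exact: cons_rV0. Qed.

Lemma tail_cons (a : R) (x : 'rV[R]_n) : tail_rV (cons_rV ((a : RR), x)) = x.
Proof. by rewrite /tail_rV cons_rVK. Qed.

Lemma head_combine (t s : R) (z z' : 'rV[R]_n.+1) :
  head_rV (t *: z + s *: z') = t * head_rV z + s * head_rV z'.
Proof. by rewrite /head_rV !mxE. Qed.

Lemma tail_combine (t s : R) (z z' : 'rV[R]_n.+1) :
  tail_rV (t *: z + s *: z') = t *: tail_rV z + s *: tail_rV z'.
Proof. by apply/rowP => i; rewrite !mxE. Qed.

Lemma headB (z z' : 'rV[R]_n.+1) : head_rV (z - z') = head_rV z - head_rV z'.
Proof. by rewrite /head_rV !mxE. Qed.

Lemma tailB (z z' : 'rV[R]_n.+1) : tail_rV (z - z') = tail_rV z - tail_rV z'.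
Proof. by apply/rowP => i; rewrite !mxE. Qed.

Lemma enorm_head_tail (z : 'rV[R]_n.+1) :
  enorm z ^+ 2 = head_rV z ^+ 2 + enorm (tail_rV z) ^+ 2.
Proof.
rewrite !enorm_sq big_ord_recl; congr (_ + _).
by apply: eq_bigr => i _; rewrite mxE.
Qed.

Lemma head_le_enorm (z : 'rV[R]_n.+1) : `|head_rV z| <= enorm z.
Proof. exact: coord_le_enorm. Qed.

Lemma tail_le_enorm (z : 'rV[R]_n.+1) : enorm (tail_rV z) <= enorm z.
Proof.
by rewrite -(@ler_pXn2r _ 2)// ?nnegrE ?enorm_ge0// enorm_head_tail lerDr sqr_ge0.
Qed.

Lemma measurable_head : measurable_fun setT head_rV.
Proof. exact: measurable_entry. Qed.

Lemma measurable_tail : measurable_fun setT tail_rV.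
Proof. exact: (measurableT_comp measurable_snd (@measurable_uncons_rV R n)). Qed.

Lemma direction_lipschitz (x y : 'rV[R]_n) : 0 < enorm y ->
  enorm (direction x - direction y) <= 2 / enorm y * enorm (x - y).
Proof.
move=> y0; have i0 : 0 < (enorm y)^-1 by rewrite invr_gt0.
have -> : direction x - direction y =
    ((enorm x)^-1 - (enorm y)^-1) *: x + (enorm y)^-1 *: (x - y).
  by rewrite /direction scalerBl scalerBr addrA subrK.
apply: le_trans (ler_enormD _ _) _; rewrite !enormZ (gtr0_norm i0).
have -> : 2 / enorm y * enorm (x - y) =
    (enorm y)^-1 * enorm (x - y) + (enorm y)^-1 * enorm (x - y) by ring.
rewrite lerD2r.
have := enorm_ge0 x; rewrite le_eqVlt => /predU1P[<-|x0].
  by rewrite mulr0 mulr_ge0 ?enorm_ge0// ltW.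
have -> : (enorm x)^-1 - (enorm y)^-1 =
    (enorm y)^-1 * ((enorm y - enorm x) / enorm x) by field; rewrite !gt_eqF.
rewrite normrM (gtr0_norm i0) -mulrA; apply: ler_wpM2l; first exact: ltW.
rewrite normrM (gtr0_norm (_ : 0 < (enorm x)^-1)) ?invr_gt0// divfK ?gt_eqF//.
by rewrite distrC; exact: ler_dist_enorm.
Qed.

(** A pair of a radius and a vector is encoded as the vector whose first entry is
    the radius, so that the results on densities over row vectors apply to it. *)
Definition ray_map (z : 'rV[R]_n.+1) : 'rV[R]_n := head_rV z *: direction (tail_rV z).

Lemma measurable_ray_map : measurable_fun setT ray_map.
Proof.
apply: measurable_scale2; first exact: measurable_head.
exact: (measurableT_comp (@measurable_direction R n) measurable_tail).
Qed.

(** The constant blows up as the vector part of [z] tends to 0, but not faster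
    than its inverse norm; only the base point [z] is constrained. *)
Lemma ray_map_lipschitz (z z' : 'rV[R]_n.+1) (r : R) :
  0 <= head_rV z <= r -> 0 < enorm (tail_rV z) ->
  enorm (ray_map z' - ray_map z) <=
  (1 + 2 * r / enorm (tail_rV z)) * enorm (z' - z).
Proof.
move=> /andP[h0 hr] x0.
have -> : ray_map z' - ray_map z =
    head_rV (z' - z) *: direction (tail_rV z') +
    head_rV z *: (direction (tail_rV z') - direction (tail_rV z)).
  by rewrite /ray_map headB scalerBl scalerBr addrA subrK.
apply: le_trans (ler_enormD _ _) _; rewrite mulrDl mul1r.
rewrite (enormZ (head_rV (z' - z))) (enormZ (head_rV z)); apply: lerD.
  apply: le_trans (head_le_enorm _); rewrite ler_piMr//.
  exact: enorm_direction_le1.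
rewrite ger0_norm//.
apply: le_trans (ler_wpM2l h0 (direction_lipschitz (tail_rV z') x0)) _.
rewrite mulrA; apply: ler_pM; rewrite ?enorm_ge0//.
- by rewrite mulr_ge0// divr_ge0// ltW.
- by rewrite mulrA [head_rV z * 2]mulrC ler_pM2r ?invr_gt0// ler_pM2l.
- by rewrite -tailB; exact: tail_le_enorm.
Qed.

End ray_coordinates.

(** * The case of dimension at least three *)

Section ray_measure.
Context {R : realType} {e : nat}.
Local Notation d := e.+2.
Local Notation n := d.+1.
Variables (mu : probability 'rV[R]_n R) (k : R -> R) (r : R).
Local Notation la := (lebesgue_rV (R := R) n).
Local Notation leb := (@lebesgue_measure R).
Local Notation RR := (measurableTypeR R).
Hypotheses (k0 : forall t, 0 <= k t) (kni : nonincreasing_fun k)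
  (klc : log_concave_on_nneg k) (r0 : 0 < r) (kr : forall t, 0 < k t -> t <= r).
Hypothesis muE : forall A, measurable A ->
  mu A = (\int[la]_(x in A) (k (enorm x))%:E)%E.

Let c : R := d%:R / (2 * r ^+ 2).
Let c0 : 0 < c.
Proof. by rewrite divr_gt0// mulr_gt0// exprn_gt0. Qed.

Let w := @radial_weight R d.
Let q := gaussian_weight c.

(** Up to normalization, the law of a pair of independent variables: the radius
    of [mu] and a Gaussian vector, whose direction is uniform. *)
Let p (z : 'rV[R]_n.+1) : R := w (head_rV z) * k (head_rV z) * q (enorm (tail_rV z)).

Let w0 t : 0 <= w t. Proof. exact: radial_weight_ge0. Qed.
Let q0 t : 0 < q t. Proof. exact: expR_gt0. Qed.

Let p0 z : 0 <= p z.
Proof. by rewrite mulr_ge0 ?(ltW (q0 _))// mulr_ge0. Qed.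

Let mk : measurable_fun [set: R] k.
Proof. exact: nonincreasing_measurable. Qed.

Let mq : measurable_fun [set: R] q.
Proof. exact: measurable_gaussian_weight. Qed.

Let mtn : measurable_fun [set: 'rV[R]_n.+1] (fun z => enorm (tail_rV z)).
Proof. exact: (measurableT_comp measurable_enorm measurable_tail). Qed.

Let mp : measurable_fun setT p.
Proof.
apply: measurable_funM; last exact: (measurableT_comp mq mtn).
apply: measurable_funM.
  exact: (measurableT_comp (@measurable_radial_weight R d) measurable_head).
exact: (measurableT_comp mk measurable_head).
Qed.

Let p_gt0 z : 0 < p z -> 0 < head_rV z <= r.
Proof.
rewrite pmulr_lgt0// => wk.
have h0 : 0 < head_rV z.
  by apply: (@radial_weight_gt0 R d); apply: contraTneq wk => e0;
    rewrite /w e0 mul0r ltxx.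
by rewrite h0 kr//; move: wk; rewrite pmulr_rgt0// /w /radial_weight h0 exprn_gt0.
Qed.

(** The two factors gain in orthogonal directions, the first through the radial
    weight and the second through the Gaussian, and [c] is chosen so that their
    constants agree; of the profile [k] only log-concavity is asked. *)
Let slcp : strongly_log_concave c p.
Proof.
move=> z z' t t01; have /andP[t0 t1] := t01.
have s0 : 0 < 1 - t by rewrite subr_gt0.
have [pz|pz] := ltP 0 (p z); last first.
  have -> : p z = 0 by apply/eqP; rewrite eq_le pz p0.
  by rewrite powR0 ?gt_eqF// !mul0r.
have [pz'|pz'] := ltP 0 (p z'); last first.
  have -> : p z' = 0 by apply/eqP; rewrite eq_le pz' p0.
  by rewrite (powR0 (x := 1 - t)) ?gt_eqF// mulr0 mul0r.
have hz := p_gt0 pz; have hz' := p_gt0 pz'.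
have /andP[hz0 _] := hz; have /andP[hz'0 _] := hz'.
rewrite /p head_combine tail_combine.
have slcw := radial_weight_strongly_log_concave d hz hz' t01.
have slck := klc (ltW hz0) (ltW hz'0) t01.
have slcq := gaussian_weight_combine c t (tail_rV z) (tail_rV z').
rewrite enorm_head_tail headB tailB mulrDr expRD.
rewrite !(powRM _ (mulr_ge0 (w0 _) (k0 _)) (ltW (q0 _))) !(powRM _ (w0 _) (k0 _)).
rewrite -/q in slcq; rewrite -slcq -/c -/w in slcw *.
set E1 := expR _ in slcw *; set E2 := expR _.
set wz := w (head_rV z) `^ t in slcw *; set wz' := w (head_rV z') `^ _ in slcw *.
set kz := k (head_rV z) `^ t in slck *; set kz' := k (head_rV z') `^ _ in slck *.
set qz := q _ `^ t; set qz' := q _ `^ (1 - t).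
have -> : wz * kz * qz * (wz' * kz' * qz') * (E1 * E2) =
    (wz * wz' * E1) * (kz * kz') * (qz * qz' * E2) by ring.
apply: ler_wpM2r; first by rewrite !mulr_ge0 ?powR_ge0 ?expR_ge0.
by apply: ler_pM => //; rewrite !mulr_ge0 ?powR_ge0 ?expR_ge0.
Qed.

Let m := density_measure (lebesgue_rV n.+1) mp p0.

Let mE A : measurable A -> m A = (\int[lebesgue_rV n.+1]_(x in A) (p x)%:E)%E.
Proof. by []. Qed.

Let mu_int (H : 'rV[R]_n -> \bar R) : measurable_fun setT H ->
  (forall x, 0 <= H x)%E ->
  (\int[mu]_x H x = \int[la]_x (H x * (k (enorm x))%:E))%E.
Proof.
move=> mH H0; rewrite (ge0_integral_density _ _ muE)//.
exact: (measurableT_comp mk measurable_enorm).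
Qed.

Let m_int (H : 'rV[R]_n -> \bar R) (h : R -> R) : measurable_fun setT H ->
  (forall x, 0 <= H x)%E -> measurable_fun setT h -> (forall t, 0 <= h t) ->
  (\int[m]_z (H (ray_map z) * (h (enorm (tail_rV z)))%:E) =
   \int[leb]_rho (w rho * (q rho * h rho))%:E * \int[mu]_x H x)%E.
Proof.
move=> mH H0 mh h0.
have mHh : measurable_fun setT
    (fun z => (H (ray_map z) * (h (enorm (tail_rV z)))%:E)%E).
  apply: emeasurable_funM; first exact: (measurableT_comp mH measurable_ray_map).
  by apply/measurable_EFinP; exact: (measurableT_comp mh mtn).
rewrite (ge0_integral_density mp p0 mE)//; last first.
  by move=> z; rewrite mule_ge0// lee_fin.
rewrite ge0_integral_lebesgue_rVS; last 2 first.
- by apply: emeasurable_funM => //; exact/measurable_EFinP.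
- by move=> z; rewrite mule_ge0// ?lee_fin// mule_ge0// lee_fin.
rewrite mu_int//.
rewrite -(@ge0_integral_ray R d H k (fun t => q t * h t))//; last 2 first.
- exact: measurable_funM.
- by move=> t; rewrite mulr_ge0// ltW.
apply: eq_integral => rho _; apply: eq_integral => x _.
rewrite /p /ray_map !head_cons !tail_cons -muleA -EFinM; congr (_ * _%:E)%E.
by rewrite /w; ring.
Qed.

Let J := fine (gaussian_moment c d).

Let JE : gaussian_moment c d = J%:E.
Proof.
by rewrite fineK// ge0_fin_numE ?gaussian_moment_lty// ltW ?gaussian_moment_gt0.
Qed.

Let J0 : 0 < J.
Proof. by rewrite -lte_fin -JE gaussian_moment_gt0. Qed.

Let m_int1 (H : 'rV[R]_n -> \bar R) : measurable_fun setT H ->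
  (forall x, 0 <= H x)%E ->
  (\int[m]_z H (ray_map z) = J%:E * \int[mu]_x H x)%E.
Proof.
move=> mH H0.
have m1 : measurable_fun [set: R] (fun=> 1 : R) by exact: measurable_cst.
have := m_int mH H0 m1 (fun=> ler01).
have -> : (\int[leb]_rho (w rho * (q rho * 1))%:E = J%:E)%E.
  by rewrite -JE; apply: eq_integral => rho _; rewrite mulr1.
by move=> <-; apply: eq_integral => z _; rewrite mule1.
Qed.

Let kap (z : 'rV[R]_n.+1) : R := 1 + 2 * r / enorm (tail_rV z).

Let mhk : measurable_fun [set: R] (fun t : R => (1 + 2 * r / t) ^+ 2).
Proof.
apply: measurable_funX; apply: measurable_funD => //; apply: measurable_funM => //.
exact: measurable_funV.
Qed.

(** The average of [kap ^ 2] under the Gaussian factor is of order one, because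
    the average of [|x|^-2] is of order [c / d], that is [1 / r^2]. *)
Let kap_moment :
  (\int[leb]_rho (w rho * (q rho * (1 + 2 * r / rho) ^+ 2))%:E <= (26 * J)%:E)%E.
Proof.
have mom i : measurable_fun [set: RR]
    (fun t : RR => (radial_weight i t * q t)%:E : \bar R).
  by apply/measurable_EFinP/measurable_funM => //; exact: measurable_radial_weight.
have mom0 i t : (0 <= (radial_weight i t * q t)%:E)%E.
  by rewrite lee_fin mulr_ge0 ?radial_weight_ge0// ltW.
have r2 : 0 <= 8 * r ^+ 2 by rewrite mulr_ge0// sqr_ge0.
apply: (@le_trans _ _ (2%:E * gaussian_moment c d +
    (8 * r ^+ 2)%:E * gaussian_moment c e)%E).
  rewrite /gaussian_moment -(ge0_integralZl leb measurableT (mom d))//.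
  rewrite -(ge0_integralZl leb measurableT (mom e)) ?lee_fin//.
  rewrite -ge0_integralD//; last 4 first.
  - by move=> t _; rewrite mule_ge0// lee_fin.
  - exact: (measurable_funeM _ (mom d)).
  - by move=> t _; rewrite mule_ge0// lee_fin.
  - exact: (measurable_funeM _ (mom e)).
  apply: ge0_le_integral => //.
  - by move=> t _; rewrite lee_fin mulr_ge0// mulr_ge0 ?sqr_ge0// ltW.
  - apply/measurable_EFinP; apply: measurable_funM.
      exact: measurable_radial_weight.
    exact: measurable_funM.
  - by apply: emeasurable_funD;
      [exact: (measurable_funeM _ (mom d))|exact: (measurable_funeM _ (mom e))].
  move=> t _; rewrite -!EFinM -EFinD lee_fin /w /radial_weight.
  case: ifPn => [t0|_]; last by rewrite !mul0r !mulr0 addr0.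
  have td : t ^+ d = t ^+ e * t ^+ 2 by rewrite -exprD addn2.
  have -> : t ^+ d * (q t * (1 + 2 * r / t) ^+ 2) =
      t ^+ e * q t * (t + 2 * r) ^+ 2.
    by rewrite td; field; rewrite gt_eqF.
  have -> : 2 * (t ^+ d * q t) + 8 * r ^+ 2 * (t ^+ e * q t) =
      t ^+ e * q t * (2 * t ^+ 2 + 8 * r ^+ 2) by rewrite td; ring.
  apply: ler_wpM2l; first by rewrite mulr_ge0 ?exprn_ge0// ltW.
  by have := sqr_ge0 (t - 2 * r); lra.
have Je : gaussian_moment c e = (fine (gaussian_moment c e))%:E.
  by rewrite fineK// ge0_fin_numE ?gaussian_moment_lty// ltW ?gaussian_moment_gt0.
have := gaussian_moment_ratio c0 e; rewrite Je JE.
set J' := fine (gaussian_moment c e); rewrite -!EFinM -EFinD !lee_fin => h.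
have r20 : 0 < r ^+ 2 by rewrite exprn_gt0.
have h' : 8 * r ^+ 2 * (e.+1%:R * J') <= 12 * d%:R * J.
  have := ler_wpM2l r2 h; rewrite /c.
  have -> : 8 * r ^+ 2 * (3 * (d%:R / (2 * r ^+ 2)) * J) = 12 * d%:R * J.
    by field; rewrite gt_eqF.
  by [].
have d2 : d%:R <= 2 * e.+1%:R :> R by rewrite -natrM ler_nat mul2n -addnn addSnnS leq_addl.
have e10 : 0 < e.+1%:R :> R by rewrite ltr0n.
rewrite -(ler_pM2l e10).
have := ler_wpM2r (ltW J0) d2; lra.
Qed.

Let kap_ge0 z : 0 <= kap z.
Proof. by rewrite addr_ge0// divr_ge0 ?enorm_ge0// mulr_ge0// ltW. Qed.

Let mu_le (H : 'rV[R]_n -> \bar R) : measurable_fun setT H ->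
  (forall x, 0 <= H x)%E ->
  (\int[mu]_x H x <= J^-1%:E * \int[m]_z H (ray_map z))%E.
Proof.
by move=> mH H0; rewrite m_int1// muleA -EFinM mulVf ?gt_eqF// mul1e.
Qed.

Let mu_ge (H : 'rV[R]_n -> \bar R) : measurable_fun setT H ->
  (forall x, 0 <= H x)%E ->
  (\int[m]_z (H (ray_map z) * (kap z ^+ 2)%:E) <= (26 * J)%:E * \int[mu]_x H x)%E.
Proof.
move=> mH H0.
rewrite (@m_int H (fun t => (1 + 2 * r / t) ^+ 2))//; last by move=> t; exact: sqr_ge0.
by apply: lee_wpmul2r; [exact: integral_ge0|exact: kap_moment].
Qed.

(** The image of [m] under [ray_map] is [J] times [mu], so that the constant is
    [2 / c] times 26, the bound on the average of the squared Lipschitz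
    constant. *)
Lemma log_sobolev_ray : log_sobolev mu (104 * r ^+ 2 / d%:R).
Proof.
move=> f sf.
have one0 (x : 'rV[R]_n) : (0 <= (1 : \bar R))%E by [].
have mc : measurable_fun [set: 'rV[R]_n] (fun=> 1%E : \bar R).
  exact: measurable_cst.
have mu1 : (\int[mu]_x 1 = 1)%E.
  by rewrite integral_cst// mul1e; exact: probability_setT.
have mT : m setT = J%:E.
  have := m_int1 mc one0; rewrite mu1 mule1 => <-.
  by rewrite integral_cst// mul1e.
have moo : (m setT < +oo)%E by rewrite mT ltry.
have m0 : (0 < m setT)%E by rewrite mT lte_fin.
have mkap : measurable_fun setT kap.
  apply: measurable_funD => //; apply: measurable_funM => //.
  exact: measurable_funV.
have ikap : m.-integrable setT (EFin \o (fun z => kap z ^+ 2)).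
  apply/integrableP; split; first by apply/measurable_EFinP; exact: measurable_funX.
  under eq_integral do rewrite /= ger0_norm ?sqr_ge0//.
  have := mu_ge mc one0; rewrite mu1 mule1.
  under eq_integral do rewrite mul1e.
  by move=> /le_lt_trans; apply; rewrite ltry.
pose D (z : 'rV[R]_n.+1) : bool := 0 < enorm (tail_rV z).
have mD : measurable_fun setT D by exact: measurable_fun_ltr.
have Dnull : m [set z | ~~ D z] = 0%E.
  have mDc : measurable [set z | ~~ D z].
    rewrite (_ : [set z | ~~ D z] = setT `&` D @^-1` [set false]); first exact: mD.
    by apply/seteqP; split=> x /=; [move=> /negbTE ->|case=> _ ->].
  have mI : measurable_fun setT (fun z => (\1_[set z | ~~ D z] z * p z)%:E : \bar R).
    by apply/measurable_EFinP; exact: measurable_funM.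
  rewrite mE// integral_mkcond.
  transitivity (\int[lebesgue_rV n.+1]_z (\1_[set z | ~~ D z] z * p z)%:E)%E.
    apply: eq_integral => z _; rewrite patchE indicE.
    by case: ifPn => _; rewrite ?mul1r ?mul0r.
  rewrite ge0_integral_lebesgue_rVS//; last first.
    by move=> z; rewrite lee_fin mulr_ge0.
  apply: integral0_eq => rho _.
  have mcr := @measurable_cons_rVr R n rho.
  transitivity (\int[la]_x (0 : \bar R))%E; last by rewrite integral0.
  apply: ge0_ae_eq_integral => //.
  - exact: (measurableT_comp mI mcr).
  - by move=> x _; rewrite lee_fin mulr_ge0.
  - apply: filterS (@ae_enorm_gt0 R d) => x x0 _.
    by rewrite indicE memNset ?mul0r//= /D tail_cons x0.
have Phi_ball z : 0 < p z -> enorm (ray_map z) <= r.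
  move=> /p_gt0/andP[h0 hr]; rewrite /ray_map enormZ (gtr0_norm h0).
  apply: le_trans hr; rewrite ler_piMr ?(ltW h0)//.
  exact: enorm_direction_le1.
have Phi_lip z' z : 0 < p z' -> 0 < p z -> D z ->
    enorm (ray_map z' - ray_map z) <= kap z * enorm (z' - z).
  move=> _ /p_gt0/andP[h0 hr] Dz; apply: ray_map_lipschitz => //.
  by rewrite (ltW h0).
have Ji0 : 0 < J^-1 by rewrite invr_gt0.
have J26 : 0 < 26 * J by rewrite mulr_gt0.
have := @log_sobolev_entropy_le R n.+1 n c p m c0 mp p0 slcp mE moo m0
  (@ray_map R n) kap D r (@measurable_ray_map R n) mkap mD kap_ge0 Dnull
  Phi_ball Phi_lip ikap mu J^-1 (26 * J) Ji0 J26 mu_le mu_ge f sf.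
have -> // : 2 * J^-1 * (26 * J) / c = 104 * r ^+ 2 / d%:R.
by rewrite /c; field; rewrite !gt_eqF// exprn_gt0.
Qed.

End ray_measure.

(** * The radius of the support and the log-Sobolev constant *)

Section support.
Context {R : realType}.

Lemma enorm_le_entries n (z : 'rV[R]_n) (e : R) :
  (forall i, `|z ord0 i| <= e) -> enorm z <= n%:R * e.
Proof.
case: n z => [|n] z ze; first by rewrite mul0r /enorm big_ord0 sqrtr0.
have e0 : 0 <= e by exact: le_trans (normr_ge0 _) (ze ord0).
rewrite -(@ler_pXn2r _ 2)// ?nnegrE ?enorm_ge0 ?mulr_ge0// enorm_sq.
apply: (@le_trans _ _ (\sum_(i < n.+1) e ^+ 2)).
  apply: ler_sum => i _; rewrite -[leLHS]real_normK ?num_real//.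
  by rewrite ler_pXn2r ?nnegrE.
rewrite sumr_const card_ord -[leLHS]mulr_natl exprMn.
apply: ler_wpM2r; first exact: sqr_ge0.
by rewrite -natrX ler_nat leq_pmulr.
Qed.

Lemma lebesgue_rV_ball_gt0 n (x : 'rV[R]_n) (e : R) : 0 < e ->
  (0 < lebesgue_rV n (ball x e))%E.
Proof.
move=> e0.
have -> : ball x e = [set y : 'rV[R]_n | forall i, ball (x ord0 i) e (y ord0 i)].
  apply/seteqP; split=> y /=; first by move=> [_ xy] i; exact: xy.
  by move=> xy; split=> // i j; rewrite (ord1 i).
rewrite (@lebesgue_rV_box R n (fun i => ball (x ord0 i) e)); last first.
  by move=> i; rewrite ball_itv; exact: measurable_itv.
elim/big_ind : _ => [|a b a0 b0|i _]; [exact: lte01|exact: mule_gt0|].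
by rewrite ball_itv lebesgue_measure_itv /= lte_fin -EFinB ifT ?lte_fin; lra.
Qed.

Variables (n : nat) (mu : probability 'rV[R]_n.+1 R) (k : R -> R).
Local Notation la := (lebesgue_rV (R := R) n.+1).
Hypotheses (k0 : forall t, 0 <= k t) (kni : nonincreasing_fun k).
Hypothesis muE : forall A, measurable A ->
  mu A = (\int[la]_(x in A) (k (enorm x))%:E)%E.

Let mke : measurable_fun [set: 'rV[R]_n.+1] (fun x => (k (enorm x))%:E : \bar R).
Proof.
apply/measurable_EFinP; apply: (measurableT_comp _ measurable_enorm).
exact: nonincreasing_measurable.
Qed.

(** The density is at least [k t] on small balls around [x]. *)
Lemma radial_support (t : R) (x : 'rV[R]_n.+1) :
  0 < k t -> enorm x < t -> msupport mu x.
Proof.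
move=> kt xt U oU Ux.
have /nbhs_ballP[e /= e0 eU] := oU x Ux.
pose e' := Num.min e ((t - enorm x) / n.+2%:R).
have d0 : 0 < (t - enorm x) / n.+2%:R by rewrite divr_gt0// subr_gt0.
have e'0 : 0 < e' by rewrite lt_min e0.
have e'e : e' <= e by rewrite ge_min lexx.
have e't : e' * n.+2%:R <= t - enorm x.
  by rewrite -ler_pdivlMr// /e' ge_min lexx orbT.
have mB : measurable (ball x e' : set 'rV[R]_n.+1).
  by apply: open_measurable_rV; exact: ball_open.
have BU : ball x e' `<=` U by apply: subset_trans eU; exact: le_ball.
have Bt y : ball x e' y -> enorm y <= t.
  move=> [_ xy].
  have h : enorm (y - x) <= n.+1%:R * e'.
    apply: enorm_le_entries => i; rewrite !mxE distrC; apply/ltW.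
    exact: (xy ord0 i).
  have := ler_enormD x (y - x); rewrite addrC subrK.
  move: e't; rewrite -[n.+2]addn1 natrD mulrDr mulr1; lra.
apply: (@lt_le_trans _ _ (mu (ball x e'))); last first.
  by apply: le_measure; rewrite ?inE//; exact: open_measurable_rV.
rewrite muE//; apply: (@lt_le_trans _ _ (\int[la]_(y in ball x e') (k t)%:E)%E).
  by rewrite integral_cst// mule_gt0 ?lte_fin// lebesgue_rV_ball_gt0.
apply: ge0_le_integral => //.
- by move=> y _; rewrite lee_fin.
- exact: measurable_funTS.
- by move=> y By; rewrite lee_fin; apply: kni; exact: Bt.
Qed.

(** The support contains 0 and points at every distance [s < t] from it. *)
Lemma radius_le_diam (t : R) : 0 < t -> 0 < k t -> (t%:E <= diam (msupport mu))%E.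
Proof.
move=> t0 kt.
have lower (s : R) : 0 < s < t -> (s%:E <= diam (msupport mu))%E.
  move=> /andP[s0 st].
  have es : enorm (s *: delta_mx ord0 ord0 : 'rV[R]_n.+1) = s.
    rewrite enormZ gtr0_norm// -[RHS]mulr1; congr (_ * _).
    apply/eqP; rewrite -(@eqrXn2 _ 2)// ?enorm_ge0// enorm_sq expr1n.
    rewrite (bigD1 ord0)//= big1 => [|i /negbTE i0]; rewrite !mxE ?eqxx ?i0.
      by rewrite expr1n addr0.
    by rewrite expr0n.
  apply: ereal_sup_ubound; exists (s *: delta_mx ord0 ord0).
    by apply: (radial_support kt); rewrite es.
  exists 0; first by apply: (radial_support kt); rewrite enorm0.
  by rewrite subr0 es.
rewrite leNgt; apply/negP => Dt.
have := lower (t / 2); have t2 : 0 < t / 2 < t by apply/andP; split; lra.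
move=> /(_ t2); case: (diam _) Dt lower => [D| |] // Dt lower.
rewrite lee_fin => D2; rewrite lte_fin in Dt.
have := lower ((D + t) / 2); have h : 0 < (D + t) / 2 < t by apply/andP; split; lra.
by move=> /(_ h); rewrite lee_fin; lra.
Qed.

Lemma radius_exists : exists2 t, 0 < t & 0 < k t.
Proof.
apply: contrapT => nk.
have : mu setT = 1%E by exact: probability_setT.
rewrite muE//; have -> : (\int[la]_x (k (enorm x))%:E = 0)%E; last first.
  by move/esym/eqP; rewrite onee_eq0.
transitivity (\int[la]_x (0 : \bar R))%E; last by rewrite integral0.
apply: ge0_ae_eq_integral => //; first by move=> x _; rewrite lee_fin.
apply: filterS (@ae_enorm_gt0 R n) => x x0 _; congr _%:E.
apply/eqP; rewrite eq_le k0 andbT leNgt; apply/negP => kx; apply: nk.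
by exists (enorm x).
Qed.

End support.

Lemma C_LS_le {R : realType} n (mu : probability 'rV[R]_n R) (c : R) :
  0 <= c -> log_sobolev mu c -> (C_LS mu <= c%:E)%E.
Proof. by move=> c0 lc; apply: ereal_inf_lbound; exists c. Qed.

Theorem theorem1p2 (R : realType) :
  exists C : R, forall (n : nat) (mu : probability 'rV[R]_n R),
    (2 <= n)%N -> radial_log_concave mu -> bounded_set (msupport mu) ->
    (C_LS mu <= C%:E * diam (msupport mu) ^+ 2 * ((n%:R - 1)^-1)%:E)%E.
Proof.
pose C : R := 2 * expR 2^-1 + 104.
have e0 := expR_gt0 (2^-1 : R).
have C0 : 0 < C by rewrite /C; lra.
exists C => n mu n2 [V [Voo Vconvex Vmono muV]] _.
pose k := radial_profile V.
have k0 := radial_profile_ge0 V : forall t, 0 <= k t.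
have kni := radial_profile_nonincreasing Voo Vmono.
have klc := radial_profile_log_concave Voo Vconvex.
have muE A : measurable A ->
    mu A = (\int[lebesgue_rV n]_(x in A) (k (enorm x))%:E)%E.
  move=> mA; rewrite muV//; apply: eq_integral => x _.
  by rewrite EFin_radial_profile// enorm_ge0.
case: n => [//|n] in mu n2 muV muE *.
have rD := radius_le_diam k0 kni muE.
have [t t0 kt] := radius_exists k0 kni muE.
have d0 : 0 < (n.+1%:R - 1 : R) by rewrite subr_gt0 ltr1n.
have := rD t t0 kt; move: rD; case: (diam _) => [r| |] // rD tD; last first.
  by rewrite expe2 mulyy gt0_muley ?lte_fin// gt0_mulye ?lte_fin ?invr_gt0// leey.
have r0 : 0 < r by rewrite lee_fin in tD; exact: lt_le_trans tD.
have kr u : 0 < k u -> u <= r.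
  have [u0 _|u0 ku] := leP u 0; first exact: le_trans u0 (ltW r0).
  by have := rD u u0 ku; rewrite lee_fin.
have r20 : 0 <= r ^+ 2 by exact: sqr_ge0.
rewrite -EFin_expe -!EFinM.
have bound (c : R) : 0 <= c -> log_sobolev mu c ->
    c <= C * r ^+ 2 / (n.+1%:R - 1) ->
    (C_LS mu <= (C * r ^+ 2 / (n.+1%:R - 1))%:E)%E.
  by move=> c0 lc cC; apply: le_trans (C_LS_le c0 lc) _; rewrite lee_fin.
(* The Gaussian average of [|x|^-2] is infinite in the plane, hence the two
   cases. *)
case: n => [|[|e]] in mu n2 muV muE rD d0 bound *; first by [].
- apply: (bound (2 * expR 2^-1 * r ^+ 2)).
  + by rewrite !mulr_ge0// ltW.
  + exact: log_sobolev_perturbation.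
  + rewrite (_ : 2%:R - 1 = 1 :> R); last by rewrite -[2%:R]/(1 + 1) addrK.
    by rewrite divr1; apply: ler_wpM2r => //; rewrite /C; lra.
- apply: (bound (104 * r ^+ 2 / e.+2%:R)).
  + by rewrite divr_ge0// mulr_ge0.
  + exact: log_sobolev_ray.
  + rewrite (_ : e.+3%:R - 1 = e.+2%:R :> R); last by rewrite -natr1 addrK.
    by apply: ler_wpM2r; [rewrite invr_ge0|apply: ler_wpM2r => //; rewrite /C; lra].
Qed.
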